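(* Let $\lambda\ge0$ and $\sigma>0$. 1. If $G(\sigma)>F(\lambda)$, then for every $\varepsilon>0$ there exists $\delta>0$ such that for all $N$ sufficiently large, $$\mu_N\Big(\sup_{u\in[0,2]}\Big|\tfrac1N\xi_{\lceil uN\rceil}-M_\sigma(u)\Big|>\varepsilon\Big)\le e^{-\delta N}.$$ 2. If $G(\sigma)<F(\lambda)$, then for every $\varepsilon>0$ there exists $\delta>0$ such that for all $N$ sufficiently large, $$\mu_N\Big(\sup_{x\in\{0,\dots,2N\}}\xi_x>\varepsilon N\Big)\le e^{-\delta N}.$$ 3. If $G(\sigma)=F(\lambda)$, then for every $\varepsilon>0$ and all $N$ sufficiently large, $$\frac{1}{C\sqrt N}\le\mu_N\Big(\sup_{x\in\{0,\dots,2N\}}\xi_x>\varepsilon N\Big)\le\frac{C}{\sqrt N},$$ where $C>0$ is a constant, and furthermore there exists $\delta>0$ such that $$\mu_N\Big(\sup_{x\in\{0,\dots,2N\}}\xi_x>\varepsilon N\ \text{ and }\ \sup_{u\in[0,2]}\Big|\tfrac1N\xi_{\lceil uN\rceil}-M_\sigma(u)\Big|>\varepsilon\Big)\le e^{-\delta N}.$$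
   Context: For $N\ge1$ let $\Omega_N=\{\xi\in\mathbb Z_+^{2N+1}:\ \xi_0=\xi_{2N}=0,\ |\xi_x-\xi_{x-1}|=1\ \text{for all } x\in\{1,\dots,2N\}\}$, with $\xi=(\xi_0,\dots,\xi_{2N})$ and $\mathbb Z_+=\{0,1,2,\dots\}$. Set $H(\xi)=\#\{x\in\{1,\dots,2N-1\}:\xi_x=0\}$ and $A(\xi)=\sum_{x=1}^{2N}\xi_x$. For $\lambda\ge0$, $\sigma\in\mathbb R$, let $Z_N(\lambda,\sigma)=2^{-2N}\sum_{\xi\in\Omega_N}\lambda^{H(\xi)}\exp(\frac{\sigma}{N}A(\xi))$ (with $0^0=1$) and let $\mu_N=\mu_N^{\lambda,\sigma}$ be the probability on $\Omega_N$ given by $$\mu_N(\xi)=\frac{2^{-2N}\lambda^{H(\xi)}\exp(\frac{\sigma}{N}A(\xi))}{Z_N(\lambda,\sigma)}.$$ $F(\lambda)=\log\big(\frac{\lambda}{2\sqrt{\lambda-1}}\big)$ if $\lambda>2$, $F(\lambda)=0$ if $0\le\lambda\le2$; $G(\sigma)=\int_0^1\log\cosh(\sigma(1-2x))\,dx$; and for $u\in[0,2]$, $$M_\sigma(u)=\int_0^u\tanh(\sigma(1-x))\,dx=\frac1\sigma\log\frac{\cosh\sigma}{\cosh(\sigma(1-u))}.$$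
   Formalization: In part 3 the lower bound 1/(C√N) is stated only for 0 < ε < M_σ(1), the maximum of the profile, since for ε ≥ 1 the event is empty and for ε > M_σ(1) it is exponentially unlikely; the borderline value ε = M_σ(1) is left out. *)

(* Defs.v *)
From HB Require Import structures.
From mathcomp Require Import all_boot all_order all_algebra.
From mathcomp Require Import all_classical all_reals all_analysis.
From mathcomp Require Import zify.

Set Implicit Arguments.
Unset Strict Implicit.
Unset Printing Implicit Defensive.

Import Order.TTheory GRing.Theory Num.Theory.
Import numFieldNormedType.Exports.

Local Open Scope ring_scope.

(* Heights are truncated at 2N so that paths form a finite type.  This loses
   nothing: a +/-1 path from 0 of length 2N has height at most 2N, see
   [Omega_complete]. *)
Definition zpath N := {ffun 'I_(2 * N).+1 -> 'I_(2 * N).+1}.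

(* [|(a%:Z - b%:Z)%R|%N] is the absolute difference of the naturals a and b;
   for x : 'I_(2N), [widen_ord _ x] and [lift ord0 x] are x and x + 1. *)
Definition Omega N : {set zpath N} :=
  [set xi : zpath N |
    [&& (xi ord0 == 0 :> nat)%N, (xi ord_max == 0 :> nat)%N &
        [forall x : 'I_(2 * N),
          `|((xi (lift ord0 x) : nat)%:Z
             - (xi (widen_ord (leqnSn _) x) : nat)%:Z)%R|%N == 1%N]]].

Lemma Omega_complete N (f : nat -> nat) :
  f 0%N = 0%N -> f (2 * N)%N = 0%N ->
  (forall x, (x < 2 * N)%N -> `|((f x.+1)%:Z - (f x)%:Z)%R|%N = 1%N) ->
  exists2 xi : zpath N, xi \in Omega N & forall x, xi x = f x :> nat.
Proof.
move=> f0 f2N fS.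
have fx x : (x <= 2 * N)%N -> (f x <= x)%N.
  elim: x => [|x IH] hx; first by rewrite f0.
  have := fS _ hx; have := IH (ltnW hx); lia.
have fi (x : 'I_(2 * N).+1) : (f x < (2 * N).+1)%N.
  by rewrite ltnS (leq_trans (fx x _)) // -ltnS.
exists [ffun x => Ordinal (fi x)]; last by move=> x; rewrite ffunE.
rewrite inE !ffunE /= f0 f2N !eqxx /=.
by apply/forallP => x; rewrite !ffunE /= /bump /= add1n fS.
Qed.

Definition H N (xi : zpath N) : nat :=
  #|[pred x : 'I_(2 * N).+1 | (0 < x < 2 * N)%N && (xi x == 0 :> nat)%N]|.

Definition A N (xi : zpath N) : nat :=
  (\sum_(x : 'I_(2 * N).+1 | (0 < x)%N) (xi x : nat))%N.

Local Open Scope classical_set_scope.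
Local Open Scope ring_scope.

Section Polymer.
Variable R : realType.
Implicit Types lambda sigma u : R.

Definition weight lambda sigma N (xi : zpath N) : R :=
  (2 ^+ (2 * N))^-1 * lambda ^+ H xi * expR (sigma / N%:R * (A xi)%:R).

Definition Z lambda sigma N : R := \sum_(xi in Omega N) weight lambda sigma xi.

Definition mu lambda sigma N (E : pred (zpath N)) : R :=
  \sum_(xi in Omega N | E xi) (weight lambda sigma xi / Z lambda sigma N).

Definition cosh (x : R) : R := (expR x + expR (- x)) / 2.
Definition sinh (x : R) : R := (expR x - expR (- x)) / 2.
Definition tanh (x : R) : R := sinh x / cosh x.

Definition F lambda : R :=
  if 2 < lambda then ln (lambda / (2 * Num.sqrt (lambda - 1))) else 0.

Definition G sigma : R :=
  (\int[lebesgue_measure]_(x in `[0, 1]) ln (cosh (sigma * (1 - 2 * x))))%R.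

(* For sigma > 0, [M sigma] is nonnegative on [0, 2] and symmetric about 1, where
   it is maximal: [M sigma 1] is the peak of the macroscopic profile.  Under
   [mu], heights above eps N with eps > M sigma 1 are exponentially unlikely in
   the regimes F < G and F = G (and impossible for eps >= 1), so a polynomial
   lower bound on the probability of such heights requires eps below the peak.
 *)
Definition M sigma u : R :=
  (\int[lebesgue_measure]_(x in `[0, u]) tanh (sigma * (1 - x)))%R.

Definition height N (xi : zpath N) : nat := (\max_x (xi x : nat))%N.

(* For u in [0, 2] the index ceil (u N) lies in {0, ..., 2N}, so neither
   [absz] nor [inord] alters it. *)
Definition rescaled N (xi : zpath N) u : R :=
  (xi (inord `|Num.ceil (u * N%:R)|%N) : nat)%:R / N%:R.

(* The set is nonempty and bounded, so this is a genuine supremum. *)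
Definition deviation sigma N (xi : zpath N) : R :=
  sup [set `|rescaled xi u - M sigma u| | u in `[0, 2]].

End Polymer.

(* Main.v *)
Require Import Defs.
From HB Require Import structures.
From mathcomp Require Import all_boot all_order all_algebra.
From mathcomp Require Import all_classical all_reals all_analysis.
From mathcomp Require Import ring lra zify.

Set Implicit Arguments.
Unset Strict Implicit.
Unset Printing Implicit Defensive.

Import Order.TTheory GRing.Theory Num.Theory.
Import numFieldNormedType.Exports.

Local Open Scope classical_set_scope.
Local Open Scope ring_scope.

(** Write [h = sigma / N] for the field per site. The argument compares two
    strategies: one excursion of macroscopic shape over the whole time interval,
    of weight [exp (2 N G) / sqrt N], and the pinned phase, of weight
    [exp (2 N F)].

    Excursions. A linear field is integrable: [exp ((h j - c) x) * prod_i
    cosh (h i - c)] solves the backward recursion of the paths with [j] steps left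
    exactly, for every [c] ([tiltedS]). With the tilt [c] of a bridge the weight
    of an excursion of [n] steps is at most [prod_i cosh (h (i - (n + 1) / 2))]
    ([exc_le]), which by the midpoint rule and convexity of [lcosh] is at most
    [exp (n ^ 2 G / (2 N))] ([ltilt_le_sqr]). Changing [c] before the time of a
    deviation is Chernoff's bound, with a Gaussian gain ([exc_le_dev]); the mean
    position under the tilted law is the Riemann sum of [tanh] that tends to [M]
    ([drift_profile]).

    Sharp constants. Dividing by the exact solution gives a random walk killed at
    the wall. The killed recursion is self-adjoint for the weight [exp (h x)] and a
    bridge is symmetric, so an excursion of [2 k] steps is the bridge constant times
    the sum of the squares of the law of the killed walk at time [k]
    ([exc_square]). Nash's inequality bounds this sum by [C / sqrt k]
    ([exc_le_sharp]). Conversely the walk survives with positive probability (an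
    exponential martingale) and concentrates in a window of width [sqrt N] around
    [N M(1)], so by Cauchy-Schwarz the sum over heights above [eps N] is at least
    [c / sqrt N] ([exc_ge]).

    Pinned phase. Let [F0] be a rate at which the renewal measure of the contacts,
    discounted, has mass at most [1], and [D >= 0] with [G <= F0 + D]. The renewal
    equation then gives [Y m <= C exp (m F0 + D m ^ 2 / (2 N))] uniformly in [N]:
    excursions that are not long hardly feel the field, and long ones are
    exponentially disfavoured ([Y_le]). For [lam > 2] the invariant measure of the
    pinned walk gives the matching lower bound [c exp (2 N F)] without field
    ([Y_ge]), which the positive field can only increase.

    Regimes. If [F < G], take [F0] between them (or equal to [F]) and look at the
    excursion straddling mid-time: it loses exponentially if it does not nearly
    fill the system, because the excess [D m ^ 2] is superadditive; if it does, a
    deviation from [M] is paid by Chernoff's bound. If [G < F], an excursion of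
    [n >= eps N] steps replaces [n F] by at most [n G]. If [G = F], the loss
    [F n (2 N - n) / (2 N)] gives a geometric factor in the number of steps
    that a long excursion leaves uncovered, and the sharp constants give the
    order [1 / sqrt N] on both sides. *)

(** * Hyperbolic functions *)

Section Hyperbolic.
Variable R : realType.
Implicit Types a b d t v x : R.

Lemma cosh_gt0 x : 0 < cosh x.
Proof. by rewrite /cosh divr_gt0 // addr_gt0 ?expR_gt0. Qed.

Lemma cosh_neq0 x : cosh x != 0.
Proof. by rewrite gt_eqF ?cosh_gt0. Qed.

Lemma coshN x : cosh (- x) = cosh x.
Proof. by rewrite /cosh opprK addrC. Qed.

Lemma cosh0 : cosh 0 = 1 :> R.
Proof. by rewrite /cosh oppr0 expR0 -mulr2n -mulr_natr mul1r divff // pnatr_eq0. Qed.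

Lemma sqr_cosh_sinh x : cosh x ^+ 2 - sinh x ^+ 2 = 1.
Proof.
rewrite /cosh /sinh; have := expRxMexpNx_1 x.
set y := expR x; set z := expR (- x) => yz.
have -> : ((y + z) / 2) ^+ 2 - ((y - z) / 2) ^+ 2 = y * z by field.
by [].
Qed.

Lemma cosh_ge1 x : 1 <= cosh x.
Proof.
have h := sqr_cosh_sinh x; have c0 := cosh_gt0 x.
have : 1 <= cosh x ^+ 2 by have := sqr_ge0 (sinh x); lra.
by rewrite -[X in X <= _](expr1n _ 2) ler_pXn2r // ?nnegrE // ltW.
Qed.

Lemma cosh_gt1 x : x != 0 -> 1 < cosh x.
Proof.
move=> x0; have := expR_gt1Dx x0.
have := @expR_gt1Dx _ (- x); rewrite oppr_eq0 => /(_ x0) h1 h2.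
by rewrite /cosh ltr_pdivlMr //; lra.
Qed.

Lemma expR_cosh_sinh x : expR x = cosh x + sinh x.
Proof. by rewrite /cosh /sinh; field. Qed.

Lemma sinhE x : sinh x = tanh x * cosh x.
Proof. by rewrite /tanh divfK ?cosh_neq0. Qed.

Lemma expR_tanh x : expR x = cosh x * (1 + tanh x).
Proof. by rewrite expR_cosh_sinh sinhE; ring. Qed.

Lemma tanhN x : tanh (- x) = - tanh x.
Proof. by rewrite /tanh coshN -mulNr /sinh -mulNr opprB opprK. Qed.

Lemma tanh0 : tanh 0 = 0 :> R.
Proof. by rewrite /tanh /sinh oppr0 subrr !mul0r. Qed.

Lemma tanh_lt1 x : tanh x < 1.
Proof.
rewrite /tanh ltr_pdivrMr ?cosh_gt0 // mul1r /sinh /cosh.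
by rewrite ltr_pM2r //; have := expR_gt0 (- x); lra.
Qed.

Lemma tanh_gtN1 x : -1 < tanh x.
Proof. by have := tanh_lt1 (- x); rewrite tanhN; lra. Qed.

Lemma sqr_tanh x : 1 - tanh x ^+ 2 = (cosh x ^+ 2)^-1.
Proof.
have h := sqr_cosh_sinh x; have c0 := cosh_neq0 x.
rewrite /tanh; have -> : 1 - (sinh x / cosh x) ^+ 2 =
  (cosh x ^+ 2 - sinh x ^+ 2) / cosh x ^+ 2 by field.
by rewrite h div1r.
Qed.

Lemma is_derive_cosh x : is_derive x 1 (@cosh R) (sinh x).
Proof.
rewrite /sinh; have -> : @cosh R = (fun y => (expR y + expR (- y)) * 2^-1) by [].
apply: is_derive_eq; rewrite /=.
by rewrite !scaler0 ?addr0 /GRing.scale /= ; field.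
Qed.

Lemma is_derive_sinh x : is_derive x 1 (@sinh R) (cosh x).
Proof.
rewrite /cosh; have -> : @sinh R = (fun y => (expR y - expR (- y)) * 2^-1) by [].
apply: is_derive_eq; rewrite /=.
by rewrite !scaler0 ?addr0 /GRing.scale /= ; field.
Qed.

Lemma is_derive_tanh x : is_derive x 1 (@tanh R) (1 - tanh x ^+ 2).
Proof.
have dc := is_derive_cosh x; have ds := is_derive_sinh x.
have dV := is_deriveV (cosh_neq0 x) dc.
have := @is_deriveM _ _ _ _ _ _ _ _ ds dV.
rewrite /GRing.scale /= => h; apply: (is_derive_eq h).
by rewrite /tanh; have c0 := cosh_neq0 x; rewrite -exprVn; field.
Qed.

Definition lcosh x : R := ln (cosh x).

Lemma expR_lcosh x : expR (lcosh x) = cosh x.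
Proof. by rewrite /lcosh lnK // posrE cosh_gt0. Qed.

Lemma is_derive_lcosh x : is_derive x 1 lcosh (tanh x).
Proof.
have dc := is_derive_cosh x; have dl := is_derive1_ln (cosh_gt0 x).
have h := @is_derive1_comp R (@ln R) (@cosh R) x _ _ dl dc.
by apply: (is_derive_eq h); rewrite /tanh mulrC.
Qed.

Lemma continuous_tanh : continuous (@tanh R).
Proof.
move=> x; apply: differentiable_continuous; apply/derivable1_diffP.
by have [] := is_derive_tanh x.
Qed.

Lemma continuous_lcosh : continuous lcosh.
Proof.
move=> x; apply: differentiable_continuous; apply/derivable1_diffP.
by have [] := is_derive_lcosh x.
Qed.

Lemma is_derive_ge0_le (f df : R -> R) a b : a <= b ->
  (forall x, is_derive x 1 f (df x)) ->
  (forall x, a <= x <= b -> 0 <= df x) -> f a <= f b.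
Proof.
move=> ab fdf df0.
have cf : {within `[a, b], continuous f}.
  apply: continuous_subspaceT => x; apply: differentiable_continuous.
  by apply/derivable1_diffP; have [] := fdf x.
have [c cab e] := @MVT_segment R f df a b ab (fun x _ => fdf x) cf.
by rewrite -subr_ge0 e mulr_ge0 ?subr_ge0 // df0.
Qed.

Lemma tanh_le a b : a <= b -> tanh a <= tanh b.
Proof.
move=> ab; apply: (is_derive_ge0_le ab is_derive_tanh) => x _.
by rewrite sqr_tanh invr_ge0 sqr_ge0.
Qed.

Lemma tanh_ge0 a : 0 <= a -> 0 <= tanh a.
Proof. by move=> /tanh_le; rewrite tanh0. Qed.

Lemma tanh_sub_le a b : a <= b -> tanh b - tanh a <= b - a.
Proof.
move=> ab.
have H := @is_derive_ge0_le (fun x => x - tanh x) (fun x => tanh x ^+ 2) a b ab.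
suff : a - tanh a <= b - tanh b by lra.
apply: H => x; last by move=> _; rewrite sqr_ge0.
have dt := is_derive_tanh x; by apply: is_derive_eq; rewrite /=; ring.
Qed.

Lemma tanh_lipschitz a b : `|tanh a - tanh b| <= `|a - b|.
Proof.
wlog ab : a b / a <= b.
  move=> H; have [/H//|/ltW/H] := leP a b.
  by rewrite distrC [X in _ <= X]distrC.
have h1 := tanh_le ab; have h2 := tanh_sub_le ab.
by rewrite ler0_norm ?subr_le0 // ler0_norm ?subr_le0 //; lra.
Qed.

(** Equivalent to [1 + 2 a <= exp (2 a)]. *)
Lemma tanh_ge a : 0 <= a -> a / (1 + a) <= tanh a.
Proof.
move=> a0; have e1 := expR_ge1Dx (2 * a).
have e0 := expR_gt0 (- a).
have e2 : expR a = expR (2 * a) * expR (- a) by rewrite -expRD; congr expR; ring.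
rewrite /tanh /sinh /cosh; rewrite ler_pdivrMr ?ltr_wpDr // mulrAC.
rewrite ler_pdivlMr ?divr_gt0 ?addr_gt0 ?expR_gt0 // e2.
rewrite -subr_ge0; set E := expR (2 * a) in e1 *; set z := expR (- a) in e0 *.
have -> : (E * z - z) / 2 * (1 + a) - a * ((E * z + z) / 2) =
  (E - (1 + 2 * a)) * z / 2 by field.
by rewrite mulr_ge0 ?invr_ge0 // mulr_ge0 ?subr_ge0 // ltW.
Qed.

(** Convexity: the derivative [tanh] is nondecreasing. *)
Lemma lcosh_tangent a b : lcosh b + tanh b * (a - b) <= lcosh a.
Proof.
pose f x := lcosh x - tanh b * x.
have df x : is_derive x 1 f (tanh x - tanh b).
  have dl := is_derive_lcosh x; rewrite /f; apply: is_derive_eq.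
  by rewrite /= /GRing.scale /= mulr1.
suff : f b <= f a by rewrite /f; lra.
have [ba|/ltW ab] := leP b a.
  apply: (is_derive_ge0_le ba df) => x /andP[bx _].
  by rewrite subr_ge0 tanh_le.
rewrite -lerN2; apply: (@is_derive_ge0_le (fun x => - f x)
  (fun x => - (tanh x - tanh b)) _ _ ab) => x.
by move=> /andP[_ xb]; rewrite oppr_ge0 subr_le0 tanh_le.
Qed.

(** The second derivative of [lcosh] is at most [1]. *)
Lemma lcosh_quadratic a b :
  lcosh a <= lcosh b + tanh b * (a - b) + (a - b) ^+ 2 / 2.
Proof.
pose f x := tanh b * x + (x - b) ^+ 2 / 2 - lcosh x.
have df x : is_derive x 1 f (tanh b + (x - b) - tanh x).
  have dl := is_derive_lcosh x; rewrite /f; apply: is_derive_eq.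
  by rewrite /= /GRing.scale /=; field.
suff : f b <= f a.
  by rewrite /f subrr expr0n /= mul0r; lra.
have [ba|/ltW ab] := leP b a.
  apply: (is_derive_ge0_le ba df) => x /andP[bx _].
  by have := tanh_sub_le bx; lra.
rewrite -lerN2; apply: (@is_derive_ge0_le (fun x => - f x)
  (fun x => - (tanh b + (x - b) - tanh x)) _ _ ab) => x.
by move=> /andP[_ xb]; have := tanh_sub_le xb; lra.
Qed.

Lemma lcosh0 : lcosh 0 = 0.
Proof. by rewrite /lcosh cosh0 ln1. Qed.

Lemma lcosh_ge0 x : 0 <= lcosh x.
Proof. by rewrite /lcosh ln_ge0 // cosh_ge1. Qed.

(** Convexity together with [lcosh 0 = 0]. *)
Lemma lcosh_scale t v : 0 <= t <= 1 -> lcosh (t * v) <= t * lcosh v.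
Proof.
move=> /andP[t0 t1].
have := lcosh_tangent v (t * v); have := lcosh_tangent 0 (t * v).
rewrite lcosh0 => h1 h2.
have := ler_wpM2l t0 h2; have := @ler_wpM2l _ (1 - t) _ _ _ h1.
rewrite subr_ge0 => /(_ t1); set p := tanh _; set q := lcosh (t * v).
nra.
Qed.

(** Sub-Gaussian bound on the exponential moment of a step of mean [tanh x]. *)
Lemma cosh_shift x t :
  cosh (x + t) <= cosh x * expR (t * tanh x + t ^+ 2 / 2).
Proof.
rewrite -!expR_lcosh -expRD ler_expR.
by have := lcosh_quadratic (x + t) x; rewrite (addrC x t) addrK; lra.
Qed.

End Hyperbolic.

(** * The free energy of the field as a Riemann integral *)

Section Integrals.
Variable R : realType.
Implicit Types a b c s t u x : R.
Local Notation leb := (@lebesgue_measure R).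

Lemma continuous_integrable (f : R -> R) a b : continuous f ->
  leb.-integrable `[a, b] (EFin \o f).
Proof.
move=> cf; apply: continuous_compact_integrable; first exact: segment_compact.
exact: continuous_subspaceT.
Qed.

Lemma Rintegral_chasles (f : R -> R) a b c : continuous f -> a <= b -> b <= c ->
  \int[leb]_(x in `[a, c]) f x =
  \int[leb]_(x in `[a, b]) f x + \int[leb]_(x in `[b, c]) f x.
Proof.
move=> cf ab bc.
have := @Rintegral_itvB R f (BLeft a) (BRight c) b (continuous_integrable _ _ cf).
rewrite !bnd_simp => /(_ ab bc) e.
rewrite -(@Rintegral_itv_obnd_cbnd R b (BRight c)); last first.
  apply: integrableS (continuous_integrable a c cf) => //.
  by apply: subset_itvr; rewrite bnd_simp.
by rewrite -e; ring.
Qed.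

Lemma Rintegral_FTC2 (f F : R -> R) a b : continuous f -> a <= b ->
  (forall x, is_derive x 1 F (f x)) ->
  \int[leb]_(x in `[a, b]) f x = F b - F a.
Proof.
move=> cf; rewrite le_eqVlt => /predU1P[<- _|ab dF].
  by rewrite set_itv1 Rintegral_set1 subrr.
have cF : continuous F.
  move=> x; apply: differentiable_continuous; apply/derivable1_diffP.
  by have [] := dF x.
rewrite /Rintegral (@continuous_FTC2 _ f F a b ab) //.
- exact: continuous_subspaceT.
- split.
  + by move=> x _; have [] := dF x.
  + exact/cvg_at_right_filter/cF.
  + exact/cvg_at_left_filter/cF.
- by move=> x _; rewrite derive1E; have [] := dF x.
Qed.

Lemma continuous_affine (A B c : R) : continuous (fun x => A + B * (x - c)).
Proof.
move=> x; apply: differentiable_continuous; apply/derivable1_diffP.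
exact: ex_derive.
Qed.

Lemma Rintegral_affine (A B : R) a b : a <= b ->
  \int[leb]_(x in `[a, b]) (A + B * (x - (a + b) / 2)) = A * (b - a).
Proof.
move=> ab; pose F x := A * x + B * (x - (a + b) / 2) ^+ 2 / 2.
have dF x : is_derive x 1 F (A + B * (x - (a + b) / 2)).
  by rewrite /F; apply: is_derive_eq; rewrite /= /GRing.scale /=; field.
rewrite (Rintegral_FTC2 (@continuous_affine A B ((a + b) / 2)) ab dF).
by rewrite /F; field.
Qed.

(** Affine bounds centred at the midpoint of a cell integrate to their value
    there, whatever their slope [B]. *)
Lemma ge_Rintegral_affine (f : R -> R) (A B : R) a b : continuous f -> a <= b ->
  (forall x, a <= x <= b -> A + B * (x - (a + b) / 2) <= f x) ->
  A * (b - a) <= \int[leb]_(x in `[a, b]) f x.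
Proof.
move=> cf ab H; rewrite -(@Rintegral_affine A B) //.
apply: le_Rintegral => //.
- by apply: continuous_integrable; exact: continuous_affine.
- exact: continuous_integrable.
Qed.

Lemma le_Rintegral_affine (f : R -> R) (A B : R) a b : continuous f -> a <= b ->
  (forall x, a <= x <= b -> f x <= A + B * (x - (a + b) / 2)) ->
  \int[leb]_(x in `[a, b]) f x <= A * (b - a).
Proof.
move=> cf ab H; rewrite -(@Rintegral_affine A B) //.
apply: le_Rintegral => //.
- exact: continuous_integrable.
- by apply: continuous_integrable; exact: continuous_affine.
Qed.

Lemma Rintegral_cells (f : R -> R) n : continuous f -> (0 < n)%N ->
  \int[leb]_(x in `[0, 1]) f x =
  \sum_(i < n) \int[leb]_(x in `[i%:R / n%:R, i.+1%:R / n%:R]) f x.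
Proof.
move=> cf n0; have nR : 0 < n%:R :> R by rewrite ltr0n.
have H m : (m <= n)%N -> \int[leb]_(x in `[0, m%:R / n%:R]) f x =
   \sum_(i < m) \int[leb]_(x in `[i%:R / n%:R, i.+1%:R / n%:R]) f x.
  elim: m => [|m IH] mn; first by rewrite big_ord0 mul0r set_itv1 Rintegral_set1.
  rewrite big_ord_recr /= -(IH (ltnW mn)).
  apply: (Rintegral_chasles cf); first by rewrite divr_ge0 // ler0n.
  by rewrite ler_pM2r ?invr_gt0 // ler_nat.
by rewrite -(H n (leqnn n)) divff // gt_eqF.
Qed.

Lemma continuous_G_integrand s : continuous (fun x => lcosh (s * (1 - 2 * x))).
Proof.
move=> x; apply: (@continuous_comp _ _ _ (fun x => s * (1 - 2 * x)) (@lcosh R)).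
  apply: differentiable_continuous; apply/derivable1_diffP; exact: ex_derive.
exact: continuous_lcosh.
Qed.

Lemma lcoshN x : lcosh (- x) = lcosh x.
Proof. by rewrite /lcosh coshN. Qed.

(** Logarithm of the normalising constant of the [n]-step walk whose steps are
    tilted so as to absorb the area of a bridge in a field [h]. *)
Definition ltilt (h : R) n : R :=
  \sum_(i < n) lcosh (h * (i.+1%:R - n.+1%:R / 2)).

(** The midpoint rule underestimates the integral of a convex function: use the
    tangent at the midpoint of each cell. *)
Lemma ltilt_le_G h n : 0 <= h -> (0 < n)%N ->
  ltilt h n <= n%:R * G (h * n%:R / 2).
Proof.
move=> h0 n0; have nR : 0 < n%:R :> R by rewrite ltr0n.
have -> : G (h * n%:R / 2) =
    \int[leb]_(x in `[0, 1]) lcosh (h * n%:R / 2 * (1 - 2 * x)) by [].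
rewrite (Rintegral_cells (@continuous_G_integrand (h * n%:R / 2)) n0).
rewrite mulr_sumr; apply: ler_sum => i _.
set y := h * (i.+1%:R - _).
have yE : h * n%:R / 2 * (1 - 2 * ((i%:R / n%:R + i.+1%:R / n%:R) / 2)) = - y :> R.
  by rewrite /y -!natr1; field; rewrite gt_eqF.
have ab : i%:R / n%:R <= i.+1%:R / n%:R :> R by rewrite ler_pM2r ?invr_gt0 // ler_nat.
rewrite -ler_pdivrMl //.
have -> : n%:R^-1 * lcosh y = lcosh y * (i.+1%:R / n%:R - i%:R / n%:R).
  by rewrite -natr1; field; rewrite gt_eqF.
apply: (@ge_Rintegral_affine _ _ (- h * n%:R * tanh (- y)) _ _
  (@continuous_G_integrand _) ab) => x _.
have := lcosh_tangent (h * n%:R / 2 * (1 - 2 * x)) (- y).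
have -> : h * n%:R / 2 * (1 - 2 * x) - - y =
  - h * n%:R * (x - (i%:R / n%:R + i.+1%:R / n%:R) / 2) :> R.
  by rewrite -yE; field; rewrite gt_eqF.
by rewrite lcoshN mulrCA mulrA.
Qed.

(** The parabola of curvature [1] touching [lcosh] at the midpoint of a cell
    bounds the error of the midpoint rule. *)
Lemma G_le_ltilt h n : 0 <= h -> (0 < n)%N ->
  n%:R * G (h * n%:R / 2) <= ltilt h n + n%:R * (h ^+ 2 / 8).
Proof.
move=> h0 n0; have nR : 0 < n%:R :> R by rewrite ltr0n.
have -> : G (h * n%:R / 2) =
    \int[leb]_(x in `[0, 1]) lcosh (h * n%:R / 2 * (1 - 2 * x)) by [].
rewrite (Rintegral_cells (@continuous_G_integrand (h * n%:R / 2)) n0).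
have -> : n%:R * (h ^+ 2 / 8) = \sum_(i < n) (h ^+ 2 / 8).
  by rewrite sumr_const card_ord mulr_natl.
rewrite -big_split /= mulr_sumr; apply: ler_sum => i _.
set y := h * (i.+1%:R - _).
have yE : h * n%:R / 2 * (1 - 2 * ((i%:R / n%:R + i.+1%:R / n%:R) / 2)) = - y :> R.
  by rewrite /y -!natr1; field; rewrite gt_eqF.
have ab : i%:R / n%:R <= i.+1%:R / n%:R :> R by rewrite ler_pM2r ?invr_gt0 // ler_nat.
rewrite -ler_pdivlMl //.
have -> : n%:R^-1 * (lcosh y + h ^+ 2 / 8) =
  (lcosh y + h ^+ 2 / 8) * (i.+1%:R / n%:R - i%:R / n%:R).
  by rewrite -natr1; field; rewrite gt_eqF.
apply: (@le_Rintegral_affine _ _ (- h * n%:R * tanh (- y)) _ _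
  (@continuous_G_integrand _) ab) => x /andP[ax xb].
have := lcosh_quadratic (h * n%:R / 2 * (1 - 2 * x)) (- y).
rewrite lcoshN => /le_trans; apply.
have -> : h * n%:R / 2 * (1 - 2 * x) - - y =
  - h * n%:R * (x - (i%:R / n%:R + i.+1%:R / n%:R) / 2) :> R.
  by rewrite -yE; field; rewrite gt_eqF.
set m := _ / 2 in ax xb *; set T := tanh _.
suff : (- h * n%:R * (x - (i%:R / n%:R + i.+1%:R / n%:R) / 2)) ^+ 2 <= h ^+ 2 / 4.
  by set z := (_ ^+ 2); lra.
have e : n%:R * (x - (i%:R / n%:R + i.+1%:R / n%:R) / 2) =
  n%:R * x - i%:R - 2^-1.
  by rewrite -natr1; field; rewrite gt_eqF.
rewrite -mulrA e mulNr sqrrN exprMn ler_wpM2l ?sqr_ge0 //.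
move: ax xb; rewrite ler_pdivrMr // ler_pdivlMr // -natr1 (mulrC x) => ax xb.
set w := n%:R * x in ax xb *; set p := i%:R in ax xb *.
have -> : 4^-1 = 2^-1 ^+ 2 :> R by field.
by rewrite -[X in X <= _]real_normK ?num_real // ler_sqr ?nnegrE ?invr_ge0 // ler_norml; lra.
Qed.

Lemma G_scale s t : 0 <= t <= 1 -> G (t * s) <= t * G s.
Proof.
move=> t01; rewrite /G.
rewrite -RintegralZl //; last first.
  by apply: continuous_integrable; exact: continuous_G_integrand.
apply: le_Rintegral => //.
- by apply: continuous_integrable; exact: continuous_G_integrand.
- apply: (@continuous_integrable (fun x => t * lcosh (s * (1 - 2 * x)))).
  move=> x; apply: (@continuous_comp _ _ _
    (fun x => lcosh (s * (1 - 2 * x))) ( *%R t)).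
    exact: continuous_G_integrand.
  exact: mulrl_continuous.
- by move=> x _; rewrite -mulrA; exact: lcosh_scale.
Qed.

Lemma G_gt0 s : 0 < s -> 0 < G s.
Proof.
move=> s0; have := @ltilt_le_G s 2 (ltW s0) isT.
rewrite /ltilt !big_ord_recr big_ord0 /= mulfK ?pnatr_eq0 //.
suff : 0 < lcosh (s * (1 - 3 / 2)).
  have := lcosh_ge0 (s * (2 - 3 / 2)); lra.
by rewrite /lcosh ln_gt0 // cosh_gt1 // lt_eqF //; lra.
Qed.

Lemma M_closed s u : 0 < s -> 0 <= u ->
  M s u = (lcosh s - lcosh (s * (1 - u))) / s.
Proof.
move=> s0 u0; rewrite /M.
pose F x := - (s^-1 * lcosh (s * (1 - x))).
have dF x : is_derive x 1 F (tanh (s * (1 - x))).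
  have dl := is_derive_lcosh (s * (1 - x)).
  have da : is_derive x 1 (fun x => s * (1 - x)) (- s).
    by apply: is_derive_eq; rewrite /= /GRing.scale /=; ring.
  have dc := @is_derive1_comp R (@lcosh R) (fun x => s * (1 - x)) x _ _ dl da.
  have h := is_deriveN (is_deriveZ s^-1 dc).
  by apply: (is_derive_eq h); rewrite /GRing.scale /=; field; rewrite gt_eqF.
have ct : continuous (fun x => tanh (s * (1 - x))).
  move=> x; apply: (@continuous_comp _ _ _ (fun x => s * (1 - x)) (@tanh R)).
    apply: differentiable_continuous; apply/derivable1_diffP; exact: ex_derive.
  exact: continuous_tanh.
rewrite (Rintegral_FTC2 ct u0 dF) /F subr0 mulr1.
by field; rewrite gt_eqF.
Qed.

End Integrals.

(** * Sums over nearest-neighbour paths *)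

Section PathSums.
Variable R : realType.

(** Backward recursion for the sum over the nearest-neighbour paths of [n] steps
    on the half-line that are at [x] at time [t]: a path contributes the product
    of [w s y] over the sites [(s, y)] that it visits after time [t], times [g]
    at its endpoint. No upper bound is put on the heights. *)
Fixpoint psum (w : nat -> nat -> R) n t (g : nat -> R) x : R :=
  if n is n'.+1 then
    w t.+1 x.+1 * psum w n' t.+1 g x.+1 +
    (if x is x'.+1 then w t.+1 x' * psum w n' t.+1 g x' else 0)
  else g x.

Definition delta0 (x : nat) : R := (x == 0%N)%:R.

(** Iterated kernels on a finite type: the form in which a sum over functions on
    an ordinal factorises one coordinate at a time. *)
Fixpoint ksum (T : finType) (k : nat -> T -> T -> R) n t (g : T -> R) a : R :=
  if n is n'.+1 then \sum_b k t a b * ksum k n' t.+1 g b else g a.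

Lemma ksumE (T : finType) (k : nat -> T -> T -> R) n t (g : T -> R) a :
  \sum_(f : {ffun 'I_n.+1 -> T} | f ord0 == a)
    ((\prod_(i < n) k (t + i)%N (f (widen_ord (leqnSn n) i)) (f (lift ord0 i))) *
      g (f ord_max)) = ksum k n t g a.
Proof.
elim: n t a => [|n IH] t a /=.
  rewrite (big_pred1 [ffun=> a]) => [|f].
    by rewrite big_ord0 mul1r ffunE.
  apply/eqP/eqP => [<-|->]; last by rewrite ffunE.
  by apply/ffunP => i; rewrite ffunE (ord1 i).
pose cons (f : {ffun 'I_n.+1 -> T}) : {ffun 'I_n.+2 -> T} :=
  [ffun i => if unlift ord0 i is Some j then f j else a].
pose tl (f : {ffun 'I_n.+2 -> T}) := [ffun j : 'I_n.+1 => f (lift ord0 j)].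
have cons0 f : cons f ord0 = a by rewrite ffunE unlift_none.
have consS f j : cons f (lift ord0 j) = f j by rewrite ffunE liftK.
have consK f : tl (cons f) = f by apply/ffunP => j; rewrite ffunE consS.
rewrite (reindex_onto cons tl) /=; last first.
  move=> f /eqP f0; apply/ffunP => i; rewrite ffunE.
  by case: unliftP => [j ->|->]; rewrite ?ffunE.
rewrite (eq_bigl xpredT); last by move=> f; rewrite cons0 consK !eqxx.
rewrite (partition_big (fun f : {ffun 'I_n.+1 -> T} => f ord0) xpredT) //=.
apply: eq_bigr => b _; rewrite -IH mulr_sumr; apply: eq_big => // f /eqP fb.
have -> : ord_max = lift ord0 ord_max :> 'I_n.+2 by apply/val_inj.
rewrite big_ord_recl /= mulrA; congr (_ * _); last by rewrite consS.
have -> : widen_ord (leqnSn n.+1) ord0 = ord0 by apply/val_inj.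
rewrite cons0 consS fb addn0; congr (_ * _).
apply: eq_bigr => i _.
have -> : widen_ord (leqnSn n.+1) (lift ord0 i) =
  lift ord0 (widen_ord (leqnSn n) i) by apply/val_inj.
by rewrite !consS /bump /= add1n addnS addSn.
Qed.

Lemma psum_far w n t x : (n < x)%N -> psum w n t delta0 x = 0.
Proof.
elim: n t x => [|n IH] t [|x] //= nx.
rewrite !IH ?mulr0 ?addr0 //; lia.
Qed.

(** Along a path that has to come back to [0] in [n <= m] steps the truncation
    of the heights at [m] is invisible. *)
Lemma ksum_psum m (w : nat -> nat -> R) n t (x : 'I_m.+1) : (n <= m)%N ->
  ksum (fun t (a b : 'I_m.+1) =>
     ((`|((b : nat)%:Z - (a : nat)%:Z)%R|%N == 1%N)%:R * w t.+1 b)) n t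
     (fun b : 'I_m.+1 => delta0 b) x = psum w n t delta0 x.
Proof.
elim: n t x => [//|n IH] t x nm /=.
pose F (b : nat) := (`|(b%:Z - (x : nat)%:Z)%R|%N == 1%N)%:R *
  w t.+1 b * psum w n t.+1 delta0 b.
rewrite (eq_bigr (fun i : 'I_m.+1 => F i)); last first.
  by move=> b _; rewrite (IH _ _ (ltnW nm)).
rewrite -(big_mkord xpredT F).
have F0 b : b != x.+1 -> b.+1 != x -> F b = 0.
  move=> h1 h2; rewrite /F; case: eqP; rewrite ?mul0r //; lia.
have Fup : F x.+1 = w t.+1 x.+1 * psum w n t.+1 delta0 x.+1.
  rewrite /F; have -> : (`|(x.+1%:Z - (x : nat)%:Z)%R|%N == 1%N) by lia.
  by rewrite mul1r.
have Fdn x' : (x : nat) = x'.+1 -> F x' = w t.+1 x' * psum w n t.+1 delta0 x'.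
  move=> e; rewrite /F e; have -> : (`|(x'%:Z - x'.+1%:Z)%R|%N == 1%N) by lia.
  by rewrite mul1r.
have xm := ltn_ord x.
have e1 : \sum_(0 <= b < m.+1) F b = F x.+1 +
   (if (x : nat) is x'.+1 then F x' else 0).
  have -> : \sum_(0 <= b < m.+1) F b = \sum_(0 <= b < m.+2) F b.
    rewrite [in RHS]big_nat_recr //=.
    have -> : F m.+1 = 0.
      have [e|ne] := eqVneq m.+1 x.+1; last by apply: F0 => //; lia.
      rewrite e Fup psum_far ?mulr0 //; lia.
    by rewrite addr0.
  have mx : x.+1 \in index_iota 0 m.+2 by rewrite mem_index_iota.
  rewrite (bigD1_seq _ mx (iota_uniq _ _)) /=; congr (_ + _).
  case ex : (x : nat) => [|x'].
    by rewrite big_nat_cond big1 // => b /andP[_ b1]; apply: F0; rewrite ex.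
  have mx' : x' \in index_iota 0 m.+2 by rewrite mem_index_iota; lia.
  rewrite big_mkcond (bigD1_seq _ mx' (iota_uniq _ _)) /=.
  have -> : x' != x'.+2 by lia.
  rewrite big_nat_cond big1 ?addr0 // => b /andP[_ bx].
  by case: ifP => // b_y; apply: F0; rewrite ex //; lia.
rewrite e1 Fup; congr (_ + _).
by case ex : (x : nat) => [//|x']; rewrite (Fdn _ ex).
Qed.

Lemma Omega_psum N (w : nat -> nat -> R) :
  \sum_(xi in Omega N) \prod_(i < 2 * N) w i.+1 (xi (lift ord0 i)) =
  psum w (2 * N) 0 delta0 0.
Proof.
rewrite -(@ksum_psum (2 * N) w (2 * N) 0 ord0) // -ksumE.
rewrite big_mkcond [in RHS]big_mkcond /=; apply: eq_bigr => xi _.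
rewrite inE; have -> : (xi ord0 == ord0) = (xi ord0 == 0 :> nat)%N by [].
case: (boolP (xi ord0 == 0 :> nat)%N) => //= _.
have [/eqP e|ne] := boolP (xi ord_max == 0 :> nat)%N; last first.
  by rewrite /delta0 (negbTE ne) mulr0.
rewrite /delta0 e mulr1 andTb.
case: ifP => [/forallP H|/negbT/forallPn[i Hi]].
  by apply: eq_bigr => i _; rewrite (eqP (H i)) mul1r add0n.
by rewrite (bigD1 i) //= (negbTE Hi) !mul0r.
Qed.

End PathSums.

(** * Excursions and the renewal equation *)

Section Excursions.
Variable R : realType.
Implicit Types (w : nat -> nat -> R) (g : nat -> R) (h lam : R).

Lemma psum_ext w w' n t g x :
  (forall s y, (t < s <= t + n)%N -> w s y = w' s y) ->
  psum w n t g x = psum w' n t g x.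
Proof.
elim: n t x => [//|n IH] t x H /=.
have H' y : psum w n t.+1 g y = psum w' n t.+1 g y.
  by apply: IH => s z sn; apply: H; lia.
by rewrite !H' H; [case: x => [//|x]; rewrite H' H //; lia | lia].
Qed.

Lemma psum_cat w a b t g x :
  psum w (a + b) t g x = psum w a t (psum w b (t + a) g) x.
Proof.
elim: a t x => [|a IH] t x /=; first by rewrite addn0.
rewrite IH addSnnS; case: x => [//|x]; by rewrite IH addSnnS.
Qed.

Lemma psum_cst (f : nat -> R) n t s g x :
  psum (fun _ => f) n t g x = psum (fun _ => f) n s g x.
Proof.
elim: n t s x => [//|n IH] t s x /=.
by rewrite (IH t.+1 s.+1); case: x => [//|x]; rewrite (IH t.+1 s.+1).
Qed.

(** The factor [1 / 2] of a step and the area that it adds are attached to the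
    site that it reaches, so that a path weight is a product over sites. The
    contact at the final time is then rewarded too: the partition function of
    the model appears multiplied by [lam]. *)
Definition site h lam (x : nat) : R :=
  2^-1 * expR (h * x%:R) * (if x == 0%N then lam else 1).

Definition Yfrom h lam n x : R := psum (fun _ => site h lam) n 0 (@delta0 R) x.
(** Pinned partition function of [n] steps from [0] to [0]. *)
Definition Y h lam n : R := Yfrom h lam n 0.

(** Weight of the paths that start from [x > 0] and first reach [0] after
    exactly [j] steps, being at a height allowed by [b i] when [i] steps
    remain. *)
Fixpoint hit h (b : nat -> nat -> bool) j x : R :=
  if j is i.+1 then
    if x is y.+1 then
      2^-1 * (expR (h * x.+1%:R) * ((b i x.+1)%:R * hit h b i x.+1) +
              expR (h * y%:R) * ((b i y)%:R * hit h b i y))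
    else 0
  else delta0 R x.

Definition exc h (b : nat -> nat -> bool) n : R :=
  if n is i.+1 then 2^-1 * expR (h * 1%:R) * ((b i 1%N)%:R * hit h b i 1) else 0.

Definition anywhere (i x : nat) := true.

(** Sitewise form of the event that a path makes an excursion from [s] to [e]
    subject to [b]: imposing it amounts to modifying the site weights. *)
Definition in_exc s e (b : nat -> nat -> bool) t x :=
  ((t == s) ==> (x == 0%N)) &&
  ((s < t <= e)%N ==> (((x == 0%N) == (t == e)) && b (e - t)%N x)).

(** The excursion cuts a path into three independent pieces. *)
Lemma psum_exc h lam s e (b : nat -> nat -> bool) L : (s < e <= L)%N ->
  psum (fun t x => (in_exc s e b t x)%:R * site h lam x) L 0 (@delta0 R) 0 =
  lam * (Y h lam s * exc h b (e - s) * Y h lam (L - e)).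
Proof.
move=> /andP[se eL]; set w := fun t x => _.
have wE t x : w t x = (in_exc s e b t x)%:R * site h lam x by [].
have -> : L = (s + ((e - s) + (L - e)))%N by lia.
rewrite psum_cat add0n; set Gs := psum w (_ + _) s _.
have -> : (s + ((e - s) + (L - e)) - e = L - e)%N by lia.
have left j x : (j < s)%N ->
    w (s - j)%N x * psum w j (s - j) Gs x = Gs 0%N * (site h lam x * Yfrom h lam j x).
  elim: j x => [|j IH] x js.
    rewrite subn0 /= wE /in_exc eqxx ltnn /= andbT /Yfrom /= /delta0.
    by case: (x =P 0%N) => [->|_]; rewrite ?mul1r ?mulr1 ?mul0r ?mulr0 // mulrC.
  have -> : w (s - j.+1)%N x = site h lam x.
    rewrite wE /in_exc; have -> : (s - j.+1 == s)%N = false by lia.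
    have -> : (s < s - j.+1 <= e)%N = false by lia.
    by rewrite /= mul1r.
  rewrite mulrCA; congr (_ * _); rewrite /=.
  have -> : (s - j.+1).+1 = (s - j)%N by lia.
  rewrite IH ?(ltnW js) // /Yfrom /= (psum_cst _ _ 1 0) mulrDr; congr (_ + _).
  by case: x => [|x]; rewrite ?mulr0 // IH ?(ltnW js) // (psum_cst _ _ 1 0).
have -> : psum w s 0 Gs 0 = Gs 0%N * Y h lam s.
  case es: s left => [|s'] left; first by rewrite /Y /Yfrom /delta0 /= mulr1.
  rewrite /= addr0 /Y /Yfrom /= addr0 (psum_cst _ _ 1 0).
  by have := left s' 1%N (ltnSn _); rewrite subSn // subnn.
set Ge := psum w (L - e) e (@delta0 R).
have right : Ge 0%N = Y h lam (L - e).
  rewrite /Ge /Y /Yfrom (psum_cst _ _ 0 e); apply: psum_ext => t x te.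
  rewrite wE /in_exc; have -> : (t == s) = false by lia.
  have -> : (s < t <= e)%N = false by lia.
    by rewrite /= mul1r.
have GsE : Gs = psum w (e - s) s Ge.
  rewrite /Gs /Ge; apply/funext => x; rewrite psum_cat.
  by have -> : (s + (e - s) = e)%N by lia.
have mid j x : (s + j < e)%N ->
    w (e - j)%N x * psum w j (e - j) Ge x =
    lam * Ge 0%N * (2^-1 * expR (h * x%:R) * ((b j x)%:R * hit h b j x)).
  elim: j x => [|j IH] x js.
    rewrite subn0 /= wE /in_exc eqxx leqnn andbT subnn.
    have -> : (e == s) = false by lia.
    have -> : (s < e)%N by lia.
    rewrite /= /site /delta0; case: (x =P 0%N) => [->|_] /=.
      by ring.
    by rewrite !mulr0 !mul0r.
  rewrite wE /in_exc; have -> : (e - j.+1 == s)%N = false by lia.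
  have -> : (s < e - j.+1 <= e)%N by lia.
  have -> : (e - j.+1 == e)%N = false by lia.
  have -> : (e - (e - j.+1) = j.+1)%N by lia.
  rewrite /=; case: x => [|x]; first by rewrite !mul0r /= !mulr0.
  have -> : (e - j.+1).+1 = (e - j)%N by lia.
  rewrite !IH; try lia.
  by rewrite /site /=; ring.
rewrite GsE.
have -> : psum w (e - s) s Ge 0 = lam * Ge 0%N * exc h b (e - s).
  have ees : (e - s = (e - s).-1.+1)%N by lia.
  rewrite ees /= addr0.
  have := mid (e - s).-1 1%N; have -> : (e - (e - s).-1 = s.+1)%N by lia.
  by move=> ->; [| lia].
by rewrite right; ring.
Qed.

Lemma YfromS h lam n x : Yfrom h lam n.+1 x =
  site h lam x.+1 * Yfrom h lam n x.+1 +
  (if x is x'.+1 then site h lam x' * Yfrom h lam n x' else 0).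
Proof.
rewrite /Yfrom /= (psum_cst _ _ 1 0); case: x => [//|x].
by rewrite (psum_cst _ _ 1 0).
Qed.

(** Decomposition at the first visit to the wall, after which the path is a
    pinned path from [0]. *)
Lemma Yfrom_hit h lam n x : (0 < x)%N ->
  Yfrom h lam n x = lam * \sum_(j < n.+1) hit h anywhere j x * Y h lam (n - j).
Proof.
elim: n x => [|n IH] [//|x] _.
  by rewrite big_ord_recr big_ord0 /= /Yfrom /= /delta0 /= mul0r addr0 mulr0.
rewrite YfromS IH // [in RHS]big_ord_recl /= /delta0 /= mul0r add0r.
under [X in _ = _ * X]eq_bigr do rewrite /bump /= add1n subSS !mul1r.
rewrite {1}/site /= mulr1.
case: x => [|x].
  have -> : \sum_(i < n.+1) 2^-1 * (expR (h * 2%:R) * hit h anywhere i 2 +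
      expR (h * 0%:R) * hit h anywhere i 0) * Y h lam (n - i) =
    2^-1 * expR (h * 2%:R) * (\sum_(i < n.+1) hit h anywhere i 2 * Y h lam (n - i))
    + 2^-1 * Y h lam n.
    have -> : 2^-1 * Y h lam n =
        \sum_(i < n.+1) 2^-1 * (hit h anywhere i 0 * Y h lam (n - i)).
      rewrite big_ord_recl big1 => [|i _]; last by rewrite /= mul0r mulr0.
      by rewrite subn0 /= /delta0 mul1r addr0.
    rewrite mulr_sumr -big_split /=; apply: eq_bigr => i _.
    by rewrite mulr0 expR0; ring.
  by rewrite /site /= mulr0 expR0 /Y; ring.
rewrite IH // /site /= mulr1 !mulr_sumr -big_split /=.
by apply: eq_bigr => i _; ring.
Qed.

Lemma Y_renewal h lam n : Y h lam n.+1 =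
  lam * \sum_(j < n.+1) exc h anywhere j.+1 * Y h lam (n - j).
Proof.
rewrite /Y YfromS addr0 Yfrom_hit // /site /= mulr1 mulrCA; congr (_ * _).
by rewrite mulr_sumr; apply: eq_bigr => j _; rewrite mul1r mulrA.
Qed.

Lemma Y0 h lam : Y h lam 0 = 1.
Proof. by []. Qed.

End Excursions.

Section Weights.
Variable R : realType.
Implicit Types lam sigma : R.

(** Heights vanish at the final time, where the model grants no reward: this is
    the extra factor [lam]. *)
Lemma weight_sites lam sigma N (xi : zpath N) : (0 < N)%N -> xi \in Omega N ->
  lam * weight lam sigma xi =
  \prod_(i < 2 * N) site (sigma / N%:R) lam (xi (lift ord0 i)).
Proof.
move=> N0; rewrite inE => /and3P[_ /eqP end0 _].
rewrite /site 2!big_split /= prodr_const card_ord /weight -expR_sum exprVn.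
rewrite -mulr_sumr -natr_sum.
have -> : A xi = (\sum_(i < 2 * N) (xi (lift ord0 i) : nat))%N.
  by rewrite /A big_mkcond big_ord_recl /= add0n.
have -> : \prod_(i < 2 * N) (if xi (lift ord0 i) == 0%N :> nat then lam else 1)
    = lam ^+ (H xi).+1.
  rewrite (eq_bigr (fun i : 'I_(2 * N) => lam ^+ (xi (lift ord0 i) == 0%N :> nat)));
    last by move=> i _; case: eqP.
  rewrite -expr_sum; congr (_ ^+ _).
  rewrite /H -sum1_card [in RHS]big_mkcond [in RHS]big_ord_recl /= add0n.
  pose f i := xi (inord i) == 0%N :> nat.
  have fE (i : 'I_(2 * N)) : (xi (lift ord0 i) == 0%N :> nat) = f i.+1.
    rewrite /f; have -> : lift ord0 i = inord i.+1 :> 'I_(2 * N).+1 => //.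
    by apply/val_inj; rewrite /= inordK ?ltnS.
  have fend : f (2 * N)%N.
    rewrite /f; have -> : inord (2 * N) = ord_max :> 'I_(2 * N).+1.
      by apply/val_inj; rewrite /= inordK.
    by rewrite end0.
  rewrite (eq_bigr (fun i : 'I_(2 * N) => f i.+1 : nat)); last by move=> i _; rewrite fE.
  rewrite [in RHS](eq_bigr (fun i : 'I_(2 * N) => ((i.+1 < 2 * N)%N && f i.+1) : nat)).
    case: (2 * N)%N fend (muln_gt0 2 N) => [|n] fn; first by rewrite N0.
    move=> _; rewrite !big_ord_recr /= ltnn fn addn0 addn1; congr _.+1.
    by apply: eq_bigr => i _; rewrite ltnS ltn_ord.
  by move=> i _; rewrite inE -fE /= /bump /= add1n; case: ifP.
by rewrite exprS; ring.
Qed.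

Lemma psum_weights lam sigma N (c : nat -> nat -> bool) : (0 < N)%N ->
  lam * \sum_(xi in Omega N | [forall i : 'I_(2 * N), c i.+1 (xi (lift ord0 i))])
    weight lam sigma xi =
  psum (fun t x => (c t x)%:R * site (sigma / N%:R) lam x) (2 * N) 0 (@delta0 R) 0.
Proof.
move=> N0; rewrite -Omega_psum mulr_sumr big_mkcondr /=; apply: eq_bigr => xi xiO.
rewrite weight_sites // [in RHS]big_split /=.
case: ifP => [/forallP H|/negbT/forallPn[i Hi]].
  by rewrite [X in _ = X * _]big1 ?mul1r // => i _; rewrite H.
by rewrite (bigD1 i) //= (negbTE Hi) !mul0r.
Qed.

Definition excb N s e b (xi : zpath N) :=
  [forall i : 'I_(2 * N), in_exc s e b i.+1 (xi (lift ord0 i))].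

Lemma weight_exc lam sigma N s e b : (0 < N)%N -> lam != 0 -> (s < e <= 2 * N)%N ->
  \sum_(xi in Omega N | excb s e b xi) weight lam sigma xi =
  Y (sigma / N%:R) lam s * exc (sigma / N%:R) b (e - s) * Y (sigma / N%:R) lam (2 * N - e).
Proof.
move=> N0 lam0 se; apply: (mulfI lam0).
by rewrite (psum_weights lam sigma (in_exc s e b) N0) psum_exc.
Qed.

Lemma weight_total lam sigma N : (0 < N)%N ->
  lam * Z lam sigma N = Y (sigma / N%:R) lam (2 * N).
Proof.
move=> N0; have := @psum_weights lam sigma N (fun _ _ => true) N0.
have -> : psum (fun t x => (true)%:R * site (sigma / N%:R) lam x) (2 * N) 0 (@delta0 R) 0
   = Y (sigma / N%:R) lam (2 * N).
  by apply: psum_ext => s y _; rewrite mul1r.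
move=> <-; rewrite /Z; congr (_ * _); apply: eq_bigl => xi.
by rewrite (introT forallP) ?andbT.
Qed.

Lemma weight_ge0 lam sigma N (xi : zpath N) : 0 <= lam -> 0 <= weight lam sigma xi.
Proof.
move=> l0; rewrite /weight !mulr_ge0 ?expR_ge0 ?exprn_ge0 // invr_ge0 exprn_ge0 //.
Qed.

End Weights.

(** * Exact solutions by tilting *)

Section Tilting.
Variable R : realType.
Implicit Types (h c t lam K : R) (b : nat -> nat -> bool).

(** Without the wall the recursion of [hit] has these exponential solutions,
    one for each tilt [c]: a linear field only shifts the exponent at each step. *)
Definition tilted h c j (x : nat) : R :=
  expR ((h * j%:R - c) * x%:R) * \prod_(0 <= i < j) cosh (h * i.+1%:R - c).

Lemma tilted_gt0 h c j x : 0 < tilted h c j x.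
Proof.
rewrite /tilted mulr_gt0 ?expR_gt0 // prodr_gt0 // => i _; exact: cosh_gt0.
Qed.

Lemma tiltedS h c j x : tilted h c j.+1 x.+1 =
  2^-1 * (expR (h * x.+2%:R) * tilted h c j x.+2 + expR (h * x%:R) * tilted h c j x).
Proof.
rewrite /tilted big_nat_recr //=; set P := \prod_(0 <= i < j) _.
have e1 : expR (h * x.+2%:R) * (expR ((h * j%:R - c) * x.+2%:R) * P) =
   expR ((h * j.+1%:R - c) * x.+1%:R) * expR (h * j.+1%:R - c) * P.
  by rewrite mulrA -!expRD; congr (expR _ * _); rewrite -!natr1; ring.
have e2 : expR (h * x%:R) * (expR ((h * j%:R - c) * x%:R) * P) =
   expR ((h * j.+1%:R - c) * x.+1%:R) * expR (- (h * j.+1%:R - c)) * P.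
  by rewrite mulrA -!expRD; congr (expR _ * _); rewrite -!natr1; ring.
by rewrite e1 e2 /cosh; field.
Qed.

(** At the wall only one of the two terms of [cosh] is present. *)
Lemma tilted0_ge h c j :
  2^-1 * expR (h * 1%:R) * tilted h c j 1 <= tilted h c j.+1 0.
Proof.
rewrite /tilted big_nat_recr //= mulr0 expR0 mul1r.
set P := \prod_(0 <= i < j) _.
have P0 : 0 < P by rewrite prodr_gt0 // => i _; exact: cosh_gt0.
have -> : 2^-1 * expR (h * 1%:R) * (expR ((h * j%:R - c) * 1%:R) * P) =
   P * (expR (h * j.+1%:R - c) / 2).
  have -> : h * j.+1%:R - c = h * 1%:R + (h * j%:R - c) * 1%:R.
    by rewrite -natr1; ring.
  by rewrite expRD; ring.
rewrite ler_pM2l // /cosh ler_pM2r ?invr_gt0 // lerDl expR_ge0 //.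
Qed.

Lemma hit_ge0 h b j x : 0 <= hit h b j x.
Proof.
elim: j x => [|j IH] [|x] //=; rewrite ?/delta0 ?ler0n //.
by rewrite mulr_ge0 ?invr_ge0 // addr_ge0 // mulr_ge0 ?expR_ge0 // mulr_ge0 ?ler0n.
Qed.

Lemma exc_ge0 h b n : 0 <= exc h b n.
Proof.
case: n => [//|n] /=.
by rewrite !mulr_ge0 ?expR_ge0 ?ler0n ?invr_ge0 // hit_ge0.
Qed.

(** [tilted] solves the recursion of [hit] exactly for every [c], so a bound at
    one time propagates to all later times, and [c] may be changed on the way. *)
Lemma hit_le_tilted h b c K r :
  (forall x, (b r x)%:R * hit h b r x <= K * tilted h c r x) ->
  forall m x, (b (r + m)%N x)%:R * hit h b (r + m) x <= K * tilted h c (r + m) x.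
Proof.
move=> H; elim=> [|m IH] x; first by rewrite addn0.
have K0 : 0 <= K.
  have := H 0%N; move=> /(le_trans (mulr_ge0 (ler0n _ _) (hit_ge0 _ _ _ _))).
  by rewrite pmulr_lge0 // tilted_gt0.
have T0 y : 0 <= K * tilted h c (r + m.+1) y by rewrite mulr_ge0 // ltW ?tilted_gt0.
have [_|_] := boolP (b (r + m.+1)%N x); last by rewrite /= mul0r.
rewrite /= mul1r; case: x => [|x]; first by move: (T0 0%N); rewrite addnS.
rewrite addnS /= tiltedS.
have -> : K * (2^-1 * (expR (h * x.+2%:R) * tilted h c (r + m) x.+2 +
     expR (h * x%:R) * tilted h c (r + m) x)) =
   2^-1 * (expR (h * x.+2%:R) * (K * tilted h c (r + m) x.+2) +
     expR (h * x%:R) * (K * tilted h c (r + m) x)) by ring.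
by rewrite ler_wpM2l ?invr_ge0 // lerD // ler_wpM2l ?expR_ge0.
Qed.

Lemma exc_le_tilted h b c K r m :
  (forall x, (b r x)%:R * hit h b r x <= K * tilted h c r x) ->
  exc h b (r + m).+1 <= K * tilted h c (r + m).+1 0.
Proof.
move=> H; have K0 : 0 <= K.
  have := H 0%N; move=> /(le_trans (mulr_ge0 (ler0n _ _) (hit_ge0 _ _ _ _))).
  by rewrite pmulr_lge0 // tilted_gt0.
have h1 := hit_le_tilted H m 1.
apply: (le_trans _ (ler_wpM2l K0 (tilted0_ge h c (r + m)))).
rewrite mulrCA /= ler_wpM2l // mulr_ge0 ?invr_ge0 ?expR_ge0 //.
Qed.

Lemma hit0_le_tilted h b c x : (b 0%N x)%:R * hit h b 0 x <= 1 * tilted h c 0 x.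
Proof.
rewrite mul1r /tilted big_nil mulr1 /= /delta0.
case: x => [|x]; last by rewrite mulr0 expR_ge0.
by rewrite mulr0 expR0 mulr1; case: (b _ _).
Qed.

(** This tilt makes the drifts of the steps antisymmetric around mid-time, as for
    a bridge. *)
Definition bridge_tilt h n : R := h * (n.+1%:R / 2).

Lemma tilted_bridge h n : tilted h (bridge_tilt h n) n 0 = expR (ltilt h n).
Proof.
rewrite /tilted mulr0 expR0 mul1r /ltilt expR_sum big_mkord.
by apply: eq_bigr => i _; rewrite expR_lcosh /bridge_tilt mulrBr.
Qed.

Lemma exc_le h b n : exc h b n <= expR (ltilt h n).
Proof.
case: n => [|n]; first exact: expR_ge0.
rewrite -tilted_bridge -[X in _ <= X]mul1r.
have := @exc_le_tilted h b (bridge_tilt h n.+1) 1 0 n.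
by rewrite add0n; apply => x; exact: hit0_le_tilted.
Qed.

(** Mean displacement, under the tilted law of a bridge of [n] steps, of the
    steps made before [r] steps remain. *)
Definition drift h n r : R := \sum_(r <= i < n) tanh (h * (i.+1%:R - n.+1%:R / 2)).

(** Chernoff's bound: shifting the tilt by [t] while more than [r] steps
    remain costs the exponential moment of the displacement. *)
Lemma exc_le_dev h b n r t k : (r < n)%N ->
  (forall x, b r x -> 0 <= t * (x%:R - k)) ->
  exc h b n <= expR (ltilt h n - t * (k - drift h n r) + t ^+ 2 / 2 * (n - r)%:R).
Proof.
move=> rn bk; pose c := bridge_tilt h n.
have ce i : h * i.+1%:R - c = h * (i.+1%:R - n.+1%:R / 2) by rewrite /c /bridge_tilt; ring.
pose P (c : R) (a e : nat) := \prod_(a <= i < e) cosh (h * i.+1%:R - c).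
have P0 c' a e : 0 < P c' a e by rewrite prodr_gt0 // => i _; exact: cosh_gt0.
pose K := expR (- (t * k)) * (P c 0%N r / P (c - t) 0%N r).
have K0 : 0 < K by rewrite /K mulr_gt0 ?expR_gt0 // divr_gt0.
have base x : (b r x)%:R * hit h b r x <= K * tilted h (c - t) r x.
  have [bx|_] := boolP (b r x); last first.
    by rewrite /= mul0r mulr_ge0 ?(ltW K0) // ltW ?tilted_gt0.
  have := @hit_le_tilted h b c 1 0 (hit0_le_tilted h b c) r x.
  rewrite add0n bx !mul1r => /le_trans; apply.
  have -> : K * tilted h (c - t) r x = expR (t * (x%:R - k)) * tilted h c r x.
    rewrite /K /tilted -/(P _ _ _) -/(P _ _ _).
    have -> : expR (- (t * k)) * (P c 0%N r / P (c - t) 0%N r) *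
        (expR ((h * r%:R - (c - t)) * x%:R) * P (c - t) 0%N r) =
      expR (- (t * k)) * expR ((h * r%:R - (c - t)) * x%:R) * P c 0%N r.
      by field; rewrite gt_eqF.
    by rewrite mulrA -!expRD; congr (expR _ * _); ring.
  rewrite ler_peMl ?(ltW (tilted_gt0 _ _ _ _)) //.
  by rewrite -[X in X <= _]expR0 ler_expR; exact: bk.
have nE : n = (r + (n - r).-1).+1 by lia.
have := exc_le_tilted (n - r).-1 base; rewrite -nE => /le_trans; apply.
rewrite /K /tilted mulr0 expR0 mul1r -/(P _ _ _) -/(P _ _ _).
rewrite /P (@big_cat_nat _ _ _ r _ n _ _ (leq0n r) (ltnW rn)) /= -!/(P _ _ _).
have -> : expR (- (t * k)) * (P c 0%N r / P (c - t) 0%N r) *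
    (P (c - t) 0%N r * P (c - t) r n) =
  expR (- (t * k)) * (P c 0%N r * P (c - t) r n) by field; rewrite gt_eqF.
have Pdev : P (c - t) r n <= P c r n * expR (t * drift h n r + t ^+ 2 / 2 * (n - r)%:R).
  rewrite /drift mulr_sumr.
  have -> : t ^+ 2 / 2 * (n - r)%:R = \sum_(r <= i < n) t ^+ 2 / 2.
    by rewrite sumr_const_nat mulr_natr.
  rewrite -big_split expR_sum /= /P -big_split /=; apply: ler_prod => i _.
  rewrite ltW ?cosh_gt0 //= opprB addrCA addrC -ce.
  by apply: le_trans (cosh_shift _ _) _; rewrite ce.
have PE : P c 0%N r * P c r n = expR (ltilt h n).
  rewrite /P -big_cat_nat //=; last exact: ltnW.
  rewrite -tilted_bridge /tilted mulr0 expR0 mul1r //.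
apply: (@le_trans _ _ (expR (- (t * k)) * (P c 0%N r *
   (P c r n * expR (t * drift h n r + t ^+ 2 / 2 * (n - r)%:R))))).
  by rewrite ler_wpM2l ?expR_ge0 // ler_wpM2l ?(ltW (P0 _ _ _)).
rewrite [P c 0%N r * _]mulrA PE -!expRD ler_expR.
by rewrite le_eqVlt; apply/orP; left; apply/eqP; ring.
Qed.

End Tilting.

(** * A random walk killed at the wall *)

Section KilledWalk.
Variable R : realType.
Variable d : nat -> R.
Hypothesis d_bound : forall i, -1 <= d i <= 1.

(** Law at time [j] of the walk from [0] that goes up with probability
    [(1 + d i) / 2] at step [i] and is killed when it returns to [0]. *)
Fixpoint walk j x : R :=
  if j is i.+1 then
    if x is y.+1 then (1 - d i) / 2 * walk i y.+2 + (1 + d i) / 2 * walk i y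
    else 0
  else delta0 R x.

Let up_ge0 i : 0 <= (1 + d i) / 2.
Proof. by have /andP[h1 h2] := d_bound i; rewrite divr_ge0 //; lra. Qed.

Let dn_ge0 i : 0 <= (1 - d i) / 2.
Proof. by have /andP[h1 h2] := d_bound i; rewrite divr_ge0 //; lra. Qed.

Lemma walk_ge0 j x : 0 <= walk j x.
Proof.
elim: j x => [|j IH] [|x] //=; rewrite ?/delta0 ?ler0n //.
by rewrite addr_ge0 // mulr_ge0.
Qed.

Lemma walk_far j x : (j < x)%N -> walk j x = 0.
Proof.
elim: j x => [|j IH] [|x] //= jx.
by rewrite !IH ?mulr0 ?addr0 //; lia.
Qed.

Lemma walkS0 j : walk j.+1 0 = 0. Proof. by []. Qed.

(** [g (x - 1)], or [0] when the walk is killed. *)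
Definition below (g : nat -> R) x : R := if x is y.+2 then g y.+1 else 0.

(** Duality: one step of the walk is transferred to the test function. *)
Lemma walk_test (g : nat -> R) j B : (j.+2 < B)%N ->
  \sum_(0 <= x < B) g x * walk j.+1 x =
  \sum_(0 <= x < B) walk j x *
    ((1 + d j) / 2 * g x.+1 + (1 - d j) / 2 * below g x).
Proof.
case: B => [//|B] jB; rewrite big_nat_recl // walkS0 mulr0 add0r.
rewrite [LHS](eq_bigr (fun x => (1 - d j) / 2 * (g x.+1 * walk j x.+2) +
   (1 + d j) / 2 * (g x.+1 * walk j x))); last by move=> x _ /=; ring.
rewrite big_split /=.
rewrite [RHS](eq_bigr (fun x => (1 + d j) / 2 * (g x.+1 * walk j x) +
   (1 - d j) / 2 * (walk j x * below g x))); last first.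
  by move=> x _; ring.
rewrite [RHS]big_split /= [RHS]addrC; congr (_ + _).
  rewrite -!mulr_sumr; congr (_ * _).
  case: B jB => [//|B] jB.
  rewrite [in RHS]big_nat_recl // mulr0 add0r [in RHS]big_nat_recl // mulr0 add0r.
  rewrite big_nat_recr //= walk_far ?mulr0 ?addr0; last by lia.
  by apply: eq_bigr => x _; rewrite mulrC.
rewrite [RHS]big_nat_recr //= walk_far ?mulr0 ?addr0 //; lia.
Qed.

Lemma walk_mass j B : (j.+1 < B)%N -> \sum_(0 <= x < B) walk j x <= 1.
Proof.
elim: j => [|j IH] jB.
  case: B jB => [//|B] _; rewrite big_nat_recl //= /delta0 /= big1 ?addr0 //.
have := @walk_test (fun _ => 1) j B jB.
under eq_bigr do rewrite mul1r.
move=> ->; apply: le_trans (IH (ltnW jB)); apply: ler_sum => x _.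
rewrite ler_piMr ?walk_ge0 //.
have := up_ge0 j; have := dn_ge0 j.
by case: x => [|[|x]] /=; lra.
Qed.

Definition walk_mean j : R := \sum_(0 <= i < j) d i.

(** Without killing the variance grows by [1 - d j ^ 2] at step [j]; killing only
    removes mass. *)
Lemma walk_second_moment j B : (j.+1 < B)%N ->
  \sum_(0 <= x < B) (x%:R - walk_mean j) ^+ 2 * walk j x <= j%:R.
Proof.
elim: j => [|j IH] jB.
  case: B jB => [//|B] _; rewrite big_nat_recl //= /walk_mean big_nil subrr.
  by rewrite expr0n /= mul0r big1 ?addr0 // => x _; rewrite /delta0 /= mulr0.
rewrite walk_test //.
apply: (@le_trans _ _ (\sum_(0 <= x < B) ((x%:R - walk_mean j) ^+ 2 * walk j x
   + walk j x))); last first.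
  rewrite big_split /= -natr1 lerD //; first exact: IH (ltnW jB).
  exact: walk_mass (ltnW jB).
apply: ler_sum => x _.
rewrite -[X in _ <= _ + X]mul1r -mulrDl mulrC ler_wpM2r ?walk_ge0 //.
have mS : walk_mean j.+1 = walk_mean j + d j by rewrite /walk_mean big_nat_recr.
have h : (1 + d j) / 2 * (x%:R + 1 - walk_mean j.+1) ^+ 2 +
  (1 - d j) / 2 * (x%:R - 1 - walk_mean j.+1) ^+ 2 <= (x%:R - walk_mean j) ^+ 2 + 1.
  rewrite mS; have := sqr_ge0 (d j).
  set m := walk_mean j; set e := d j; set y : R := x%:R => h0.
  have -> : (1 + e) / 2 * (y + 1 - (m + e)) ^+ 2 +
     (1 - e) / 2 * (y - 1 - (m + e)) ^+ 2 = (y - m) ^+ 2 + 1 - e ^+ 2 by field.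
  lra.
apply: le_trans h; rewrite -(natr1 x) lerD2l ler_wpM2l //.
case: x => [|[|x]]; rewrite /= ?sqr_ge0 //.
by rewrite -[in X in _ <= X](natr1 x.+1) addrK.
Qed.

(** Lower bound on the survival probability. The martingale
    [1 - exp (- t x) / prod kappa], where [kappa] is the exponential moment of a
    step, is nonpositive at [0], so killing only increases its mean. *)
Lemma walk_alive t n B : (n.+1 < B)%N -> (0 < n)%N ->
  (forall j, (0 < j <= n)%N ->
    \prod_(1 <= i < j) ((1 + d i) / 2 * expR (- t) + (1 - d i) / 2 * expR t) <= 1) ->
  (forall i, 0 < (1 + d i) / 2 * expR (- t) + (1 - d i) / 2 * expR t) ->
  (1 + d 0) / 2 * (1 - expR (- t)) <= \sum_(0 <= x < B) walk n x.
Proof.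
move=> nB n0 K1 k0.
pose k i := (1 + d i) / 2 * expR (- t) + (1 - d i) / 2 * expR t.
pose K j := \prod_(1 <= i < j) k i.
have K0 j : 0 < K j by rewrite /K prodr_gt0 // => i _; exact: k0.
pose g j (x : nat) := 1 - expR (- (t * x%:R)) / K j.
have H j : (0 < j <= n)%N ->
    (1 + d 0) / 2 * (1 - expR (- t)) <= \sum_(0 <= x < B) g j x * walk j x.
  elim: j => [//|[|j] IH] jn.
    have -> : (1 + d 0) / 2 * (1 - expR (- t)) = g 1%N 1%N * walk 1 1.
      rewrite /g /K big_geq // divr1 mulr1 /= /delta0 /= mulr0 add0r mulr1 mulrC.
      by [].
    have m1 : 1%N \in index_iota 0 B by rewrite mem_index_iota; lia.
    rewrite -[X in X <= _]addr0 (bigD1_seq _ m1 (iota_uniq _ _)).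
    rewrite lerD2l big1 // => x x1.
    have [->|x0] := eqVneq x 0%N; first by rewrite walkS0 mulr0.
    by rewrite walk_far ?mulr0 //; lia.
  rewrite walk_test; last by lia.
  apply: le_trans (IH _) _; first lia.
  apply: ler_sum => x _; rewrite mulrC.
  case: x => [|x]; first by rewrite walkS0 !mul0r.
  rewrite ler_wpM2l ?walk_ge0 //.
  have Kj : K j.+2 = K j.+1 * k j.+1 by rewrite /K big_nat_recr.
  have -> : g j.+1 x.+1 = (1 + d j.+1) / 2 * g j.+2 x.+2 + (1 - d j.+1) / 2 * g j.+2 x.
    rewrite /g Kj.
    have -> : expR (- (t * x.+2%:R)) = expR (- (t * x.+1%:R)) * expR (- t).
      by rewrite -expRD; congr expR; rewrite -(natr1 x.+1); ring.
    have -> : expR (- (t * x%:R)) = expR (- (t * x.+1%:R)) * expR t.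
      by rewrite -expRD; congr expR; rewrite -(natr1 x); ring.
    have kk : k j.+1 != 0 by rewrite gt_eqF // k0.
    have KK : K j.+1 != 0 by rewrite gt_eqF.
    set E := expR _; have -> : E / K j.+1 = E * k j.+1 / (K j.+1 * k j.+1).
      by field; rewrite KK kk.
    by rewrite {1}/k; field; rewrite KK kk.
  rewrite lerD2l ler_wpM2l //; case: x => [|x]; last by [].
  rewrite /g mulr0 oppr0 expR0 subr_le0 div1r invf_ge1 //; apply: K1; lia.
apply: le_trans (H n _) _; first by rewrite n0 leqnn.
apply: ler_sum => x _; rewrite ler_piMl ?walk_ge0 // /g.
by rewrite lerBlDr lerDl divr_ge0 ?expR_ge0 // ltW.
Qed.

Section Nash.
Variable kappa : R.

Let T j y : R := `|walk j y.+2 ^+ 2 - walk j y ^+ 2|.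

(** Telescoping from infinity by steps of [2], as the walk keeps its parity. *)
Lemma walk_sqr_le j B x : (j < B)%N -> (x <= B)%N ->
  walk j x ^+ 2 <= \sum_(0 <= y < B) T j y.
Proof.
move=> jB xB.
have H n : (n <= B)%N -> walk j (B - n) ^+ 2 <= \sum_(B - n <= y < B) T j y /\
   walk j (B - n).+1 ^+ 2 <= \sum_(B - n <= y < B) T j y.
  elim: n => [|n IH] nB.
    by rewrite subn0 big_geq // !walk_far ?expr0n //; lia.
  have [h1 h2] := IH (ltnW nB).
  have e : (B - n = (B - n.+1).+1)%N by lia.
  rewrite big_ltn; last by lia.
  rewrite -e; split; last first.
    by apply: le_trans h1 _; rewrite lerDr normr_ge0.
  have -> : walk j (B - n.+1) ^+ 2 = - (walk j (B - n.+1).+2 ^+ 2 - walk j (B - n.+1) ^+ 2)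
     + walk j (B - n).+1 ^+ 2 by rewrite e; ring.
  by rewrite lerD // ler_normr lexx orbT.
have [h _] := H (B - x)%N (leq_subr _ _).
rewrite subKn // in h; apply: le_trans h _.
rewrite [X in _ <= X](@big_cat_nat _ _ _ x) //=.
by rewrite lerDr sumr_ge0 // => y _; exact: normr_ge0.
Qed.

Definition walk_l2 j B : R := \sum_(0 <= x < B) walk j x ^+ 2.
Definition walk_energy j B : R := \sum_(0 <= x < B) (walk j x.+2 - walk j x) ^+ 2.

Lemma sum_shift2_le (f : nat -> R) B : (forall x, 0 <= f x) ->
  (forall x, (B <= x)%N -> f x = 0) ->
  \sum_(0 <= x < B) f x.+2 <= \sum_(0 <= x < B) f x.
Proof.
move=> f0 fB; have h1 (g : nat -> R) : (forall x, 0 <= g x) -> g B = 0 ->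
    \sum_(0 <= x < B) g x.+1 <= \sum_(0 <= x < B) g x.
  move=> g0 gB; have e : \sum_(0 <= x < B.+1) g x = g 0%N + \sum_(0 <= x < B) g x.+1.
      by rewrite big_nat_recl.
    by rewrite big_nat_recr //= gB addr0 in e; rewrite e lerDr.
apply: le_trans (h1 f f0 (fB _ (leqnn _))).
by apply: (h1 (fun x => f x.+1)) => //; exact: fB.
Qed.

Lemma walk_l2_le j B : (j < B)%N -> forall s : R, 0 < s -> forall x, (x <= B)%N ->
  walk j x ^+ 2 <= s / 2 * walk_energy j B + 2 / s * walk_l2 j B.
Proof.
move=> jB s s0 x xB; apply: (le_trans (walk_sqr_le jB xB)).
apply: (@le_trans _ _ (\sum_(0 <= y < B) (s / 2 * (walk j y.+2 - walk j y) ^+ 2 +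
   s^-1 * (walk j y.+2 ^+ 2 + walk j y ^+ 2)))).
  apply: ler_sum => y _; rewrite /T subr_sqr normrM.
  set a := walk j y.+2; set b := walk j y.
  have ab0 : 0 <= a + b by rewrite addr_ge0 ?walk_ge0.
  rewrite (ger0_norm ab0) -(real_normK (num_real (a - b))).
  set z := `|a - b|.
  have h1 : (a + b) ^+ 2 <= 2 * (a ^+ 2 + b ^+ 2) by have := sqr_ge0 (a - b); nra.
  have h2 : 0 <= (s * z - (a + b)) ^+ 2 / (2 * s) by rewrite divr_ge0 ?sqr_ge0 //; lra.
  have e : (s * z - (a + b)) ^+ 2 / (2 * s) = s / 2 * z ^+ 2 - z * (a + b) +
    s^-1 * ((a + b) ^+ 2 / 2) by field; rewrite gt_eqF.
  rewrite e in h2.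
  have h3 : s^-1 * ((a + b) ^+ 2 / 2) <= s^-1 * (a ^+ 2 + b ^+ 2).
    by rewrite ler_wpM2l ?invr_ge0 ?(ltW s0) //; lra.
  lra.
rewrite big_split /= -mulr_sumr lerD2l -mulr_sumr big_split /=.
have h : \sum_(0 <= x < B) walk j x.+2 ^+ 2 <= \sum_(0 <= x < B) walk j x ^+ 2.
  apply: (@sum_shift2_le (fun x => walk j x ^+ 2)) => [x'|y By]; first exact: sqr_ge0.
  by rewrite walk_far ?expr0n //; lia.
rewrite [2 / s]mulrC -mulrA ler_wpM2l ?invr_ge0 ?(ltW s0) //.
by rewrite /walk_l2; lra.
Qed.

(** Nash's inequality: the supremum of the density is controlled by the energy
    and the [l2] norm, and [l2] is at most supremum times mass, the mass being at
    most [1]. *)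
Lemma walk_nash j B : (j.+1 < B)%N -> walk_l2 j B ^+ 3 / 4 <= walk_energy j B.
Proof.
move=> jB; set u := walk_l2 j B; set D := walk_energy j B.
have u0 : 0 <= u by rewrite /u /walk_l2 sumr_ge0 // => x _; exact: sqr_ge0.
have D0 : 0 <= D by rewrite /D /walk_energy sumr_ge0 // => x _; exact: sqr_ge0.
have [->|un0] := eqVneq u 0; first by rewrite expr0n /= mul0r.
have {un0}u_gt0 : 0 < u by rewrite lt0r un0.
(* s = 4 / u makes the l2 term of the bound u ^ 2 / 2, to be absorbed *)
pose B0 := 4 / u / 2 * D + 2 / (4 / u) * u.
have B00 : 0 <= B0 by rewrite /B0 addr_ge0 // !mulr_ge0 ?invr_ge0 // ?divr_ge0 //.
have wB x : (x < B)%N -> walk j x <= Num.sqrt B0.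
  move=> xB; rewrite -[walk j x]ger0_norm ?walk_ge0 // -sqrtr_sqr ler_wsqrtr //.
  by apply: walk_l2_le => //; [lia | rewrite divr_gt0 | exact: ltnW].
have : u <= Num.sqrt B0.
  apply: (@le_trans _ _ (\sum_(0 <= x < B) Num.sqrt B0 * walk j x)).
    rewrite /u /walk_l2 big_nat [X in _ <= X]big_nat.
    by apply: ler_sum => x xB; rewrite expr2 ler_wpM2r ?walk_ge0 // wB.
  rewrite -mulr_sumr ler_piMr ?sqrtr_ge0 //; exact: walk_mass.
rewrite -ler_sqr ?nnegrE ?sqrtr_ge0 // sqr_sqrtr // => h.
have e : B0 = 2 * D / u + u ^+ 2 / 2 by rewrite /B0; field; rewrite gt_eqF.
have h2 : u ^+ 2 / 2 <= 2 * D / u by rewrite e in h; lra.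
by move: h2; rewrite ler_pdivlMr //; rewrite exprS [_ ^+ 3]exprS; nra.
Qed.

(** A step averages two neighbouring values, which loses a multiple of the
    energy by strict convexity of the square. *)
Lemma walk_l2_step j B : (j.+2 < B)%N -> kappa <= (1 - d j ^+ 2) / 4 ->
  walk_l2 j.+1 B <= walk_l2 j B - kappa * walk_energy j B.
Proof.
move=> jB kd; rewrite /walk_l2 /walk_energy.
case: B jB => [//|B] jB; rewrite [X in X <= _]big_nat_recl // walkS0 expr0n /= add0r.
have e y : ((1 - d j) / 2 * walk j y.+2 + (1 + d j) / 2 * walk j y) ^+ 2 =
   (1 - d j) / 2 * walk j y.+2 ^+ 2 + (1 + d j) / 2 * walk j y ^+ 2
   - (1 - d j ^+ 2) / 4 * (walk j y.+2 - walk j y) ^+ 2 by field.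
apply: (@le_trans _ _ (\sum_(0 <= y < B.+1) ((1 - d j) / 2 * walk j y.+2 + (1 + d j) / 2 * walk j y) ^+ 2)).
  by rewrite [X in _ <= X]big_nat_recr //= lerDl sqr_ge0.
rewrite (eq_bigr _ (fun y _ => e y)).
rewrite sumrB; apply: lerB; last first.
  rewrite -mulr_sumr ler_wpM2r // sumr_ge0 // => x _; exact: sqr_ge0.
rewrite big_split /= -!mulr_sumr.
have h : \sum_(0 <= x < B.+1) walk j x.+2 ^+ 2 <= \sum_(0 <= x < B.+1) walk j x ^+ 2.
  apply: (@sum_shift2_le (fun x => walk j x ^+ 2)) => [x'|y By]; first exact: sqr_ge0.
  by rewrite walk_far ?expr0n //; lia.
have := ler_wpM2l (dn_ge0 j) h; lra.
Qed.

(** The discrete form of [u' <= - kappa u ^ 3 / 4]: the [l2] norm decays at least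
    like the inverse square root of the time. *)
Lemma walk_l2_decay n B : (n.+1 < B)%N -> 0 <= kappa ->
  (forall j, (j < n)%N -> kappa <= (1 - d j ^+ 2) / 4) ->
  walk_l2 n B ^+ 2 * (1 + kappa / 4 * n%:R) <= 1.
Proof.
move=> nB k0; elim: n nB => [|n IH] nB kd.
  rewrite mulr0 addr0 mulr1 /walk_l2; case: B nB => [//|B] nB.
  rewrite big_nat_recl // big1 => [|x _]; last by rewrite /= /delta0 expr0n.
  by rewrite /= /delta0 /= addr0 !expr1n.
have {}IH := IH (ltnW nB) (fun j jn => kd j (ltnW jn)).
have st := walk_l2_step nB (kd n (ltnSn n)).
have na := walk_nash (ltnW nB).
have k1 : kappa <= 1 / 4.
  by have := kd n (ltnSn n); have := sqr_ge0 (d n); lra.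
have u0 j : 0 <= walk_l2 j B by rewrite /walk_l2 sumr_ge0 // => x _; exact: sqr_ge0.
set u := walk_l2 n B in IH st na *; set u' := walk_l2 n.+1 B in st *.
have {}u0' : 0 <= u' by exact: u0.
have {}u0 : 0 <= u by exact: u0.
pose e := kappa / 4; rewrite -/e in IH *.
have e0 : 0 <= e by rewrite /e divr_ge0.
have e1 : e <= 1 / 16 by rewrite /e; lra.
pose v := u ^+ 2; have v0 : 0 <= v by rewrite sqr_ge0.
pose t := 1 + e * n%:R; have t1 : 1 <= t by rewrite /t lerDl mulr_ge0.
have vt : v * t <= 1 by [].
have v1 : v <= 1 by nra.
have hu : u' <= u * (1 - e * v).
  apply: le_trans st _; have := ler_wpM2l k0 na.
  have -> : u * (1 - e * v) = u - kappa * (u ^+ 3 / 4) by rewrite /e /v; field.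
  by lra.
have ev : 0 <= e * v <= 1 by apply/andP; split; [rewrite mulr_ge0 | nra].
have hv : u' ^+ 2 <= v * (1 - e * v).
  have : u' ^+ 2 <= (u * (1 - e * v)) ^+ 2 by rewrite ler_sqr ?nnegrE //; apply: le_trans hu.
  rewrite exprMn -/v => /le_trans; apply; rewrite ler_wpM2l //.
  by move: ev => /andP[]; set z := e * v; nra.
have -> : 1 + e * n.+1%:R = t + e by rewrite /t -natr1; ring.
apply: (@le_trans _ _ (v * (1 - e * v) * (t + e))).
  by rewrite ler_wpM2r // addr_ge0 // (le_trans _ t1).
(* v (1 - e v) increases with v in this range: v may be replaced by 1 / t *)
have zt : v <= t^-1 by rewrite -div1r ler_pdivlMr // (lt_le_trans _ t1).
have t0 : 0 < t by apply: lt_le_trans t1.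
have h1 : v * (1 - e * v) <= t^-1 * (1 - e * t^-1).
  have ti1 : t^-1 <= 1 by rewrite invf_le1.
  rewrite -subr_ge0.
  have -> : t^-1 * (1 - e * t^-1) - v * (1 - e * v) =
    (t^-1 - v) * (1 - e * (t^-1 + v)) by ring.
  rewrite mulr_ge0 ?subr_ge0 //.
  have : e * (t^-1 + v) <= 1 / 16 * 2 by apply: ler_pM => //; [rewrite addr_ge0 // invr_ge0 ltW | lra].
  lra.
apply: (le_trans (ler_wpM2r _ h1)); first by rewrite addr_ge0 // ltW.
have -> : t^-1 * (1 - e * t^-1) * (t + e) = 1 - (e / t) ^+ 2 by field; rewrite gt_eqF.
by rewrite lerBlDr lerDl sqr_ge0.
Qed.

End Nash.
End KilledWalk.

(** * Excursions as squared densities *)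

Section ExcursionSquare.
Variable R : realType.
Implicit Types (h c : R) (b : nat -> nat -> bool) (g : nat -> R).

(** Transfer operator of the recursion of [hit], with the wall absorbing. *)
Definition kill h g x : R :=
  if x is y.+1 then
    2^-1 * (expR (h * x.+1%:R) * g x.+1 + expR (h * y%:R) * g y)
  else 0.

Lemma hitS h b j : hit h b j.+1 =1 kill h (fun x => (b j x)%:R * hit h b j x).
Proof. by case. Qed.

Lemma eq_kill h g1 g2 : g1 =1 g2 -> kill h g1 =1 kill h g2.
Proof. by move=> e [|x] //=; rewrite !e. Qed.

Lemma hit_far h b j x : (j < x)%N -> hit h b j x = 0.
Proof.
elim: j x => [|j IH] [|x] //= jx.
by rewrite !IH ?mulr0 ?addr0 ?mulr0 //; lia.
Qed.

Lemma hit_odd h b j x : odd (j + x) -> hit h b j x = 0.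
Proof.
elim: j x => [|j IH] [|x] //= jx.
by rewrite !IH ?mulr0 ?addr0 ?mulr0 //; move: jx; rewrite !addnS /= ?negbK.
Qed.

Lemma exc_odd h b n : odd n -> exc h b n = 0.
Proof.
case: n => [//|n] /= n1; rewrite hit_odd ?mulr0 //.
by rewrite addn1.
Qed.

(** The killed transfer operator is self-adjoint for the weight [exp (h x)]. *)
Lemma kill_adjoint h f g B : f 0%N = 0 -> g 0%N = 0 -> f B = 0 -> f B.+1 = 0 ->
  \sum_(0 <= x < B.+1) expR (h * x%:R) * (f x * kill h g x) =
  \sum_(0 <= x < B.+1) expR (h * x%:R) * (kill h f x * g x).
Proof.
move=> f0 g0 fB fB1.
have E (u v : nat -> R) : u 0%N = 0 ->
   \sum_(0 <= x < B.+1) expR (h * x%:R) * (u x * kill h v x) =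
   2^-1 * (\sum_(0 <= x < B.+1) expR (h * x%:R) * expR (h * x.+1%:R) * (u x * v x.+1) +
           \sum_(0 <= x < B) expR (h * x%:R) * expR (h * x.+1%:R) * (u x.+1 * v x)).
  move=> u0; rewrite big_nat_recl //= !mulr0 add0r.
  rewrite [X in 2^-1 * (X + _)]big_nat_recl //= u0 mul0r mulr0 add0r.
  rewrite -big_split mulr_sumr /=; apply: eq_bigr => x _; ring.
rewrite E //.
rewrite [RHS](eq_bigr (fun x => expR (h * x%:R) * (g x * kill h f x))); last first.
  by move=> x _; rewrite (mulrC (g x)).
rewrite E //; congr (_ * _).
rewrite addrC big_nat_recr //= fB mul0r mulr0 addr0.
rewrite [X in _ = X + _]big_nat_recr //= fB1 mulr0 mulr0 addr0.
by congr (_ + _); apply: eq_bigr => x _; rewrite [g _ * _]mulrC.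
Qed.

(** Self-adjointness moves the steps of an excursion, one by one, from its first
    part to its second part. *)
Lemma iter_kill_hit h m g B : g 0%N = 0 -> (m.+2 < B)%N ->
  2^-1 * expR (h * 1%:R) * iter m (kill h) g 1 =
  \sum_(0 <= x < B) expR (h * x%:R) * (hit h anywhere m.+1 x * g x).
Proof.
case: B => [//|B]; elim: m g => [|m IH] g g0 mB.
  have m1 : 1%N \in index_iota 0 B.+1 by rewrite mem_index_iota; lia.
  rewrite (bigD1_seq _ m1 (iota_uniq _ _)) big1 /= => [|x x1].
    by rewrite /delta0 /= addr0 !mul1r mulr0 add0r mulr0 expR0; ring.
  case: x x1 => [|[|x]] //= _; first by rewrite mul0r mulr0.
  by rewrite /delta0 /= !mulr0 addr0 mulr0 mul0r mulr0.
rewrite iterSr IH //; last exact: ltnW.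
rewrite (@kill_adjoint h _ g B) // ?hit_far //; try lia.
by apply: eq_bigr => x _; congr (_ * (_ * _)); rewrite hitS; apply: eq_kill => y; rewrite mul1r.
Qed.

(** As in [hit] times are counted backwards: [i] is the number of steps that
    remain. *)
Definition at_time k (P : nat -> bool) (i x : nat) := (i == k) ==> P x.

Lemma hit_at_time_before h k P j x : (j <= k)%N ->
  hit h (at_time k P) j x = hit h anywhere j x.
Proof.
elim: j x => [//|j IH] x jk; rewrite !hitS; apply: eq_kill => y.
by rewrite IH ?(ltnW jk) // /at_time ltn_eqF.
Qed.

Lemma hit_at_time_after h k P m x :
  hit h (at_time k P) (k + m.+1) x =
  iter m.+1 (kill h) (fun x => (P x)%:R * hit h anywhere k x) x.
Proof.
elim: m x => [|m IH] x.
  by rewrite addn1 hitS; apply: eq_kill => y; rewrite /at_time eqxx hit_at_time_before.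
rewrite addnS hitS iterS; apply: eq_kill => y.
by rewrite -IH /at_time (_ : (k + m.+1 == k) = false) ?mul1r //; lia.
Qed.

Lemma excS h b n : exc h b n.+1 =
  2^-1 * expR (h * 1%:R) * ((b n 1%N)%:R * hit h b n 1).
Proof. by []. Qed.

Lemma exc_at_time h k P : (0 < k)%N ->
  exc h (at_time k P) (k + k) =
  \sum_(0 <= x < k.+2) expR (h * x%:R) * ((P x)%:R * hit h anywhere k x ^+ 2).
Proof.
case: k => [//|k] _.
rewrite (eq_bigr (fun x => expR (h * x%:R) * (hit h anywhere k.+1 x *
   ((P x)%:R * hit h anywhere k.+1 x)))); last by move=> x _; ring.
rewrite -iter_kill_hit ?mulr0 // addnS excS; congr (_ * _).
case: k => [|k]; first by rewrite /at_time eqxx hit_at_time_before.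
have -> : at_time k.+2 P (k.+2 + k.+1) 1 = true.
  by rewrite /at_time (_ : (k.+2 + k.+1 == k.+2) = false) //; lia.
by rewrite mul1r hit_at_time_after.
Qed.

Lemma exc_anywhere h b n : (forall i x, b i x) -> exc h b n = exc h anywhere n.
Proof.
move=> bT; have H j x : hit h b j x = hit h anywhere j x.
  by elim: j x => [//|j IH] [|x] //=; rewrite !bT !IH.
by case: n => [//|n] /=; rewrite bT H.
Qed.

(** Drift of the walk obtained from [hit] by the tilt [c]. *)
Definition step_drift h c i : R := tanh (c - h * i.+1%:R).

Lemma step_drift_bound h c i : -1 <= step_drift h c i <= 1.
Proof. by rewrite !ltW ?tanh_lt1 ?tanh_gtN1. Qed.

(** Doob transform: dividing by an exact solution turns the weights into
    probabilities. *)
Lemma hit_walk h c j x :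
  hit h anywhere j x = tilted h c j x * walk (step_drift h c) j x.
Proof.
elim: j x => [|j IH] x.
  rewrite /= /tilted big_nil mulr1 /delta0; case: x => [|x].
    by rewrite mulr0 expR0 mulr1.
  by rewrite mulr0.
case: x => [|x] /=; first by rewrite mulr0.
rewrite !mul1r !IH /tilted big_nat_recr //=; set P := \prod_(0 <= i < j) _.
have dE : step_drift h c j = - tanh (h * j.+1%:R - c) by rewrite -tanhN opprB.
have e1 : expR (h * x.+2%:R) * expR ((h * j%:R - c) * x.+2%:R) =
   expR ((h * j.+1%:R - c) * x.+1%:R) * expR (h * j.+1%:R - c).
  by rewrite -!expRD; congr expR; rewrite -!natr1; ring.
have e2 : expR (h * x%:R) * expR ((h * j%:R - c) * x%:R) =
   expR ((h * j.+1%:R - c) * x.+1%:R) * expR (- (h * j.+1%:R - c)).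
  by rewrite -!expRD; congr expR; rewrite -!natr1; ring.
set w2 := walk _ j x.+2; set w0 := walk _ j x.
transitivity (2^-1 * (expR (h * x.+2%:R) * expR ((h * j%:R - c) * x.+2%:R) * P * w2 +
    expR (h * x%:R) * expR ((h * j%:R - c) * x%:R) * P * w0)); first by ring.
rewrite e1 e2 (expR_tanh (h * _ - c)) (expR_tanh (- _)) coshN tanhN dE.
by field.
Qed.

(** The drifts of a bridge are antisymmetric around mid-time. *)
Lemma ltilt_double h k :
  expR (ltilt h (k + k)) =
  (\prod_(0 <= i < k) cosh (h * i.+1%:R - bridge_tilt h (k + k))) ^+ 2.
Proof.
rewrite -tilted_bridge /tilted mulr0 expR0 mul1r.
rewrite (@big_cat_nat _ _ _ k) //= ?leq_addr // expr2; congr (_ * _).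
rewrite -{1}[k]add0n big_addn addnK big_nat_rev /=.
apply: eq_big_nat => i /andP[_ ik]; rewrite -coshN; congr cosh.
rewrite /bridge_tilt add0n.
have -> : (k - i.+1 + k).+1%:R = (k + k)%:R - i%:R :> R.
  by rewrite -natrB; [congr (_%:R); lia | lia].
by rewrite -!natr1 natrD; field.
Qed.

(** At mid-time the two halves of an excursion are independent copies of the
    same killed walk, up to the normalisation: hence the square. *)
Lemma exc_square h k P : (0 < k)%N ->
  exc h (at_time k P) (k + k) = expR (ltilt h (k + k)) *
  \sum_(0 <= x < k.+2) (P x)%:R * walk (step_drift h (bridge_tilt h (k + k))) k x ^+ 2.
Proof.
move=> k0; rewrite exc_at_time // ltilt_double mulr_sumr; apply: eq_bigr => x _.
rewrite (hit_walk h (bridge_tilt h (k + k))) /tilted; set Pr := \prod_(_ <= i < _) _.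
set w := walk _ _ _.
have -> : expR (h * x%:R) * ((P x)%:R *
   (expR ((h * k%:R - bridge_tilt h (k + k)) * x%:R) * Pr * w) ^+ 2) =
   (expR (h * x%:R) * (expR ((h * k%:R - bridge_tilt h (k + k)) * x%:R) *
    expR ((h * k%:R - bridge_tilt h (k + k)) * x%:R))) *
    (Pr ^+ 2 * ((P x)%:R * w ^+ 2)) by ring.
rewrite -!expRD.
have -> : h * x%:R + ((h * k%:R - bridge_tilt h (k + k)) * x%:R +
   (h * k%:R - bridge_tilt h (k + k)) * x%:R) = 0.
  by rewrite /bridge_tilt -natr1 natrD; field.
by rewrite expR0 mul1r.
Qed.

End ExcursionSquare.

(** * Sharp asymptotics of excursions *)

Section ExcursionAsymptotics.
Variable R : realType.
Implicit Types (h p eta sigma : R).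

(** The tangents of the convex function [lcosh] at both ends of a cell enclose
    its increment, so each cell contributes only the error on the sample points
    and one mesh. *)
Lemma tanh_sum_lcosh h p eta (a : nat -> R) n : 0 <= h ->
  (forall i, (i < n)%N -> `|a i - (p - h * i%:R)| <= eta) ->
  `|h * (\sum_(0 <= i < n) tanh (a i)) - (lcosh p - lcosh (p - h * n%:R))|
    <= h * n%:R * (eta + h).
Proof.
move=> h0; elim: n => [|n IH] H.
  by rewrite big_geq // mulr0 subr0 subrr subr0 normr0 mul0r.
rewrite big_nat_recr //= mulrDr.
have {}IH := IH (fun i ni => H i (ltnW ni)).
have Hn := H n (ltnSn n).
have t1 := lcosh_tangent (p - h * n%:R) (p - h * n.+1%:R).
have t2 := lcosh_tangent (p - h * n.+1%:R) (p - h * n%:R).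
have e : p - h * n%:R - (p - h * n.+1%:R) = h by rewrite -natr1; ring.
have e' : p - h * n.+1%:R - (p - h * n%:R) = - h by rewrite -natr1; ring.
rewrite e in t1; rewrite e' in t2.
have l1 := tanh_lipschitz (a n) (p - h * n%:R).
have l2 := tanh_lipschitz (a n) (p - h * n.+1%:R).
have H2 : `|a n - (p - h * n.+1%:R)| <= eta + h.
  have -> : a n - (p - h * n.+1%:R) = a n - (p - h * n%:R) + h by rewrite -natr1; ring.
  by apply: (le_trans (ler_normD _ _)); rewrite (ger0_norm h0) lerD2r.
have {}l1 : tanh (a n) - tanh (p - h * n%:R) >= - (eta + h).
  have := le_trans l1 Hn; rewrite ler_norml => /andP[+ _].
  by apply: le_trans; rewrite lerN2 lerDl.
have {}l2 : tanh (a n) - tanh (p - h * n.+1%:R) <= eta + h.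
  by have := le_trans l2 H2; rewrite ler_norml => /andP[].
set S := \sum_(0 <= i < n) _ in IH *.
set T := tanh (a n) in l1 l2 *.
have {}l1 := ler_wpM2l h0 l1; have {}l2 := ler_wpM2l h0 l2.
have -> : h * n.+1%:R * (eta + h) = h * n%:R * (eta + h) + h * (eta + h).
  by rewrite -natr1; ring.
by move: IH; rewrite !ler_norml => /andP[i1 i2]; apply/andP; split; lra.
Qed.

Lemma bridge_step h k i :
  bridge_tilt h (k + k) - h * i.+1%:R = h * (k%:R - 2^-1) - h * i%:R.
Proof. by rewrite /bridge_tilt -!natr1 natrD; field. Qed.

Lemma bridge_step_bound h k i sigma : 0 <= h -> h * k%:R <= sigma -> (i < k)%N ->
  0 <= bridge_tilt h (k + k) - h * i.+1%:R <= sigma.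
Proof.
move=> h0 hk ik; rewrite bridge_step.
have i0 : 0 <= i%:R :> R by [].
have ik' : i%:R + 1 <= k%:R :> R by rewrite natr1 ler_nat.
have := mulr_ge0 h0 i0; have := ler_wpM2l h0 ik'; lra.
Qed.

(** The mid-time density of the killed walk has mass at most [1], and Nash's
    inequality spreads it over a width of order [sqrt k]. *)
Lemma exc_le_sharp sigma : 0 < sigma -> exists2 C : R, 0 < C &
  forall h k, 0 <= h -> h * k%:R <= sigma -> (0 < k)%N ->
  exc h anywhere (k + k) <= C / Num.sqrt k%:R * expR (ltilt h (k + k)).
Proof.
move=> s0; pose kappa := (1 - tanh sigma ^+ 2) / 4.
have ka0 : 0 < kappa by rewrite /kappa sqr_tanh divr_gt0 // invr_gt0 exprn_gt0 // cosh_gt0.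
exists (2 / Num.sqrt kappa); first by rewrite divr_gt0 // sqrtr_gt0.
move=> h k h0 hk k0.
have <- : exc h (at_time k xpredT) (k + k) = exc h anywhere (k + k).
  by apply: exc_anywhere => i x; rewrite /at_time; case: eqP.
rewrite exc_square // mulrC ler_wpM2r ?expR_ge0 //.
set d := step_drift _ _.
have -> : \sum_(0 <= x < k.+2) true%:R * walk d k x ^+ 2 = walk_l2 d k k.+2.
  by apply: eq_bigr => x _; rewrite mul1r.
have dk j : (j < k)%N -> kappa <= (1 - d j ^+ 2) / 4.
  move=> jk; rewrite /kappa ler_pM2r ?invr_gt0 // lerD2l lerN2.
  have /andP[a0 a1] := bridge_step_bound h0 hk jk.
  by rewrite /d /step_drift ler_sqr ?nnegrE ?tanh_ge0 ?tanh_le // ltW.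
have := walk_l2_decay (step_drift_bound h _) (ltnSn k.+1) (ltW ka0) dk.
rewrite -/d; set u := walk_l2 d k k.+2 => hu.
have kR : 0 < k%:R :> R by rewrite ltr0n.
have u0 : 0 <= u by rewrite /u /walk_l2 sumr_ge0 // => x _; exact: sqr_ge0.
have C0 : 0 <= 2 / Num.sqrt kappa / Num.sqrt k%:R by rewrite !divr_ge0 ?sqrtr_ge0.
rewrite -ler_sqr ?nnegrE // !expr_div_n !sqr_sqrtr ?(ltW ka0) ?(ltW kR) //.
rewrite -mulrA -invfM ler_pdivlMr ?(mulr_gt0 ka0 kR) //.
have : u ^+ 2 * (kappa / 4 * k%:R) <= 1.
  by apply: le_trans hu; rewrite ler_wpM2l ?sqr_ge0 // lerDr.
by lra.
Qed.

Lemma count_window (m w : R) B : 0 <= m - w -> 0 <= w ->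
  (count (fun x : nat => `|x%:R - m| <= w) (iota 0 B))%:R <= 2 * w + 2.
Proof.
move=> mw w0; rewrite -size_filter.
pose lo := Num.truncn (m - w); pose len := (Num.truncn (2 * w)).+2.
have lo_le : lo%:R <= m - w by rewrite truncn_le.
have lo_gt : m - w < lo.+1%:R by rewrite truncnS_gt.
have t_le : (Num.truncn (2 * w))%:R <= 2 * w by rewrite truncn_le // mulr_ge0.
have t_gt : 2 * w < (Num.truncn (2 * w)).+1%:R by rewrite truncnS_gt.
have lenE : len%:R = (Num.truncn (2 * w))%:R + 2 :> R by rewrite /len -addn2 natrD.
apply: (@le_trans _ _ (len%:R)); first last.
  by rewrite lenE; lra.
rewrite ler_nat -(size_iota lo len); apply: uniq_leq_size.
  by rewrite filter_uniq // iota_uniq.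
move=> x; rewrite mem_filter mem_iota => /andP[hx _].
move: hx; rewrite ler_norml => /andP[h1 h2].
rewrite mem_iota; apply/andP; split.
  by rewrite -ltnS -(ltr_nat R) (le_lt_trans _ (_ : x%:R < x.+1%:R)) ?ltr_nat //; lra.
rewrite -(ltr_nat R) natrD lenE.
have : x%:R <= m - w + 2 * w by lra.
move: lo_gt t_gt; rewrite -(natr1 lo) -(natr1 (Num.truncn (2 * w))); lra.
Qed.

(** Up to a factor of order [1 / sqrt N], full-length excursions that are
    macroscopic at mid-time carry the weight of the bridge: the tilted walk
    survives with positive probability, and its mass sits in a window of width
    [O (sqrt N)] around [N M(1)]. *)
Lemma exc_ge sigma : 0 < sigma -> exists2 c : R, 0 < c &
  forall eps, 0 <= eps -> eps < M sigma 1 -> exists N0, forall N, (N0 <= N)%N ->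
  c / Num.sqrt N%:R * expR (ltilt (sigma / N%:R) (N + N)) <=
  exc (sigma / N%:R) (at_time N (fun x => eps * N%:R < x%:R)) (N + N).
Proof.
move=> s0; have s1 : 0 < 1 + sigma by lra.
(* t is small enough for the mean drift, at least of order
   sigma / (4 (1 + sigma)), to beat the quadratic term t ^ 2 / 2 of the moment;
   2 p is then a lower bound on the survival probability *)
pose t := sigma / (4 * (1 + sigma)).
have t0 : 0 < t by rewrite divr_gt0 // mulr_gt0.
pose p := (1 - expR (- t)) / 4.
have p0 : 0 < p by rewrite divr_gt0 // subr_gt0 expR_lt1 oppr_lt0.
pose sp := Num.sqrt p; have sp0 : 0 < sp by rewrite sqrtr_gt0.
have spV : 0 < sp^-1 by rewrite invr_gt0.
exists (p ^+ 2 / (2 / sp + 2)).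
  by rewrite divr_gt0 ?exprn_gt0 // addr_gt0 // divr_gt0.
move=> eps eps0 epsM.
pose gap := M sigma 1 - eps; have gap0 : 0 < gap by rewrite subr_gt0.
pose q := (2 * sigma + sp^-1 + 1) / gap.
have q0 : 0 < q by rewrite divr_gt0 //; lra.
exists (Num.truncn (q ^+ 2)).+2 => N N0N.
have N1 : (1 < N)%N := leq_trans (isT : (1 < _.+2)%N) N0N.
have NR : 0 < N%:R :> R by rewrite ltr0n ltnW.
pose h := sigma / N%:R; rewrite -/h.
have h0 : 0 < h by rewrite divr_gt0.
have hN : h * N%:R = sigma by rewrite /h divfK // gt_eqF.
pose s := Num.sqrt N%:R : R.
have s_gt0 : 0 < s by rewrite sqrtr_gt0.
have ss : s ^+ 2 = N%:R by rewrite sqr_sqrtr // ltW.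
have s_ge1 : 1 <= s by rewrite -sqrtr1 ler_wsqrtr // ler1n ltnW.
have s_geq : q <= s.
  rewrite -ler_sqr ?nnegrE ?(ltW q0) ?(ltW s_gt0) // ss ltW //.
  by apply: (lt_le_trans (truncnS_gt _)); rewrite ler_nat ltnW.
rewrite exc_square ?(ltnW N1) //.
rewrite mulrC ler_wpM2l ?expR_ge0 //.
set d := step_drift _ _; pose B := N.+2.
have dE i : d i = tanh (h * (N%:R - 2^-1) - h * i%:R) by rewrite /d /step_drift bridge_step.
have d_ge0 i : (i < N)%N -> 0 <= d i.
  move=> iN; have /andP[a0 _] := bridge_step_bound (ltW h0) (le_refl (h * N%:R)) iN.
  by rewrite /d /step_drift tanh_ge0.
have dB := step_drift_bound h (bridge_tilt h (N + N)); rewrite -/d in dB.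
pose m := walk_mean d N.
have m_near : N%:R * M sigma 1 - 2 * sigma <= m.
  have := @tanh_sum_lcosh h sigma (h / 2) (fun i => h * (N%:R - 2^-1) - h * i%:R) N (ltW h0).
  have -> : \sum_(0 <= i < N) tanh (h * (N%:R - 2^-1) - h * i%:R) = m.
    by apply: eq_bigr => i _; rewrite dE.
  have H1 : forall i, (i < N)%N ->
      `|h * (N%:R - 2^-1) - h * i%:R - (sigma - h * i%:R)| <= h / 2.
    move=> i _; rewrite -hN.
    have -> : h * (N%:R - 2^-1) - h * i%:R - (h * N%:R - h * i%:R) = - (h / 2) by field.
    by rewrite normrN ger0_norm // divr_ge0 // ltW.
  move=> /(_ H1); rewrite hN subrr lcosh0 subr0 ler_norml => /andP[H2 _].
  have MN : N%:R * M sigma 1 = lcosh sigma / h.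
    rewrite M_closed // subrr mulr0 lcosh0 subr0 /h.
    by field; rewrite !gt_eqF.
  rewrite MN lerBlDr ler_pdivrMr //.
  have : (2 * sigma) * h >= sigma * (h / 2 + h) by have := mulr_gt0 s0 h0; lra.
  by lra.
have alive : 2 * p <= \sum_(0 <= x < B) walk d N x.
  have kb i : (1 + d i) / 2 * expR (- t) + (1 - d i) / 2 * expR t <=
      expR (- (t * d i) + t ^+ 2 / 2).
    set a := bridge_tilt h (N + N) - h * i.+1%:R.
    have -> : d i = tanh a by [].
    have := cosh_shift a (- t); rewrite sqrrN mulNr => H.
    rewrite -(ler_pM2l (cosh_gt0 a)); apply: le_trans H.
    have -> : cosh a * ((1 + tanh a) / 2 * expR (- t) + (1 - tanh a) / 2 * expR t)
      = (cosh a * (1 + tanh a) * expR (- t) + cosh a * (1 - tanh a) * expR t) / 2 by field.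
    have -> : cosh a * (1 - tanh a) = expR (- a) by rewrite expR_tanh coshN tanhN.
    rewrite -expR_tanh -!expRD /cosh.
    by have -> : - (a - t) = - a + t by ring.
  have k_gt0 i : 0 < (1 + d i) / 2 * expR (- t) + (1 - d i) / 2 * expR t.
    have /andP[b1 b2] := dB i; have e1 := expR_gt0 (- t); have e2 := expR_gt0 t.
    have [z|z] := leP 0 (d i).
      by rewrite ltr_pwDl // ?mulr_gt0 ?mulr_ge0 ?divr_gt0 // ?divr_ge0 ?(ltW e2) //; lra.
    by rewrite ltr_wpDl // ?mulr_gt0 ?mulr_ge0 ?divr_gt0 // ?divr_ge0 ?(ltW e1) //; lra.
  have K1 j : (0 < j <= N)%N ->
      \prod_(1 <= i < j) ((1 + d i) / 2 * expR (- t) + (1 - d i) / 2 * expR t) <= 1.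
    move=> /andP[j0 jN].
    apply: (@le_trans _ _ (\prod_(1 <= i < j)
       expR (- (t * ((h * (N%:R - 2^-1) - h * i%:R) / (1 + sigma))) + t ^+ 2 / 2))).
      rewrite big_nat [X in _ <= X]big_nat; apply: ler_prod => i /andP[i1 ij].
      rewrite ltW ?k_gt0 //=; apply: (le_trans (kb i)).
      rewrite ler_expR lerD2r lerN2 ler_wpM2l ?(ltW t0) // dE.
      have iN : (i < N)%N := leq_trans ij jN.
      have := bridge_step_bound (ltW h0) (le_refl (h * N%:R)) iN.
      rewrite bridge_step hN => /andP[a0 a1].
      apply: le_trans (tanh_ge a0).
      by rewrite ler_wpM2l // lef_pV2 ?posrE //; lra.
    rewrite -expR_sum -[X in _ <= X]expR0 ler_expR.
    have -> : \sum_(1 <= i < j) (- (t * ((h * (N%:R - 2^-1) - h * i%:R) / (1 + sigma)))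
        + t ^+ 2 / 2) = (j%:R - 1) * (t ^+ 2 / 2 - t * h * (N%:R - 2^-1 - j%:R / 2) / (1 + sigma)).
      case: j j0 jN => [//|j] _ _; elim: j => [|j IH]; first by rewrite big_geq //; ring.
      by rewrite big_nat_recr //= IH -!natr1; field; rewrite gt_eqF.
    have jR : 1 <= j%:R :> R by rewrite ler1n.
    have jNR : j%:R <= N%:R :> R by rewrite ler_nat.
    have N2R : 2 <= N%:R :> R by rewrite ler_nat.
    rewrite mulr_ge0_le0 ?subr_ge0 //.
    have tE : t * (4 * (1 + sigma)) = sigma by rewrite /t divfK // mulf_neq0 // gt_eqF.
    have hh : sigma / 4 <= h * (N%:R - 2^-1 - j%:R / 2).
      apply: (@le_trans _ _ (h * (N%:R / 4))); first by rewrite mulrA hN.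
      by rewrite ler_wpM2l ?(ltW h0) //; lra.
    have : t ^+ 2 / 2 <= t * (sigma / 4) / (1 + sigma).
      have -> : t * (sigma / 4) / (1 + sigma) = t ^+ 2.
        by rewrite /t; field; rewrite gt_eqF.
      by have := sqr_ge0 t; lra.
    have : t * (sigma / 4) / (1 + sigma) <= t * h * (N%:R - 2^-1 - j%:R / 2) / (1 + sigma).
      by rewrite -(mulrA t h) ler_wpM2r ?invr_ge0 ?(ltW s1) // ler_wpM2l // ltW.
    by lra.
  have := walk_alive dB (ltnSn N.+1) (ltnW N1) K1 k_gt0.
  apply: le_trans.
  have -> : 2 * p = 1 / 2 * (1 - expR (- t)) by rewrite /p; field.
  rewrite ler_wpM2r // ?subr_ge0 ?expR_le1 ?oppr_le0 ?(ltW t0) //.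
  by have := d_ge0 0%N (ltnW N1); lra.
(* with this window Chebyshev's inequality leaves at most p outside *)
pose w := s / sp.
have w0 : 0 < w by rewrite divr_gt0.
have wE : w ^+ 2 = N%:R / p by rewrite expr_div_n ss sqr_sqrtr // ltW.
have mw : eps * N%:R < m - w.
  have h1 : N%:R * gap >= s * (2 * sigma + sp^-1 + 1).
    have -> : 2 * sigma + sp^-1 + 1 = q * gap by rewrite /q divfK // gt_eqF.
    rewrite mulrA ler_wpM2r ?(ltW gap0) // -ss expr2 ler_wpM2l // ltW //.
  have h2 : s * (2 * sigma + sp^-1 + 1) >= 2 * sigma + w + 1.
    rewrite /w !mulrDr mulr1 -!addrA lerD //; last by rewrite lerD2l.
    by rewrite ler_peMl //; lra.
  have : N%:R * gap = N%:R * M sigma 1 - eps * N%:R by rewrite /gap; ring.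
  by lra.
pose win (x : nat) := `|x%:R - m| <= w.
have outside : \sum_(0 <= x < B | ~~ win x) walk d N x <= p.
  have := walk_second_moment dB (ltnSn N.+1); rewrite -/m -/B => sm.
  have : w ^+ 2 * (\sum_(0 <= x < B | ~~ win x) walk d N x) <= N%:R.
    apply: le_trans sm; rewrite mulr_sumr [X in _ <= X](bigID win) /=.
    apply: ler_wpDl.
      by apply: sumr_ge0 => x _; rewrite mulr_ge0 ?sqr_ge0 ?walk_ge0.
    apply: ler_sum => x; rewrite /win -ltNge => wx; rewrite ler_wpM2r ?walk_ge0 //.
    by rewrite -(real_normK (num_real (x%:R - m))) ler_sqr ?nnegrE ?(ltW w0) // ltW.
  rewrite wE -mulrA ger_pMr // mulrC ler_pdivrMr // mul1r.
  done.
have inside : p <= \sum_(0 <= x < B | win x) walk d N x.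
  by have := alive; rewrite (bigID win) /=; lra.
pose n := \sum_(0 <= x < B | win x) (1 : R).
have nle : n <= 2 * w + 2.
  have -> : n = (count win (iota 0 B))%:R.
    by rewrite /n (eq_bigr (fun _ => 1%N%:R)) // -natr_sum sum1_count /index_iota subn0.
  by apply: count_window; [have := mulr_ge0 eps0 (ltW NR); lra | exact: ltW].
pose K := 2 * w + 2; have K0 : 0 < K by rewrite /K; lra.
(* Cauchy-Schwarz: mass p on at most K sites *)
have cs : p ^+ 2 / K <= \sum_(0 <= x < B | win x) walk d N x ^+ 2.
  apply: (@le_trans _ _ (\sum_(0 <= x < B | win x) (2 * (p / K) * walk d N x - (p / K) ^+ 2))).
    rewrite sumrB -mulr_sumr.
    have -> : \sum_(0 <= x < B | win x) (p / K) ^+ 2 = (p / K) ^+ 2 * n.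
      by rewrite /n mulr_sumr; apply: eq_bigr => x _; rewrite mulr1.
    have h1 := ler_wpM2l (ltW (divr_gt0 p0 K0)) inside.
    have h2 : (p / K) ^+ 2 * n <= (p / K) ^+ 2 * K by rewrite ler_wpM2l ?sqr_ge0.
    have e1 : (p / K) ^+ 2 * K = p ^+ 2 / K by field; rewrite gt_eqF.
    have e2 : p / K * p = p ^+ 2 / K by field; rewrite gt_eqF.
    rewrite e1 in h2; rewrite e2 in h1; lra.
  apply: ler_sum => x _; have := sqr_ge0 (walk d N x - p / K).
  by rewrite sqrrB; lra.
apply: (@le_trans _ _ (p ^+ 2 / K)).
  rewrite -mulrA ler_wpM2l ?sqr_ge0 // -invfM lef_pV2 ?posrE //; last first.
    by rewrite mulr_gt0 // addr_gt0 // mulr_gt0.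
  have e : (2 / sp + 2) * s = 2 * (s / sp) + 2 * s by field; rewrite gt_eqF.
  by rewrite -/s e /K /w; lra.
apply: (le_trans cs); rewrite big_mkcond /=; apply: ler_sum => x _.
case: ifP => [wx|_]; last by rewrite mulr_ge0 ?ler0n ?sqr_ge0.
have -> : eps * N%:R < x%:R; last by rewrite mul1r.
by move: wx; rewrite /win ler_norml => /andP[wx _]; lra.
Qed.

End ExcursionAsymptotics.

(** * The pinned phase *)

Section PinnedBounds.
Variable R : realType.
Implicit Types (h lam rho sigma D : R).

Lemma geometric_le (x : R) n : 0 <= x < 1 -> \sum_(0 <= i < n) x ^+ i <= (1 - x)^-1.
Proof.
move=> /andP[x0 x1]; have y0 : 0 < 1 - x by rewrite subr_gt0.
suff -> : \sum_(0 <= i < n) x ^+ i = (1 - x ^+ n) / (1 - x).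
  by rewrite -[X in _ <= X]mul1r ler_pM2r ?invr_gt0 // lerBlDr lerDl exprn_ge0.
elim: n => [|n IH]; first by rewrite big_geq // subrr mul0r.
by rewrite big_nat_recr //= IH exprS; field; rewrite gt_eqF.
Qed.

Lemma geometric_tail_le (x : R) L m : 0 <= x < 1 -> (m <= L)%N ->
  \sum_(0 <= j < m) x ^+ (L - j.+1) <= x ^+ (L - m) / (1 - x).
Proof.
move=> x01 mL; rewrite big_nat_rev /= add0n.
apply: (@le_trans _ _ (x ^+ (L - m) * \sum_(0 <= j < m) x ^+ j)).
  rewrite mulr_sumr big_nat [X in _ <= X]big_nat; apply: ler_sum => j /andP[_ jm].
  by rewrite -exprD le_eqVlt; apply/orP; left; apply/eqP; congr (_ ^+ _); lia.
rewrite ler_wpM2l ?geometric_le // exprn_ge0 //; by case/andP: x01.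
Qed.

Lemma sum_shift1 (f : nat -> R) B : f B = 0 ->
  \sum_(0 <= x < B) f x.+1 = \sum_(0 <= x < B) f x - f 0%N.
Proof.
move=> fB; have e : \sum_(0 <= x < B.+1) f x = f 0%N + \sum_(0 <= x < B) f x.+1.
  by rewrite big_nat_recl.
by rewrite big_nat_recr //= fB addr0 in e; rewrite e addrC addKr.
Qed.

Lemma exc_anywhere_le1 n : exc 0 anywhere n <= 1 :> R.
Proof.
apply: le_trans (exc_le _ _ _) _; rewrite /ltilt big1 ?expR0 // => i _.
by rewrite mul0r lcosh0.
Qed.

(** The heights of a path that reaches [0] in [j] steps are at most [j]. *)
Lemma hit_field h j x : 0 <= h ->
  hit h anywhere j x <= hit 0 anywhere j x * expR (h * j%:R ^+ 2).
Proof.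
move=> h0; elim: j x => [|j IH] x.
  by rewrite expr0n /= mulr0 expR0 mulr1.
case: x => [|x]; first by rewrite /= mul0r.
have H y : expR (h * y%:R) * (1 * hit h anywhere j y) <=
    expR (0 * y%:R) * (1 * hit 0 anywhere j y) * expR (h * j.+1%:R ^+ 2).
  rewrite !mul1r mul0r expR0 mul1r.
  have [yj|jy] := leqP y j; last by rewrite !hit_far // mulr0 mul0r.
  apply: le_trans (ler_wpM2l (expR_ge0 _) (IH y)) _.
  rewrite mulrCA ler_wpM2l ?hit_ge0 // -expRD ler_expR -mulrDr ler_wpM2l //.
  have : y%:R <= j%:R :> R by rewrite ler_nat.
  have j0 : 0 <= j%:R :> R by [].
  rewrite -natr1; nra.
by rewrite /= -[X in _ <= X]mulrA mulrDl ler_wpM2l ?invr_ge0 // lerD.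
Qed.

Lemma exc_field h n : 0 <= h ->
  exc h anywhere n <= exc 0 anywhere n * expR (h * n%:R ^+ 2).
Proof.
move=> h0; case: n => [|n]; first by rewrite /= mul0r.
rewrite /= !mul1r mul0r expR0 -!mulrA ler_wpM2l ?invr_ge0 // mul1r.
apply: le_trans (ler_wpM2l (expR_ge0 _) (hit_field n 1 h0)) _.
rewrite mulrCA ler_wpM2l ?hit_ge0 // -expRD ler_expR -mulrDr ler_wpM2l //.
have n0 : 0 <= n%:R :> R by [].
by rewrite -natr1; nra.
Qed.

(** Rate at which the killed walk has to be discounted for [rho ^ x] to be
    harmonic. It is the free energy of the pinned walk when
    [rho ^ 2 = 1 / (lam - 1)]. *)
Definition pin_rate rho : R := ln ((rho + rho^-1) / 2).

Lemma expR_pin_rate rho : 0 < rho -> expR (pin_rate rho) = (rho + rho^-1) / 2.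
Proof.
by move=> r0; rewrite lnK // posrE divr_gt0 // addr_gt0 // invr_gt0.
Qed.

Lemma expRN_pin_rate rho : 0 < rho ->
  expR (- pin_rate rho) = 2 * rho / (1 + rho ^+ 2).
Proof.
move=> r0; rewrite expRN expR_pin_rate //.
have : 0 < 1 + rho ^+ 2 by rewrite addr_gt0 // exprn_gt0.
by move=> r1; field; rewrite !gt_eqF // addrC.
Qed.

Lemma pin_rate_gt0 rho : 0 < rho < 1 -> 0 < pin_rate rho.
Proof.
move=> /andP[r0 r1]; rewrite /pin_rate ln_gt0 //.
rewrite ltr_pdivlMr // mul1r.
have e : rho + rho^-1 - 2 = (1 - rho) ^+ 2 / rho by field; rewrite gt_eqF.
by rewrite -subr_gt0 e divr_gt0 // exprn_gt0 // subr_gt0.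
Qed.

(** Optional stopping for the harmonic function [rho ^ x]. *)
Lemma hit_generating rho n x : 0 < rho ->
  \sum_(0 <= j < n) expR (- pin_rate rho) ^+ j * hit 0 anywhere j x <= rho ^+ x.
Proof.
move=> r0; set z := expR _.
have zE : z = 2 * rho / (1 + rho ^+ 2) by exact: expRN_pin_rate.
have r1 : 0 < 1 + rho ^+ 2 by rewrite addr_gt0 // exprn_gt0.
have z0 : 0 < z by exact: expR_gt0.
elim: n x => [|n IH] x; first by rewrite big_geq // exprn_ge0 // ltW.
rewrite big_nat_recl // expr0 mul1r; case: x => [|x].
  by rewrite big1 => [|i _]; rewrite /= ?mulr0 // addr0.
rewrite {1}/hit /delta0 /= add0r.
rewrite (eq_bigr (fun j => z / 2 * (z ^+ j * hit 0 anywhere j x.+2) +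
   z / 2 * (z ^+ j * hit 0 anywhere j x))); last first.
  by move=> j _; rewrite !mul0r expR0 !mul1r exprS; field.
rewrite big_split /= -!mulr_sumr.
have z2 : 0 <= z / 2 by rewrite divr_ge0 // ltW.
apply: le_trans (lerD (ler_wpM2l z2 (IH _)) (ler_wpM2l z2 (IH _))) _.
rewrite -mulrDr zE !exprS le_eqVlt; apply/orP; left; apply/eqP.
by field; rewrite gt_eqF.
Qed.

(** The hypothesis on [lam] says that the renewal measure of the contacts,
    discounted by [pin_rate rho], has mass at most [1]. *)
Lemma exc_generating rho lam n : 0 < rho -> 0 <= lam -> (lam - 1) * rho ^+ 2 <= 1 ->
  lam * (\sum_(0 <= j < n) exc 0 anywhere j.+1 * expR (- pin_rate rho) ^+ j.+1) <= 1.
Proof.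
move=> r0 l0 lr; have r1 : 0 < 1 + rho ^+ 2 by rewrite addr_gt0 // exprn_gt0.
set z := expR _.
have zE : z = 2 * rho / (1 + rho ^+ 2) by exact: expRN_pin_rate.
have z0 : 0 < z by exact: expR_gt0.
rewrite (eq_bigr (fun j => z / 2 * (z ^+ j * hit 0 anywhere j 1))); last first.
  by move=> j _; rewrite /= mul0r expR0 !mul1r exprS; field.
rewrite -mulr_sumr.
have h := @hit_generating rho n 1 r0; rewrite expr1 in h.
have z2 : 0 <= lam * (z / 2) by rewrite mulr_ge0 // divr_ge0 // ltW.
rewrite mulrA; apply: le_trans (ler_wpM2l z2 h) _.
have -> : lam * (z / 2) * rho = lam * rho ^+ 2 / (1 + rho ^+ 2).
  by rewrite zE; field; rewrite gt_eqF.
by rewrite ler_pdivrMr //; lra.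
Qed.

(** Macroscopically an excursion of [n] steps sees the field reduced by the
    factor [n / (2 N)], and [G] is convex with [G 0 = 0]. *)
Lemma ltilt_le_sqr sigma N n : 0 < sigma -> (0 < N)%N -> (n <= 2 * N)%N ->
  ltilt (sigma / N%:R) n <= n%:R ^+ 2 / (2 * N)%:R * G sigma.
Proof.
move=> s0 N0 nN; case: n nN => [|n] nN.
  by rewrite /ltilt big_ord0 expr0n /= !mul0r.
have NR : 0 < N%:R :> R by rewrite ltr0n.
have h0 : 0 <= sigma / N%:R by rewrite divr_ge0 // ltW.
apply: le_trans (ltilt_le_G h0 (ltn0Sn n)) _.
have -> : sigma / N%:R * n.+1%:R / 2 = n.+1%:R / (2 * N)%:R * sigma.
  by rewrite natrM; field; rewrite gt_eqF.
have LR : 0 < (2 * N)%:R :> R by rewrite ltr0n muln_gt0.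
have t01 : 0 <= (n.+1%:R / (2 * N)%:R : R) <= 1.
  by rewrite divr_ge0 //= ler_pdivrMr // mul1r ler_nat.
apply: le_trans (ler_wpM2l (ler0n _ _) (G_scale sigma t01)) _.
by rewrite expr2 !mulrA.
Qed.

(** Upper bound on the pinned partition function, uniform in the system size:
    by the renewal equation the quotient of [Y] by the bound [w] grows at step [i]
    by at most the factor [1 + ep i], where [sum ep i] is bounded. Short
    excursions almost do not feel the field; long ones are penalised unless they
    fill the system. *)
Lemma Y_le sigma lam rho D : 0 < sigma -> 0 < rho < 1 -> 0 <= lam ->
  (lam - 1) * rho ^+ 2 <= 1 -> 0 <= D -> G sigma <= pin_rate rho + D ->
  exists2 C : R, 0 < C & forall N m, (0 < N)%N -> (m <= 2 * N)%N ->
  Y (sigma / N%:R) lam m <=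
    C * expR (m%:R * pin_rate rho + D * m%:R ^+ 2 / (2 * N)%:R).
Proof.
move=> s0 r01 l0 lr D0 GD; have /andP[r0 r1] := r01.
pose F0 := pin_rate rho; have F0gt0 : 0 < F0 by exact: pin_rate_gt0.
(* an excursion of j steps is short when h j <= F0 / 2: then the field costs at
   most exp (F0 j / 2) and leaves a discount x1 ^ (2 j), of which one half pays
   for j ^ 2 (C1 bounds j ^ 2 x1 ^ j) and the other one is summed over j; a long
   excursion of j steps loses c per step that it leaves uncovered *)
pose c := F0 * (F0 / (4 * sigma)).
have c0 : 0 < c by rewrite mulr_gt0 // divr_gt0 // mulr_gt0.
pose x1 := expR (- (F0 / 4)); pose x2 := expR (- c).
have x1b : 0 <= x1 < 1 by rewrite expR_ge0 expR_lt1 oppr_lt0 divr_gt0.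
have x2b : 0 <= x2 < 1 by rewrite expR_ge0 expR_lt1 oppr_lt0.
pose C1 := 32 / F0 ^+ 2.
have C10 : 0 < C1 by rewrite divr_gt0 // exprn_gt0.
pose A1 := lam * C1 / (1 - x1); pose A2 := lam / (1 - x2).
have y1 : 0 < 1 - x1 by rewrite subr_gt0; case/andP: x1b.
have y2 : 0 < 1 - x2 by rewrite subr_gt0; case/andP: x2b.
have A10 : 0 <= A1 := divr_ge0 (mulr_ge0 l0 (ltW C10)) (ltW y1).
have A20 : 0 <= A2 := divr_ge0 l0 (ltW y2).
exists (expR (2 * sigma * A1 + A2 / (1 - x2))); first exact: expR_gt0.
move=> N m N0 mN; pose L := (2 * N)%N.
have NR : 0 < N%:R :> R by rewrite ltr0n.
have LR : 0 < L%:R :> R by rewrite ltr0n muln_gt0.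
have LE : L%:R = 2 * N%:R :> R by rewrite natrM.
pose h := sigma / N%:R; rewrite -/h; have h0 : 0 < h by rewrite divr_gt0.
pose w k : R := expR (k%:R * F0 + D * k%:R ^+ 2 / L%:R).
rewrite -[expR (_ * pin_rate _ + _)]/(w m).
pose ep i : R := A1 * h + A2 * x2 ^+ (L - i).
have ep0 i : 0 <= ep i.
  by rewrite addr_ge0 // mulr_ge0 ?(ltW h0) ?exprn_ge0 //; case/andP: x2b.
have term j k : (0 < j <= k)%N -> (k <= L)%N ->
   lam * exc h anywhere j * w (k - j)%N <=
   w k * (lam * (exc 0 anywhere j * expR (- F0) ^+ j) + lam * h * C1 * x1 ^+ j +
          lam * x2 ^+ (L - j)).
  move=> /andP[j0 jk] kL.
  have jR : 0 < j%:R :> R by rewrite ltr0n.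
  have jkR : j%:R <= k%:R :> R by rewrite ler_nat.
  have kLR : k%:R <= L%:R :> R by rewrite ler_nat.
  have x1j : 0 <= x1 ^+ j by rewrite exprn_ge0 //; case/andP: x1b.
  have x2j : 0 <= x2 ^+ (L - j) by rewrite exprn_ge0 //; case/andP: x2b.
  have wE : w (k - j)%N = w k * expR (- (j%:R * F0) - D * (2 * k%:R * j%:R - j%:R ^+ 2) / L%:R).
    rewrite /w -expRD natrB //; congr expR; field; by rewrite gt_eqF.
  rewrite wE mulrCA ler_wpM2l ?expR_ge0 //.
  have -> : lam * (exc 0 anywhere j * expR (- F0) ^+ j) + lam * h * C1 * x1 ^+ j +
    lam * x2 ^+ (L - j) = lam * (exc 0 anywhere j * expR (- F0) ^+ j +
      h * (C1 * x1 ^+ j) + x2 ^+ (L - j)) by ring.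
  rewrite -(mulrA lam) ler_wpM2l //.
  have kj0 : 0 <= D * (2 * k%:R * j%:R - j%:R ^+ 2) / L%:R.
    rewrite !mulr_ge0 ?invr_ge0 ?(ltW LR) //.
    have -> : 2 * k%:R * j%:R - j%:R ^+ 2 = j%:R * (2 * k%:R - j%:R) :> R by ring.
    by rewrite mulr_ge0 ?(ltW jR) //; lra.
  have [short|long] := leP (h * j%:R) (F0 / 2).
    apply: (@le_trans _ _ (exc 0 anywhere j * expR (- F0) ^+ j + h * (C1 * x1 ^+ j))); last first.
      by rewrite lerDl.
    apply: (@le_trans _ _ (exc h anywhere j * expR (- F0) ^+ j)).
      rewrite ler_wpM2l ?exc_ge0 // -expRM_natl ler_expR; lra.
    have e1 := exc_field j (ltW h0).
    set y := h * j%:R ^+ 2 in e1.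
    have y0 : 0 <= y by rewrite mulr_ge0 ?(ltW h0) ?sqr_ge0.
    have ey : expR y <= 1 + y * expR y.
      have := ler_wpM2r (expR_ge0 y) (expR_ge1Dx (- y)).
      by rewrite -expRD addNr expR0 mulrDl mul1r mulNr; lra.
    have z0 : 0 <= expR (- F0) ^+ j by rewrite exprn_ge0 ?expR_ge0.
    apply: le_trans (ler_wpM2r z0 e1) _.
    apply: le_trans (ler_wpM2r z0 (ler_wpM2l (exc_ge0 _ _ _) ey)) _.
    rewrite mulrDr mulr1 mulrDl lerD2l.
    apply: (@le_trans _ _ (1 * (y * expR y) * expR (- F0) ^+ j)).
      rewrite ler_wpM2r // ler_wpM2r ?exc_anywhere_le1 // mulr_ge0 ?expR_ge0 //.
    have -> : 1 * (y * expR y) * expR (- F0) ^+ j =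
       h * (j%:R ^+ 2 * (expR y * expR (- F0) ^+ j)) by rewrite {1}/y; ring.
    rewrite ler_wpM2l ?(ltW h0) // -expRM_natl -expRD.
    have yF : y <= F0 / 2 * j%:R.
      by rewrite /y expr2 mulrA ler_wpM2r ?(ltW jR).
    apply: (@le_trans _ _ (j%:R ^+ 2 * (x1 ^+ j * x1 ^+ j))).
      rewrite ler_wpM2l ?sqr_ge0 // -exprD /x1 -expRM_natl ler_expR natrD; lra.
    rewrite mulrA ler_wpM2r //.
    have q0 : 0 <= j%:R * (F0 / 4) by rewrite mulr_ge0 ?(ltW jR) ?divr_ge0 ?(ltW F0gt0).
    have := expR_ge1Dxn 1 q0; rewrite (_ : 2`!%:R = 2) // => hq.
    have : (j%:R * (F0 / 4)) ^+ 2 / 2 * x1 ^+ j <= 1.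
      have -> : x1 ^+ j = (expR (j%:R * (F0 / 4)))^-1.
        by rewrite -expRN -mulrN expRM_natl.
      by rewrite ler_pdivrMr ?expR_gt0 // mul1r; lra.
    rewrite /C1 ler_pdivlMr ?exprn_gt0 // exprMn.
    have -> : (F0 / 4) ^+ 2 = F0 ^+ 2 / 16 by field.
    lra.
  apply: (@le_trans _ _ (x2 ^+ (L - j))); last first.
    rewrite lerDr; apply: (addr_ge0 (mulr_ge0 (exc_ge0 _ _ _) (exprn_ge0 _ (expR_ge0 _)))).
    exact: (mulr_ge0 (ltW h0) (mulr_ge0 (ltW C10) x1j)).
  have jL : (j <= L)%N by exact: leq_trans kL.
  have jLR : j%:R <= L%:R :> R by rewrite ler_nat.
  apply: le_trans (ler_wpM2r (expR_ge0 _) (exc_le _ _ _)) _.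
  rewrite -expRD -expRM_natl ler_expR natrB //.
  have g1 := ltilt_le_sqr s0 N0 jL; rewrite -/h -/L in g1.
  have u0 : 0 <= j%:R ^+ 2 / L%:R :> R by rewrite divr_ge0 ?sqr_ge0 // ltW.
  have g2 := ler_wpM2l u0 GD; rewrite -/F0 in g2.
  have g3 : D * (j%:R ^+ 2 / L%:R) <= D * (2 * k%:R * j%:R - j%:R ^+ 2) / L%:R.
    rewrite -mulrA ler_wpM2l // ler_wpM2r ?invr_ge0 ?(ltW LR) //.
    by have := ler_wpM2r (ltW jR) jkR; lra.
  have g4 : (L%:R - j%:R) * c <= F0 * (j%:R - j%:R ^+ 2 / L%:R).
    have -> : j%:R - j%:R ^+ 2 / L%:R = (L%:R - j%:R) * (j%:R / L%:R) :> R.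
      by field; rewrite gt_eqF.
    rewrite [X in _ <= X]mulrCA ler_wpM2l ?subr_ge0 // /c ler_wpM2l ?(ltW F0gt0) //.
    rewrite ler_pdivlMr // LE.
    have -> : F0 / (4 * sigma) * (2 * N%:R) = F0 / 2 / h.
      by rewrite /h; field; rewrite !gt_eqF.
    by rewrite ler_pdivrMr // [X in _ <= X]mulrC ltW.
  lra.
have sums k : (0 < k <= L)%N ->
    \sum_(0 <= j < k) (lam * exc h anywhere j.+1 * w (k - j.+1)%N) <= w k * (1 + ep k).
  move=> /andP[k0 kL].
  apply: (@le_trans _ _ (\sum_(0 <= j < k) (w k * (lam * (exc 0 anywhere j.+1 * expR (- F0) ^+ j.+1) +
     lam * h * C1 * x1 ^+ j.+1 + lam * x2 ^+ (L - j.+1))))).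
    rewrite big_nat [X in _ <= X]big_nat; apply: ler_sum => j /andP[_ jk].
    by apply: term => //; rewrite jk.
  rewrite -mulr_sumr ler_wpM2l ?expR_ge0 // !big_split /= -!mulr_sumr -addrA.
  rewrite lerD ?exc_generating // lerD //.
    have -> : A1 * h = lam * h * C1 * (1 - x1)^-1 by rewrite /A1; ring.
    rewrite ler_wpM2l ?(mulr_ge0 (mulr_ge0 l0 (ltW h0)) (ltW C10)) //.
    apply: le_trans (geometric_le k x1b).
    rewrite big_nat [X in _ <= X]big_nat; apply: ler_sum => j _.
    have /andP[p0 p1] := x1b.
    by rewrite exprS ler_piMl ?exprn_ge0 // ltW.
  rewrite /A2 -mulrA ler_wpM2l // [X in _ <= X]mulrC.
  exact: geometric_tail_le.
have main k : (k <= L)%N -> Y h lam k <= w k * expR (\sum_(1 <= i < k.+1) ep i).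
  elim/ltn_ind: k => -[|k] IH kL.
    by rewrite Y0 big_geq // expR0 mulr1 /w mul0r add0r expr0n /= mulr0 mul0r expR0.
  rewrite Y_renewal; pose E := expR (\sum_(1 <= i < k.+1) ep i).
  apply: (@le_trans _ _ (\sum_(0 <= j < k.+1) (lam * exc h anywhere j.+1 * w (k.+1 - j.+1)%N) * E)).
    rewrite big_mkord mulr_sumr; apply: ler_sum => j _; rewrite subSS mulrA -[X in _ <= X]mulrA.
    rewrite ler_wpM2l ?(mulr_ge0 l0 (exc_ge0 _ _ _)) //.
    have kj : (k - j < k.+1)%N by rewrite ltnS leq_subr.
    apply: le_trans (IH _ kj (leq_trans (ltnW kj) kL)) _.
    rewrite ler_wpM2l ?expR_ge0 // ler_expR.
    rewrite [X in _ <= X](@big_cat_nat _ _ _ (k - j).+1) //=.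
      by rewrite lerDl sumr_ge0.
  rewrite -mulr_suml.
  apply: le_trans (ler_wpM2r (expR_ge0 _) (sums k.+1 kL)) _.
  have -> : \sum_(1 <= i < k.+2) ep i = \sum_(1 <= i < k.+1) ep i + ep k.+1.
    by rewrite big_nat_recr.
  rewrite expRD -/E -(mulrA (w _)) ler_wpM2l ?expR_ge0 // mulrC ler_wpM2l ?expR_ge0 //.
  exact: expR_ge1Dx.
apply: le_trans (main m mN) _; rewrite mulrC ler_wpM2r ?expR_ge0 // ler_expR.
rewrite /ep big_split /= sumr_const_nat subSS subn0 -mulr_sumr; apply: lerD.
  rewrite -[_ *+ m]mulr_natr.
  have -> : 2 * sigma * A1 = A1 * h * L%:R by rewrite LE /h; field; rewrite gt_eqF.
  by rewrite ler_wpM2l ?(mulr_ge0 A10 (ltW h0)) // ler_nat.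
rewrite ler_wpM2l //; have /andP[p0 p1] := x2b.
rewrite big_add1 /=; apply: le_trans (geometric_tail_le x2b mN) _.
rewrite ler_piMl ?invr_ge0 ?subr_ge0 ?(ltW p1) // exprn_ile1 // ltW //.
Qed.

Lemma Yfrom_odd h lam n x : odd (n + x) -> Yfrom h lam n x = 0.
Proof.
elim: n x => [|n IH] [|x] //= nx; rewrite YfromS.
  by rewrite IH ?mulr0 ?addr0 //; move: nx; rewrite addn0 addn1.
by rewrite !IH ?mulr0 ?addr0 //; move: nx; rewrite !addnS /= ?negbK.
Qed.

Lemma Yfrom_far h lam n x : (n < x)%N -> Yfrom h lam n x = 0.
Proof. exact: psum_far. Qed.

Lemma Yfrom_ge0 h lam n x : 0 <= lam -> 0 <= Yfrom h lam n x.
Proof.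
move=> l0; have s0 y : 0 <= site h lam y.
  by rewrite /site !mulr_ge0 ?invr_ge0 ?expR_ge0 //; case: eqP.
elim: n x => [|n IH] x; first by rewrite /Yfrom /= /delta0 ler0n.
by rewrite YfromS; case: x => [|x]; rewrite ?addr0 ?addr_ge0 // mulr_ge0.
Qed.

Lemma Y_ge0 h lam n : 0 <= lam -> 0 <= Y h lam n.
Proof. exact: Yfrom_ge0. Qed.

(** Positive recurrence of the pinned walk: the invariant measure gives a
    conserved sum over the starting points, and the weight of returning decays
    geometrically with the height of the starting point, so the wall contributes
    a positive fraction of the sum. *)
Lemma Y_ge lam rho : 0 < rho < 1 -> (lam - 1) * rho ^+ 2 = 1 ->
  exists2 c0 : R, 0 < c0 & forall n, c0 * expR ((2 * n)%:R * pin_rate rho) <= Y 0 lam (2 * n).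
Proof.
move=> r01 lr; have /andP[r0 r1] := r01.
pose r2 := 1 + rho ^+ 2; have r2p : 0 < r2 by rewrite addr_gt0 // exprn_gt0.
have r1p : 0 < 1 - rho ^+ 2 by rewrite subr_gt0 exprn_ilt1 // ltW.
have lE : lam * rho ^+ 2 = r2 by rewrite /r2; lra.
have l0 : 0 < lam by rewrite -(pmulr_lgt0 _ (exprn_gt0 2 r0)) lE.
pose z := expR (- pin_rate rho); have z0 : 0 < z by exact: expR_gt0.
have zE : z = 2 * rho / r2 by exact: expRN_pin_rate.
pose a n x := z ^+ n * (if x == 0%N then lam else 1) * Yfrom 0 lam n x.
have a0 n : a n.+1 0%N = lam * (z / 2) * a n 1%N.
  by rewrite /a YfromS addr0 /site /= mul0r expR0 exprS; field.
have aS n x : a n.+1 x.+1 = z / 2 * (a n x.+2 + a n x).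
  by rewrite /a YfromS /site /= !mul0r expR0 exprS; case: x => [|x] /=; field.
have age0 n x : 0 <= a n x.
  rewrite /a !mulr_ge0 ?exprn_ge0 ?(ltW z0) ?Yfrom_ge0 ?(ltW l0) //.
  by case: eqP => _; rewrite ?(ltW l0).
have zz : 0 <= z / 2 by rewrite divr_ge0 // ltW.
have mono n x : a n x.+2 <= rho ^+ 2 * a n x.
  elim: n x => [|n IH] x.
    rewrite {1}/a Yfrom_far // mulr0; exact: mulr_ge0 (sqr_ge0 _) (age0 _ _).
  rewrite aS; case: x => [|x].
    have -> : rho ^+ 2 * a n.+1 0%N = z / 2 * (r2 * a n 1%N) by rewrite a0 -lE; ring.
    rewrite ler_wpM2l //.
    by rewrite /r2; have := IH 1%N; lra.
  rewrite aS mulrCA ler_wpM2l // mulrDr lerD //.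
have dec n k : a n (2 * k)%N <= rho ^+ (2 * k) * a n 0%N.
  elim: k => [|k IH]; first by rewrite muln0 mul1r.
  have -> : (2 * k.+1 = (2 * k).+2)%N by lia.
  apply: le_trans (mono _ _) _.
  have -> : rho ^+ (2 * k).+2 = rho ^+ 2 * rho ^+ (2 * k) by rewrite -exprD add2n.
  by rewrite -mulrA ler_wpM2l ?sqr_ge0.
(* with the contact factor in a, p is the invariant measure of the pinned walk *)
pose p x : R := if x is y.+1 then rho ^+ x else z / 2 * rho.
have cons n B : (n.+2 < B)%N -> \sum_(0 <= x < B) p x * a n x = p 0%N * lam.
  elim: n B => [|n IH] B nB.
    case: B nB => [//|B] _; rewrite big_nat_recl // big1 => [|x _].
      by rewrite addr0 /a /Yfrom /= /delta0 /= mulr1 mul1r.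
    by rewrite /a Yfrom_far // !mulr0.
  rewrite -(IH B (ltnW nB)).
  have afar m x : (m < x)%N -> a m x = 0 by move=> mx; rewrite /a Yfrom_far ?mulr0.
  case: B nB => [//|B] nB.
  have nB1 : (n.+1 < B)%N := ltnW nB.
  pose T := \sum_(0 <= x < B) rho ^+ x * a n x.
  have Tshift : \sum_(0 <= x < B) rho ^+ x.+1 * a n x.+1 = T - a n 0%N.
    have z1 : rho ^+ B * a n B = 0 by rewrite afar ?mulr0 //; exact: ltnW nB1.
    by have /= -> := @sum_shift1 (fun x => rho ^+ x * a n x) B z1; rewrite mul1r.
  have T1 : \sum_(0 <= x < B) rho ^+ x.+1 * a n x = rho * T.
    by rewrite /T mulr_sumr; apply: eq_bigr => x _; rewrite exprS mulrA.
  have T2 : \sum_(0 <= x < B) rho ^+ x.+1 * a n x.+2 = rho^-1 * (T - a n 0%N - rho * a n 1%N).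
    have -> : T - a n 0%N - rho * a n 1%N = \sum_(0 <= x < B) rho ^+ x.+2 * a n x.+2.
      rewrite -Tshift.
      have z1 : rho ^+ B.+1 * a n B.+1 = 0 by rewrite afar ?mulr0 //; exact: ltnW (ltnW nB1).
      by have /= -> := @sum_shift1 (fun x => rho ^+ x.+1 * a n x.+1) B z1; rewrite expr1.
    rewrite mulr_sumr; apply: eq_bigr => x _.
    by rewrite !exprS; field; rewrite gt_eqF.
  rewrite big_nat_recl // a0 (eq_bigr (fun x => z / 2 * (rho ^+ x.+1 * a n x.+2) +
    z / 2 * (rho ^+ x.+1 * a n x))); last by move=> x _; rewrite aS /p; ring.
  rewrite big_split /= -!mulr_sumr T1 T2 [RHS]big_nat_recl //.
  rewrite (_ : \sum_(0 <= x < B) p x.+1 * a n x.+1 = T - a n 0%N) //.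
  have e1 : lam * (z / 2) * rho = 1.
    apply: (mulIf (lt0r_neq0 r2p)); rewrite zE -[in RHS]lE.
    by field; rewrite gt_eqF.
  have e2 : z / 2 * (rho + rho^-1) = 1.
    by rewrite zE /r2; field; rewrite !gt_eqF.
  have e3 : p 0%N = 1 - z / 2 * rho^-1 by rewrite -[X in _ = X - _]e2 /p /=; ring.
  have e4 : p 0%N * (lam * (z / 2)) = z / 2 
    by rewrite /p /= -[RHS]mul1r -[X in _ = X * _]e1; ring.
  have -> : p 0%N * (lam * (z / 2) * a n 1%N) = z / 2 * a n 1%N by rewrite mulrA e4.
  rewrite e3.
  have -> : z / 2 * a n 1%N + (z / 2 * (rho^-1 * (T - a n 0%N - rho * a n 1%N)) +
     z / 2 * (rho * T)) = z / 2 * (rho + rho^-1) * T - z / 2 * rho^-1 * a n 0%N.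
    by field; rewrite gt_eqF.
  by rewrite e2; ring.
pose c1 := p 0%N + (1 - rho ^+ 2)^-1.
have p00 : 0 < p 0%N by rewrite mulr_gt0 // divr_gt0.
have c1p : 0 < c1 by rewrite addr_gt0 // invr_gt0.
have bound n : p 0%N * lam <= a (2 * n)%N 0%N * c1.
  have := cons (2 * n)%N (2 * n).+3 (ltnSn _) => <-.
  rewrite big_nat_recl // /c1 mulrDr [_ * p _]mulrC lerD2l.
  apply: (@le_trans _ _ (a (2 * n)%N 0%N * \sum_(0 <= x < (2 * n).+2) (rho ^+ 2) ^+ x)); last first.
    by rewrite ler_wpM2l // geometric_le // sqr_ge0 /= -subr_gt0.
  rewrite mulr_sumr; apply: ler_sum => x _ /=.
  have [ox|ex] := boolP (odd x.+1).
    have -> : a (2 * n)%N x.+1 = 0 by rewrite /a Yfrom_odd ?mulr0 // oddD oddM ox.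
    by rewrite mulr0; exact: mulr_ge0 (age0 _ _) (exprn_ge0 _ (sqr_ge0 _)).
  have xE : x.+1 = (2 * (x.+1)./2)%N by rewrite mul2n -[LHS]odd_double_half (negbTE ex).
  apply: (@le_trans _ _ (rho ^+ x.+1 * (rho ^+ x.+1 * a (2 * n)%N 0%N))).
    by rewrite ler_wpM2l ?exprn_ge0 ?(ltW r0) // {1 2}xE dec.
  rewrite mulrA mulrC ler_wpM2l // -exprD -exprM.
  by rewrite ler_wiXn2l ?(ltW r0) ?(ltW r1) // mul2n -addnn; apply: leq_add.
exists (p 0%N / c1); first by rewrite divr_gt0.
move=> n; rewrite -mulrAC ler_pdivrMr //.
have := bound n; rewrite /a /= -[Yfrom _ _ _ 0%N]/(Y 0 lam (2 * n)).
rewrite /z -expRM_natl => h.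
have {}h : p 0%N <= expR ((2 * n)%:R * - pin_rate rho) * Y 0 lam (2 * n) * c1.
  by rewrite -(ler_pM2r l0); apply: le_trans h _; rewrite le_eqVlt; apply/orP; left; apply/eqP; ring.
have := ler_wpM2r (expR_ge0 ((2 * n)%:R * pin_rate rho)) h.
move=> /le_trans; apply; rewrite mulrN expRN le_eqVlt; apply/orP; left; apply/eqP.
by field; rewrite gt_eqF // expR_gt0.
Qed.

End PinnedBounds.

(** * Geometry of paths *)

Section Paths.
Variable R : realType.
Variable N : nat.
Implicit Types (xi : zpath N) (s e t u : nat).

Definition hgt xi t : nat := xi (inord t).

Lemma hgtE xi (x : 'I_(2 * N).+1) : xi x = hgt xi x :> nat.
Proof. by rewrite /hgt inord_val. Qed.

Lemma hgt0 xi : xi \in Omega N -> hgt xi 0 = 0%N.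
Proof.
rewrite inE => /and3P[/eqP e _ _]; rewrite /hgt.
have -> : inord 0 = ord0 :> 'I_(2 * N).+1 by apply/val_inj; rewrite /= inordK.
by [].
Qed.

Lemma hgt_end xi : xi \in Omega N -> hgt xi (2 * N) = 0%N.
Proof.
rewrite inE => /and3P[_ /eqP e _]; rewrite /hgt.
have -> : inord (2 * N) = ord_max :> 'I_(2 * N).+1 by apply/val_inj; rewrite /= inordK.
by [].
Qed.

Lemma hgt_step xi t : xi \in Omega N -> (t < 2 * N)%N ->
  hgt xi t.+1 = (hgt xi t).+1 \/ hgt xi t = (hgt xi t.+1).+1.
Proof.
rewrite inE => /and3P[_ _ /forallP H] tN.
have := H (Ordinal tN); rewrite !hgtE /= /bump /= add1n; lia.
Qed.

Lemma hgt_dist xi s d : xi \in Omega N -> (s + d <= 2 * N)%N ->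
  (hgt xi (s + d) <= hgt xi s + d)%N /\ (hgt xi s <= hgt xi (s + d) + d)%N.
Proof.
move=> xiO; elim: d => [|d IH] sd; first by rewrite !addn0.
rewrite addnS in sd *.
have := hgt_step xiO sd; have := IH (ltnW sd); lia.
Qed.

Lemma excbP xi s e b : (0 < N)%N -> xi \in Omega N -> (s < e <= 2 * N)%N -> hgt xi s = 0%N ->
  (forall u, (s < u <= e)%N -> ((hgt xi u == 0%N) == (u == e)) && b (e - u)%N (hgt xi u)) ->
  excb s e b xi.
Proof.
move=> N0 xiO se hs H; apply/forallP => i; rewrite /in_exc hgtE /= /bump /= add1n.
apply/andP; split; first by apply/implyP => /eqP ->; rewrite hs.
by apply/implyP => /H.
Qed.

Lemma excb_hgt xi s e b u : excb s e b xi -> (s < u <= e)%N -> (e <= 2 * N)%N ->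
  ((hgt xi u == 0%N) = (u == e)) /\ b (e - u)%N (hgt xi u).
Proof.
move=> /forallP H /andP[su ue] eN.
have uN : (u.-1 < 2 * N)%N by lia.
have uE : u.-1.+1 = u by lia.
have := H (Ordinal uN); rewrite /in_exc hgtE /= /bump /= add1n uE => /andP[_].
by rewrite su ue /= => /andP[/eqP -> ->].
Qed.

(** From the last zero before [t] to the first zero from [t] on. *)
Lemma exc_around xi t : xi \in Omega N -> (0 < t <= 2 * N)%N ->
  exists s e, [/\ (s < t)%N, (t <= e <= 2 * N)%N, hgt xi s = 0%N &
    forall u, (s < u <= e)%N -> (hgt xi u == 0%N) = (u == e)].
Proof.
move=> xiO /andP[t0 tN].
pose P u := (u < t)%N && (hgt xi u == 0%N).
have exP : exists u, P u by exists 0%N; rewrite /P t0 hgt0.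
have ubP u : P u -> (u <= t)%N by move=> /andP[/ltnW].
pose Q u := [&& (t <= u)%N, (u <= 2 * N)%N & hgt xi u == 0%N].
have exQ : exists u, Q u by exists (2 * N)%N; rewrite /Q tN leqnn hgt_end.
case: (ex_maxnP exP ubP) => s /andP[st /eqP hs] smax.
case: (ex_minnP exQ) => e /and3P[te eN /eqP he] emin.
exists s, e; split => //; first by rewrite te.
move=> u /andP[su ue]; apply/idP/idP => [hu|/eqP ->]; last by rewrite he.
have [ut|tu] := ltnP u t.
  by have := smax u; rewrite /P ut hu => /(_ isT); lia.
have := emin u; rewrite /Q tu hu (leq_trans ue eN) => /(_ isT); lia.
Qed.

Lemma height_hgt xi : exists2 t, (t <= 2 * N)%N & height xi = hgt xi t.
Proof.
have c : (0 < #|'I_(2 * N).+1|)%N by rewrite card_ord.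
rewrite /height; have [x ->] := @bigop.eq_bigmax _ (fun x => xi x : nat) c.
by exists x; rewrite ?hgtE // -ltnS.
Qed.

Lemma hgt_le_height xi t : (hgt xi t <= height xi)%N.
Proof. by rewrite /height /hgt (leq_bigmax (inord t)). Qed.

(** A path needs at least as many steps as its height to leave the wall. *)
Lemma exc_of_height xi (k : R) : xi \in Omega N -> 0 <= k -> k < (height xi)%:R ->
  exists s e, [/\ (s < e <= 2 * N)%N, k < (e - s)%:R, hgt xi s = 0%N &
    forall u, (s < u <= e)%N -> (hgt xi u == 0%N) = (u == e)].
Proof.
move=> xiO k0; have [t tN ->] := height_hgt xi => kt.
have ht : (0 < hgt xi t)%N by rewrite -(ltr_nat R) (le_lt_trans k0).
have t0 : (0 < t)%N by case: t ht {kt tN} => //; rewrite hgt0.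
have t0N : (0 < t <= 2 * N)%N by rewrite t0.
have [s [e [st /andP[te eN] hs H]]] := exc_around xiO t0N.
have [] := @hgt_dist xi s (t - s) xiO; first by lia.
have -> : (s + (t - s) = t)%N by lia.
rewrite hs => h1 _.
exists s, e; split => //; first by rewrite (leq_trans st te) eN.
apply: lt_le_trans kt _; rewrite ler_nat; lia.
Qed.

Lemma lcosh_lipschitz (a b : R) : `|lcosh a - lcosh b| <= `|a - b|.
Proof.
wlog ab : a b / b <= a.
  move=> H; have [/H//|/ltW/H] := leP b a.
  by rewrite distrC [X in _ <= X]distrC.
have d0 : 0 <= a - b by rewrite subr_ge0.
rewrite (ger0_norm d0) ler_norml.
have h1 := lcosh_tangent a b; have h2 := lcosh_tangent b a.
have t1 := ler_wpM2r d0 (ltW (tanh_lt1 a)); have t2 := ler_wpM2r d0 (ltW (tanh_gtN1 b)).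
by apply/andP; split; lra.
Qed.

Lemma M_lipschitz (sigma u v : R) : 0 < sigma -> 0 <= u -> 0 <= v ->
  `|M sigma u - M sigma v| <= `|u - v|.
Proof.
move=> s0 u0 v0; rewrite !M_closed //.
have -> : (lcosh sigma - lcosh (sigma * (1 - u))) / sigma -
  (lcosh sigma - lcosh (sigma * (1 - v))) / sigma =
  (lcosh (sigma * (1 - v)) - lcosh (sigma * (1 - u))) / sigma by field; rewrite gt_eqF.
rewrite normrM (@gtr0_norm _ sigma^-1) ?invr_gt0 // ler_pdivrMr //.
apply: le_trans (lcosh_lipschitz _ _) _.
have -> : sigma * (1 - v) - sigma * (1 - u) = (u - v) * sigma by ring.
by rewrite normrM (gtr0_norm s0).
Qed.

Lemma M0 (sigma : R) : 0 < sigma -> M sigma 0 = 0.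
Proof. by move=> s0; rewrite M_closed // subr0 mulr1 subrr mul0r. Qed.

Lemma M2 (sigma : R) : 0 < sigma -> M sigma 2 = 0.
Proof.
move=> s0; rewrite M_closed //; have -> : sigma * (1 - 2) = - sigma by ring.
by rewrite lcoshN subrr mul0r.
Qed.

Definition profile (sigma : R) t : R := N%:R * M sigma (t%:R / N%:R).

Lemma profile_le (sigma : R) t : 0 < sigma -> (0 < N)%N -> `|profile sigma t| <= t%:R.
Proof.
move=> s0 N0; have NR : 0 < N%:R :> R by rewrite ltr0n.
rewrite /profile normrM (gtr0_norm NR).
have tN : 0 <= t%:R / N%:R :> R by rewrite divr_ge0.
have := M_lipschitz s0 tN (lexx 0); rewrite M0 // !subr0 (ger0_norm tN).
by move=> /(ler_wpM2l (ltW NR)); rewrite mulrCA divff ?mulr1 // gt_eqF.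
Qed.

Lemma profile_le_end (sigma : R) t : 0 < sigma -> (0 < N)%N -> (t <= 2 * N)%N ->
  `|profile sigma t| <= (2 * N - t)%:R.
Proof.
move=> s0 N0 tN; have NR : 0 < N%:R :> R by rewrite ltr0n.
rewrite /profile normrM (gtr0_norm NR).
have t0 : 0 <= t%:R / N%:R :> R by rewrite divr_ge0.
have := M_lipschitz s0 t0 (ler0n _ 2); rewrite M2 // subr0.
move=> /(ler_wpM2l (ltW NR)) /le_trans; apply.
have -> : t%:R / N%:R - 2 = - ((2 * N - t)%:R / N%:R) :> R.
  by rewrite natrB // natrM; field; rewrite gt_eqF.
by rewrite normrN ger0_norm ?divr_ge0 // mulrCA divff ?mulr1 // gt_eqF.
Qed.

(** Rounding the macroscopic time to the lattice moves the height by at most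
    one unit. *)
Lemma deviation_hgt (sigma eps : R) xi : 0 < sigma -> (0 < N)%N -> 0 < eps ->
  eps < deviation sigma xi ->
  exists2 t, (t <= 2 * N)%N & eps * N%:R - 1 < `|(hgt xi t)%:R - profile sigma t|.
Proof.
move=> s0 N0 eps0 dev; have NR : 0 < N%:R :> R by rewrite ltr0n.
apply: contrapT => noex.
have H t : (t <= 2 * N)%N -> `|(hgt xi t)%:R - profile sigma t| <= eps * N%:R - 1.
  by move=> tN; rewrite leNgt; apply/negP => lt; apply: noex; exists t.
suff : deviation sigma xi <= eps by rewrite leNgt dev.
apply: sup_le_ub.
  exists (`|rescaled xi 0 - M sigma 0|) => /=; exists 0 => //.
  by rewrite /= in_itv /= lexx ler0n.
move=> _ [u /= + <-]; rewrite in_itv /= => /andP[u0 u2].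
pose t := `|Num.ceil (u * N%:R)|%N.
have uN0 : 0 <= u * N%:R by rewrite mulr_ge0 // ltW.
have cE : (t%:Z)%:~R = (Num.ceil (u * N%:R))%:~R :> R.
  by rewrite /t gez0_abs // ceil_ge0 (lt_le_trans _ uN0) // ltrN10.
have t_ge : u * N%:R <= t%:R.
  by have := ceil_ge (u * N%:R); rewrite -cE.
have t_lt : t%:R < u * N%:R + 1.
  have := ceilB1_lt (u * N%:R); rewrite intrD -cE -[_%:~R]/(t%:R) => h.
  by rewrite -ltrBlDr.
have tN : (t <= 2 * N)%N.
  rewrite -ltnS -(ltr_nat R) (lt_le_trans t_lt) // -natr1 lerD2r natrM.
  by rewrite ler_wpM2r // ltW.
have := H t tN; rewrite /rescaled -/t -/(hgt xi t) => Ht.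
have tN0 : 0 <= t%:R / N%:R :> R by rewrite divr_ge0.
have Mlip := M_lipschitz s0 u0 tN0.
have tu : `|u - t%:R / N%:R| <= N%:R^-1.
  rewrite distrC ger0_norm ?subr_ge0 ?ler_pdivlMr //.
  by rewrite lerBlDr ler_pdivrMr // mulrDl mulVf ?gt_eqF //; lra.
have -> : (hgt xi t)%:R / N%:R - M sigma u =
   ((hgt xi t)%:R - profile sigma t) / N%:R - (M sigma u - M sigma (t%:R / N%:R)).
  by rewrite /profile; field; rewrite gt_eqF.
apply: le_trans (ler_normB _ _) _.
rewrite normrM (@gtr0_norm _ N%:R^-1) ?invr_gt0 //.
have h1 : `|(hgt xi t)%:R - profile sigma t| / N%:R <= eps - N%:R^-1.
  by rewrite ler_pdivrMr // mulrBl mulVf ?gt_eqF.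
have := le_trans Mlip tu; lra.
Qed.

(** The step drifts of the bridge and the slopes of the profile at the same time
    are values of [tanh] at points that differ by [h] times the number of steps
    that the excursion leaves uncovered, up to constants. *)
Lemma drift_profile (sigma : R) s e t : 0 < sigma -> (0 < N)%N ->
  (s < t <= e)%N -> (e <= 2 * N)%N ->
  `|drift (sigma / N%:R) (e - s) (e - t) - profile sigma t| <=
    (4 * sigma + 1) * (2 * N - (e - s))%:R + 4 * sigma.
Proof.
move=> s0 N0 /andP[st te] eN; have NR : 0 < N%:R :> R by rewrite ltr0n.
pose h := sigma / N%:R; rewrite -/h; have h0 : 0 < h by rewrite divr_gt0.
have hN : h * N%:R = sigma by rewrite /h divfK // gt_eqF.
pose n := (e - s)%N; pose g := (2 * N - n)%N; rewrite -/n -/g.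
pose a k : R := h * ((n%:R - 1) / 2 - k%:R).
have driftE : drift h n (e - t) = \sum_(0 <= k < t - s) tanh (a k).
  have -> : (t - s = n - (e - t))%N by lia.
  rewrite /drift -{1}[(e - t)%N]add0n big_addn big_nat_rev /=.
  apply: eq_big_nat => k kn; congr tanh; rewrite /a add0n; congr (_ * _).
  have -> : (n - (e - t) - k.+1 + (e - t)).+1%:R = n%:R - k%:R :> R.
    by rewrite -natrB; [congr (_%:R); lia | lia].
  by rewrite -natr1; field.
pose p := sigma - h * s%:R.
have gE : g%:R = 2 * N%:R - n%:R :> R by rewrite /g natrB ?natrM //; lia.
have sg : s%:R <= g%:R :> R by rewrite ler_nat; lia.
have near k : (k < t - s)%N -> `|a k - (p - h * k%:R)| <= h * (2 * g%:R + 1).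
  move=> _; have -> : a k - (p - h * k%:R) = h * (s%:R - g%:R / 2 - 2^-1).
    by rewrite /a /p -hN gE; field.
  rewrite normrM (gtr0_norm h0) ler_wpM2l ?(ltW h0) // ler_norml.
  have : 0 <= s%:R :> R by [].
  have : 0 <= g%:R :> R by [].
  by move=> ? ?; apply/andP; split; lra.
have := tanh_sum_lcosh (ltW h0) near; rewrite -driftE.
have -> : p - h * (t - s)%:R = sigma - h * t%:R by rewrite /p natrB ?(ltnW st) //; ring.
have profE : h * profile sigma t = lcosh sigma - lcosh (sigma - h * t%:R).
  rewrite /profile M_closed ?divr_ge0 //.
  have -> : sigma * (1 - t%:R / N%:R) = sigma - h * t%:R by rewrite /h; ring.
  by rewrite /h; field; rewrite !gt_eqF.
have ps : `|lcosh sigma - lcosh p| <= h * s%:R.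
  apply: le_trans (lcosh_lipschitz _ _) _.
  by rewrite /p opprB addrC subrK ger0_norm // mulr_ge0 // ltW.
set S := drift h n (e - t).
move=> hS; rewrite -(ler_pM2l h0) -[X in X * `|_| <= _](gtr0_norm h0) -normrM mulrBr profE.
have -> : h * S - (lcosh sigma - lcosh (sigma - h * t%:R)) =
  (h * S - (lcosh p - lcosh (sigma - h * t%:R))) - (lcosh sigma - lcosh p) by ring.
apply: le_trans (ler_normB _ _) _; apply: le_trans (lerD hS ps) _.
have tsN : (t - s)%:R <= 2 * N%:R :> R by rewrite -natrM ler_nat; lia.
have h2 : h * (t - s)%:R <= 2 * sigma.
  by rewrite -hN mulrCA ler_wpM2l ?(ltW h0).
have g0 : 0 <= g%:R :> R by [].
have e1 : h * (2 * g%:R + 1) + h = h * (2 * g%:R + 2) by ring.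
rewrite e1; have q0 : 0 <= h * (2 * g%:R + 2) by rewrite mulr_ge0 ?(ltW h0) //; lra.
have h3 := ler_wpM2r q0 h2; have h4 := ler_wpM2l (ltW h0) sg.
by lra.
Qed.

End Paths.

(** * Weights of events *)

Section EventWeights.
Variable R : realType.
Implicit Types (lam sigma eps c : R).

Definition Z_on lam sigma N (E : pred (zpath N)) : R :=
  \sum_(xi in Omega N | E xi) weight lam sigma xi.

Lemma mu_W lam sigma N (E : pred (zpath N)) :
  mu lam sigma E = Z_on lam sigma E / Z lam sigma N.
Proof. by rewrite /mu /Z_on mulr_suml. Qed.

Lemma Z_on_le lam sigma N (E E' : pred (zpath N)) : 0 <= lam ->
  (forall xi, xi \in Omega N -> E xi -> E' xi) -> Z_on lam sigma E <= Z_on lam sigma E'.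
Proof.
move=> l0 H; rewrite /Z_on !big_mkcondr; apply: ler_sum => xi xiO.
case: ifP => [/(H _ xiO) -> //|_]; case: ifP => _ //; exact: weight_ge0.
Qed.

Lemma Z_on_le_lam lam lam' sigma N (E : pred (zpath N)) : 0 <= lam <= lam' ->
  Z_on lam sigma E <= Z_on lam' sigma E.
Proof.
move=> /andP[l0 ll]; apply: ler_sum => xi _; rewrite /weight.
rewrite ler_wpM2r ?expR_ge0 // ler_wpM2l ?invr_ge0 ?exprn_ge0 //.
by rewrite lerXn2r // nnegrE (le_trans l0).
Qed.

Lemma Z_on_total lam sigma N (E : pred (zpath N)) : 0 <= lam -> Z_on lam sigma E <= Z lam sigma N.
Proof.
move=> l0; rewrite /Z -[X in _ <= X]/(\sum_(xi in Omega N) weight lam sigma xi).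
rewrite [X in _ <= X](bigID E) /= lerDl; apply: sumr_ge0 => xi _; exact: weight_ge0.
Qed.

Lemma Z_on_union lam sigma N (I : finType) (E : pred (zpath N)) (Ei : I -> pred (zpath N)) :
  0 <= lam -> (forall xi, xi \in Omega N -> E xi -> exists i, Ei i xi) ->
  Z_on lam sigma E <= \sum_i Z_on lam sigma (Ei i).
Proof.
move=> l0 H; rewrite /Z_on; under [X in _ <= X]eq_bigr do rewrite big_mkcondr.
rewrite exchange_big big_mkcondr /=; apply: ler_sum => xi xiO.
have w0 : 0 <= weight lam sigma xi by exact: weight_ge0.
case: ifP => [/(H _ xiO)[i Eixi]|_].
  rewrite (bigD1 i) //= Eixi lerDl; apply: sumr_ge0 => j _; by case: ifP.
by apply: sumr_ge0 => j _; case: ifP.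
Qed.

Lemma Z_on_pred0 lam sigma N (E : pred (zpath N)) : (forall xi, ~~ E xi) -> Z_on lam sigma E = 0.
Proof. by move=> H; rewrite /Z_on big1 // => xi /andP[_]; rewrite (negbTE (H xi)). Qed.

Lemma Z_on_exc lam sigma N s e b : (0 < N)%N -> 0 < lam -> (s < e <= 2 * N)%N ->
  Z_on lam sigma (@excb N s e b) =
  Y (sigma / N%:R) lam s * exc (sigma / N%:R) b (e - s) * Y (sigma / N%:R) lam (2 * N - e).
Proof. by move=> N0 l0 se; rewrite /Z_on weight_exc // gt_eqF. Qed.

(** Paths without contact do not feel [lam]. *)
Lemma Z_on_exc_full lam sigma N b : (0 < N)%N ->
  Z_on lam sigma (@excb N 0 (2 * N) b) = exc (sigma / N%:R) b (2 * N).
Proof.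
move=> N0; transitivity (Z_on 1 sigma (@excb N 0 (2 * N) b)); last first.
  rewrite Z_on_exc ?ltr01 //; last by rewrite muln_gt0 N0 leqnn.
  by rewrite subn0 subnn !Y0 mul1r mulr1.
apply: eq_bigr => xi /andP[xiO ex]; rewrite /weight; congr (_ * _ * _).
suff -> : H xi = 0%N by [].
apply: eq_card0 => x; rewrite inE hgtE; apply/negbTE/negP => /andP[/andP[x0 xN] hx].
have xr : (0 < x <= 2 * N)%N by rewrite x0 ltnW.
by have [] := excb_hgt ex xr (leqnn (2 * N)); rewrite hx (ltn_eqF xN).
Qed.

Lemma M1_gt0 sigma : 0 < sigma -> 0 < M sigma 1.
Proof.
move=> s0; rewrite M_closed // subrr mulr0 lcosh0 subr0 divr_gt0 //.
by rewrite /lcosh ln_gt0 // cosh_gt1 // gt_eqF.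
Qed.

(** Excursions of full length account for this weight on their own. *)
Lemma Z_on_height_ge sigma : 0 < sigma -> exists2 c : R, 0 < c &
  forall eps, 0 <= eps -> eps < M sigma 1 -> exists N0, forall N, (N0 <= N)%N ->
  forall lam, 0 <= lam ->
  c / Num.sqrt N%:R * expR ((2 * N)%:R * G sigma) <=
  Z_on lam sigma (fun xi : zpath N => eps * N%:R < (height xi)%:R).
Proof.
move=> s0; have [c c0 H] := exc_ge s0.
exists (c * expR (- sigma ^+ 2)); first by rewrite mulr_gt0 ?expR_gt0.
move=> eps e0 eM; have [N0 HN] := H eps e0 eM.
exists N0.+1 => N N0N lam l0.
have N0' : (0 < N)%N by apply: leq_trans N0N.
have NR : 1 <= N%:R :> R by rewrite ler1n.
have NR0 : 0 < N%:R :> R by rewrite ltr0n.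
apply: (@le_trans _ _ (exc (sigma / N%:R) (at_time N (fun x => eps * N%:R < x%:R)) (N + N))).
  apply: le_trans (HN N (ltnW N0N)).
  have h0 : 0 <= sigma / N%:R by rewrite divr_ge0 // ltW.
  have := @G_le_ltilt _ (sigma / N%:R) (N + N) h0.
  rewrite addn_gt0 N0' => /(_ isT).
  have -> : sigma / N%:R * (N + N)%:R / 2 = sigma by rewrite natrD; field; rewrite gt_eqF.
  rewrite mul2n -addnn => hG.
  have -> : c * expR (- sigma ^+ 2) / Num.sqrt N%:R * expR ((N + N)%:R * G sigma) =
    c / Num.sqrt N%:R * expR (- sigma ^+ 2 + (N + N)%:R * G sigma) by rewrite expRD; ring.
  rewrite ler_wpM2l ?divr_ge0 ?sqrtr_ge0 ?(ltW c0) // ler_expR.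
  have : (N + N)%:R * ((sigma / N%:R) ^+ 2 / 8) <= sigma ^+ 2.
    have -> : (N + N)%:R * ((sigma / N%:R) ^+ 2 / 8) = sigma ^+ 2 / (4 * N%:R).
      by rewrite natrD; field; rewrite gt_eqF.
    by rewrite ler_pdivrMr ?mulr_gt0 // ler_peMr ?sqr_ge0 //; lra.
  by lra.
rewrite addnn -mul2n -(Z_on_exc_full lam) //; apply: Z_on_le => // xi xiO ex.
have N2 : (0 < N <= 2 * N)%N by rewrite N0' leq_pmull.
have [_] := excb_hgt ex N2 (leqnn _).
rewrite /at_time mul2n -addnn addnK eqxx /= => /lt_le_trans; apply.
by rewrite ler_nat hgt_le_height.
Qed.

(** The ratio [rho = 1 / sqrt (lam - 1)] is the one for which the renewal measure
    of the contacts is a probability. *)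
Lemma F_pin_rate lam : 2 < lam -> F lam = pin_rate (Num.sqrt (lam - 1))^-1.
Proof.
move=> l2; rewrite /F l2 /pin_rate invrK; congr ln.
have p : 0 < lam - 1 by lra.
set s := Num.sqrt (lam - 1); have s0 : 0 < s by rewrite sqrtr_gt0.
have : s ^+ 2 = lam - 1 by rewrite sqr_sqrtr // ltW.
move=> e; have -> : lam = s ^+ 2 + 1 by rewrite e; lra.
by field; rewrite gt_eqF.
Qed.

Lemma pin_ratio lam : 2 < lam ->
  0 < (Num.sqrt (lam - 1))^-1 < 1 /\ (lam - 1) * (Num.sqrt (lam - 1))^-1 ^+ 2 = 1.
Proof.
move=> l2; have p : 0 < lam - 1 by lra.
have s1 : 1 < Num.sqrt (lam - 1) by rewrite -[X in X < _]sqrtr1 ltr_sqrt //; lra.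
split; first by rewrite invr_gt0 sqrtr_gt0 p /= invf_lt1 // (lt_trans ltr01).
by rewrite exprVn sqr_sqrtr ?(ltW p) // divff // gt_eqF.
Qed.

Lemma F_gt0 lam : 2 < lam -> 0 < F lam.
Proof. by move=> l2; rewrite F_pin_rate // pin_rate_gt0 //; have [] := pin_ratio l2. Qed.

(** As [sigma > 0] the field only increases the weights. *)
Lemma Z_ge_pin lam sigma : 2 < lam -> 0 < sigma -> exists2 c : R, 0 < c &
  forall N, (0 < N)%N -> c * expR ((2 * N)%:R * F lam) <= Z lam sigma N.
Proof.
move=> l2 s0; have [r01 lr] := pin_ratio l2.
have l0 : 0 < lam by lra.
have [c c0 H] := Y_ge r01 lr.
exists (c / lam); first by rewrite divr_gt0.
move=> N N0; rewrite F_pin_rate //.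
apply: (@le_trans _ _ (Z lam 0 N)).
  have := H N; rewrite -[X in Y X](mul0r N%:R^-1) -weight_total // => h.
  by rewrite mulrAC ler_pdivrMr // mulrC [X in _ <= X]mulrC [X in X <= _]mulrC.
apply: ler_sum => xi _; rewrite /weight ler_wpM2l //.
  by rewrite mulr_ge0 ?invr_ge0 ?exprn_ge0 // ltW.
by rewrite ler_expR !mul0r mulr_ge0 // divr_ge0 // ltW.
Qed.

Lemma poly_exp_eventually (A c : R) (f : nat -> R) : 0 <= A -> 0 < c ->
  (exists N0, forall N, (N0 <= N)%N -> f N <= A * N%:R ^+ 4 * expR (- (c * N%:R))) ->
  exists2 delta : R, 0 < delta &
    \forall N \near \oo, f N <= expR (- (delta * N%:R)).
Proof.
move=> A0 c0 [N0 H]; exists (c / 2); first by rewrite divr_gt0.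
(* 120 = 5!, from the fifth term of the exponential series *)
pose K := A * 120 * (2 / c) ^+ 5.
exists (maxn N0 (Num.truncn K).+1) => // N /=; rewrite geq_max => /andP[N0N KN].
apply: le_trans (H N N0N) _.
have -> : - (c * N%:R) = - (c / 2 * N%:R) + - (c / 2 * N%:R) by field.
rewrite expRD mulrA ler_piMl ?expR_ge0 //.
have q0 : 0 <= c / 2 * N%:R by rewrite mulr_ge0 // divr_ge0 // ltW.
have := expR_ge1Dxn 4 q0; rewrite (_ : 5`!%:R = 120) // => hq.
rewrite expRN ler_pdivrMr ?expR_gt0 // mul1r.
have KNR : K <= N%:R.
  by apply/ltW/(lt_le_trans (truncnS_gt _)); rewrite ler_nat.
apply: (@le_trans _ _ ((c / 2 * N%:R) ^+ 5 / 120)); last by lra.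
have N4 : 0 <= N%:R ^+ 4 :> R by rewrite exprn_ge0.
have -> : (c / 2 * N%:R) ^+ 5 / 120 = ((c / 2) ^+ 5 / 120 * N%:R) * N%:R ^+ 4 :> R.
  by rewrite exprMn; ring.
rewrite ler_wpM2r // mulrC -ler_pdivrMr ?divr_gt0 ?exprn_gt0 ?divr_gt0 //.
apply: le_trans KNR; rewrite /K le_eqVlt; apply/orP; left; apply/eqP.
by field; rewrite gt_eqF.
Qed.

End EventWeights.

(** * Deviations from the profile *)

Section Numerators.
Variable R : realType.
Variables lam sigma F0 D C : R.
Hypotheses (lam_gt0 : 0 < lam) (sigma_gt0 : 0 < sigma) (F0_ge0 : 0 <= F0)
  (D_ge0 : 0 <= D) (C_gt0 : 0 < C).
Hypothesis Y_bound : forall N m, (0 < N)%N -> (m <= 2 * N)%N ->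
  Y (sigma / N%:R) lam m <= C * expR (m%:R * F0 + D * m%:R ^+ 2 / (2 * N)%:R).

Lemma Z_on_exc_le N s e b K : (0 < N)%N -> (s < e <= 2 * N)%N ->
  exc (sigma / N%:R) b (e - s) <= K ->
  Z_on lam sigma (@excb N s e b) <=
  C ^+ 2 * expR ((s%:R + (2 * N - e)%:R) * F0 +
    D * (s%:R ^+ 2 + (2 * N - e)%:R ^+ 2) / (2 * N)%:R) * K.
Proof.
move=> N0 /andP[se eN] HK; rewrite Z_on_exc // ?se ?eN //.
set r := (2 * N - e)%N.
have sN : (s <= 2 * N)%N by apply: leq_trans eN; exact: ltnW.
have h1 := Y_bound N0 sN; have h2 := @Y_bound N r N0 (leq_subr _ _).
have Yg m : 0 <= Y (sigma / N%:R) lam m by exact/Y_ge0/ltW.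
have e0 := exc_ge0 (sigma / N%:R) b (e - s).
apply: (@le_trans _ _ (C * expR (s%:R * F0 + D * s%:R ^+ 2 / (2 * N)%:R) * K *
    (C * expR (r%:R * F0 + D * r%:R ^+ 2 / (2 * N)%:R)))).
  by apply: ler_pM => //; [exact: mulr_ge0 | apply: ler_pM].
rewrite le_eqVlt; apply/orP; left; apply/eqP.
have -> : (s%:R + r%:R) * F0 + D * (s%:R ^+ 2 + r%:R ^+ 2) / (2 * N)%:R =
  (s%:R * F0 + D * s%:R ^+ 2 / (2 * N)%:R) + (r%:R * F0 + D * r%:R ^+ 2 / (2 * N)%:R) by ring.
set a := s%:R * F0 + _; set b' := r%:R * F0 + _.
by rewrite (expRD a); ring.
Qed.

(** The side of the deviation is a parameter because Chernoff's bound is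
    one-sided. *)
Definition off_mean (N s e t : nat) (k : R) (up : bool) : nat -> nat -> bool :=
  at_time (e - t)%N (fun x => if up then drift (sigma / N%:R) (e - s) (e - t) + k <= x%:R
                            else x%:R <= drift (sigma / N%:R) (e - s) (e - t) - k).

Lemma exc_off_mean N s e t k up : (0 < N)%N -> (s < t <= e)%N -> (e <= 2 * N)%N -> 0 <= k ->
  exc (sigma / N%:R) (off_mean N s e t k up) (e - s)%N <=
  expR ((2 * N)%:R * G sigma - k ^+ 2 / (4 * N%:R)).
Proof.
move=> N0 /andP[st te] eN k0; have NR : 0 < N%:R :> R by rewrite ltr0n.
pose n := (e - s)%N; pose S := drift (sigma / N%:R) n (e - t).
have rn : (e - t < n)%N by rewrite /n; lia.
have nN : (n <= 2 * N)%N by rewrite /n; lia.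
have LR : (2 * N)%:R = 2 * N%:R :> R by rewrite natrM.
have G0 := ltW (G_gt0 sigma_gt0).
have lt : ltilt (sigma / N%:R) n <= (2 * N)%:R * G sigma.
  apply: (le_trans (ltilt_le_sqr sigma_gt0 N0 nN)); rewrite ler_wpM2r //.
  have n0 : 0 <= n%:R :> R by [].
  have nNR : n%:R <= (2 * N)%:R :> R by rewrite ler_nat.
  by rewrite ler_pdivrMr ?LR ?mulr_gt0 // -LR expr2; exact: ler_pM.
have th0 : 0 <= k / (2 * N%:R) by rewrite divr_ge0 // mulr_ge0 // ltW.
have nrN : (n - (e - t))%:R <= 2 * N%:R :> R by rewrite -LR ler_nat (leq_trans (leq_subr _ _)).
have quad : (k / (2 * N%:R)) ^+ 2 / 2 * (n - (e - t))%:R <= k ^+ 2 / (4 * N%:R).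
  have -> : k ^+ 2 / (4 * N%:R) = (k / (2 * N%:R)) ^+ 2 / 2 * (2 * N%:R).
    by field; rewrite gt_eqF.
  by rewrite ler_wpM2l // divr_ge0 ?sqr_ge0.
have lin : k / (2 * N%:R) * k = 2 * (k ^+ 2 / (4 * N%:R)) by field; rewrite gt_eqF.
case: up.
  apply: le_trans (@exc_le_dev _ _ _ n (e - t) (k / (2 * N%:R)) (S + k) rn _) _.
    move=> x; rewrite /off_mean /at_time eqxx /= => hx.
    by rewrite mulr_ge0 // subr_ge0.
  rewrite ler_expR -/S.
  have -> : S + k - S = k by ring.
  by rewrite lin; lra.
apply: le_trans (@exc_le_dev _ _ _ n (e - t) (- (k / (2 * N%:R))) (S - k) rn _) _.
  move=> x; rewrite /off_mean /at_time eqxx /= => hx.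
  by rewrite mulr_le0 ?oppr_le0 // subr_le0.
rewrite ler_expR -/S.
have -> : - (k / (2 * N%:R)) * (S - k - S) = k / (2 * N%:R) * k by ring.
by rewrite sqrrN lin; lra.
Qed.

(** Either the excursion leaves more than [delta N] steps uncovered, and falls
    under the bound [K], or its mean path is close to the profile, so that a
    deviation from the profile is one from the mean, to which Chernoff's bound
    applies. The factor [63 N ^ 3] counts the choices of the two endpoints, of the
    time of the deviation and of its side. *)
Lemma Z_on_deviation (eps : R) : 0 < eps ->
  exists (delta c : R) (N0 : nat),
  [/\ 0 < delta, 0 < c & forall N, (N0 <= N)%N ->
  forall (P : nat -> nat -> bool) (K : R) (E : pred (zpath N)), 0 <= K ->
  (forall s e, (s < e <= 2 * N)%N -> P s e -> delta * N%:R < (2 * N - (e - s))%:R ->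
     Z_on lam sigma (@excb N s e anywhere) <= K) ->
  (forall xi, xi \in Omega N -> E xi -> eps < deviation sigma xi /\
     exists s e, [/\ (s < e <= 2 * N)%N, P s e, hgt xi s = 0%N &
       forall u, (s < u <= e)%N -> (hgt xi u == 0%N) = (u == e)]) ->
  Z_on lam sigma E <= 63 * N%:R ^+ 3 *
    (K + C ^+ 2 * expR ((2 * N)%:R * G sigma - c * N%:R))].
Proof.
(* d1 keeps the discrepancy between drift and profile below eps N / 8, and d2
   keeps the pinned remainder below half of the gain eps ^ 2 N / 64 *)
move=> eps0; pose d1 := eps / (8 * (4 * sigma + 1)).
pose d2 := eps ^+ 2 / (128 * (F0 + D + 1)).
pose delta := Num.min d1 d2.
have s0 := sigma_gt0; have s4 : 0 < 4 * sigma + 1 by rewrite addr_gt0 // mulr_gt0.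
have FD : 0 < F0 + D + 1 by rewrite ltr_wpDl // addr_ge0.
have d10 : 0 < d1 by rewrite divr_gt0 // mulr_gt0.
have d20 : 0 < d2 by rewrite divr_gt0 ?exprn_gt0 // mulr_gt0.
have dl0 : 0 < delta by rewrite lt_min d10.
have dl1 : (4 * sigma + 1) * delta <= eps / 8.
  have : delta <= d1 by rewrite ge_min lexx.
  move=> /(ler_wpM2l (ltW s4)) /le_trans; apply.
  by rewrite /d1 le_eqVlt; apply/orP; left; apply/eqP; field; rewrite gt_eqF.
have dl2 : (F0 + D) * delta <= eps ^+ 2 / 128.
  have : delta <= d2 by rewrite ge_min lexx orbT.
  move=> /(ler_wpM2l (ltW FD)) h.
  apply: (@le_trans _ _ ((F0 + D + 1) * delta)); first by rewrite ler_wpM2r ?(ltW dl0) //; lra.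
  apply: (le_trans h).
  by rewrite /d2 le_eqVlt; apply/orP; left; apply/eqP; field; rewrite gt_eqF.
have dl3 : delta <= eps / 8.
  have := mulr_gt0 sigma_gt0 dl0; have := ltW dl0; lra.
exists delta, (eps ^+ 2 / 128), (Num.truncn (32 * sigma / eps + 2 / eps)).+2.
split; [exact: dl0 | by rewrite divr_gt0 ?exprn_gt0 | ].
move=> N N0N P K E K0 HK HE.
have N0 : (0 < N)%N by apply: leq_trans N0N.
have NR : 0 < N%:R :> R by rewrite ltr0n.
have NR1 : 1 <= N%:R :> R by rewrite ler1n.
have LR : (2 * N)%:R = 2 * N%:R :> R by rewrite natrM.
have Nbig : 32 * sigma / eps + 2 / eps <= N%:R.
  by apply/ltW/(lt_le_trans (truncnS_gt _)); rewrite ler_nat; exact: ltnW.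
have Nbig' : 32 * sigma + 2 <= eps * N%:R.
  have := ler_wpM2l (ltW eps0) Nbig; rewrite mulrDr.
  by rewrite ![eps * (_ / eps)]mulrC !divfK ?gt_eqF.
pose k := eps * N%:R / 4.
have k0 : 0 <= k by rewrite divr_ge0 // mulr_ge0 // ltW.
pose I1 : finType := ('I_(2 * N).+1 * 'I_(2 * N).+1)%type.
pose I2 : finType := (I1 * 'I_(2 * N).+1 * bool)%type.
pose I : finType := (I1 + I2)%type.
pose Ei (i : I) : pred (zpath N) := match i with
  | inl (s, e) => fun xi => [&& (s < e)%N, P s e, delta * N%:R < (2 * N - (e - s))%:R
       & excb s e anywhere xi]
  | inr (s, e, t, up) => fun xi => [&& (s < t)%N, (t <= e)%N, (2 * N - (e - s))%:R <= delta * N%:R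
       & excb s e (off_mean N s e t k up) xi]
  end.
have C20 : 0 <= C ^+ 2 by exact: sqr_ge0.
pose K2 := C ^+ 2 * expR ((2 * N)%:R * G sigma - eps ^+ 2 / 128 * N%:R).
have K20 : 0 <= K2 by rewrite mulr_ge0 ?expR_ge0.
have cover xi : xi \in Omega N -> E xi -> exists i : I, Ei i xi.
  move=> xiO Exi; have [dev [s [e [se Pse hs Hse]]]] := HE xi xiO Exi.
  have /andP[slte eN] := se.
  have sL : (s < (2 * N).+1)%N by rewrite ltnS (leq_trans (ltnW slte)).
  have eL : (e < (2 * N).+1)%N by rewrite ltnS.
  have [short|long] := ltP (delta * N%:R) (2 * N - (e - s))%:R.
    exists (inl (Ordinal sL, Ordinal eL)); apply/and4P; split => //=.
    by apply: excbP => // u /Hse ->; rewrite eqxx.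
  have [t tN tdev] := deviation_hgt sigma_gt0 N0 eps0 dev.
  have tL : (t < (2 * N).+1)%N by rewrite ltnS.
  have gsmall : (2 * N - (e - s))%:R <= eps / 8 * N%:R.
    by apply: (le_trans long); rewrite ler_wpM2r // ltW.
  have [h1 _] := @hgt_dist N xi 0 t xiO tN.
  have h2E : (t + (2 * N - t) <= 2 * N)%N by rewrite subnKC.
  have [_ h2] := @hgt_dist N xi t (2 * N - t) xiO h2E.
  rewrite add0n hgt0 // add0n in h1; rewrite subnKC // hgt_end // add0n in h2.
  have st : (s < t)%N.
    rewrite ltnNge; apply/negP => ts.
    have tg : t%:R <= eps / 8 * N%:R.
      by apply: le_trans gsmall; rewrite ler_nat; clear -ts slte eN; lia.
    have p1 := profile_le t sigma_gt0 N0.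
    have : (hgt xi t)%:R <= t%:R :> R by rewrite ler_nat.
    have := ler_normB (hgt xi t)%:R (profile N sigma t).
    rewrite (ger0_norm (ler0n R (hgt xi t))); lra.
  have te : (t <= e)%N.
    rewrite leqNgt; apply/negP => et.
    have tg : (2 * N - t)%:R <= eps / 8 * N%:R.
      by apply: le_trans gsmall; rewrite ler_nat; clear -et slte eN; lia.
    have p1 := profile_le_end sigma_gt0 N0 tN.
    have : (hgt xi t)%:R <= (2 * N - t)%:R :> R by rewrite ler_nat.
    have := ler_normB (hgt xi t)%:R (profile N sigma t).
    rewrite (ger0_norm (ler0n R (hgt xi t))); lra.
  have ste : (s < t <= e)%N by rewrite st.
  have dp := drift_profile sigma_gt0 N0 ste eN.
  set S := drift _ _ _ in dp.
  have far : k <= `|(hgt xi t)%:R - S|.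
    have tri : `|(hgt xi t)%:R - profile N sigma t| <= `|(hgt xi t)%:R - S| + `|S - profile N sigma t|.
      by apply: le_trans (ler_normD _ _); rewrite subrKA.
    have lg := ler_wpM2l (ltW s4) long.
    have lg2 := ler_wpM2r (ltW NR) dl1.
    by rewrite /k; lra.
  have up : exists up, off_mean N s e t k up (e - t)%N (hgt xi t).
    move: far; rewrite ler_normr => /orP[far|far].
      by exists true; rewrite /off_mean /at_time eqxx /= -/S; lra.
    by exists false; rewrite /off_mean /at_time eqxx /= -/S; lra.
  have [dir Hdir] := up.
  exists (inr (Ordinal sL, Ordinal eL, Ordinal tL, dir)); apply/and4P; split => //=.
  apply: excbP => // u seu; rewrite Hse // eqxx /=.
  have [->//|ut] := eqVneq u t.
  rewrite /off_mean /at_time; have -> // : (e - u == e - t)%N = false.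
  have /andP[_ ue] := seu.
  by apply/negbTE; apply: contra_neq ut => h; rewrite -(subKn ue) h subKn.
apply: le_trans (@Z_on_union R lam sigma N I E Ei (ltW lam_gt0) cover) _.
have W1 i : Z_on lam sigma (Ei i) <= K + K2.
  case: i => [[s e]|[[[s e] t] up]].
    have [c|nc] := boolP [&& (s < e)%N, P s e & delta * N%:R < (2 * N - (e - s))%:R]; last first.
      rewrite Z_on_pred0 ?addr_ge0 // => xi; apply: contra nc => /=.
      by move=> /and4P[-> -> ->].
    have /and3P[se Pse short] := c.
    have seN : (s < e <= 2 * N)%N by rewrite se -ltnS ltn_ord.
    apply: (@le_trans _ _ (Z_on lam sigma (@excb N s e anywhere))).
      by apply: Z_on_le; [exact: ltW | move=> xi _ /and4P[]].
    by apply: (le_trans (HK s e seN Pse short)); rewrite lerDl.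
  have [c|nc] := boolP [&& (s < t)%N, (t <= e)%N & (2 * N - (e - s))%:R <= delta * N%:R]; last first.
    rewrite Z_on_pred0 ?addr_ge0 // => xi; apply: contra nc => /=.
    by move=> /and4P[-> -> ->].
  have /and3P[st te long] := c.
  have eN : (e <= 2 * N)%N by rewrite -ltnS ltn_ord.
  have seN : (s < e <= 2 * N)%N by rewrite (leq_trans st te).
  apply: (@le_trans _ _ (Z_on lam sigma (@excb N s e (off_mean N s e t k up)))).
    by apply: Z_on_le; [exact: ltW | move=> xi _ /and4P[]].
  have ste : (s < t <= e)%N by rewrite st.
  apply: (le_trans (Z_on_exc_le N0 seN (exc_off_mean up N0 ste eN k0))).
  apply: (@le_trans _ _ K2); last by rewrite lerDr.
  rewrite /K2 -mulrA ler_wpM2l // -expRD ler_expR.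
  set r := (2 * N - e)%N.
  have gE : (2 * N - (e - s))%:R = s%:R + r%:R :> R.
    by rewrite -natrD; congr (_%:R); rewrite /r; clear -st te eN; lia.
  rewrite gE in long.
  have sq m : (m <= 2 * N)%N -> m%:R ^+ 2 / (2 * N)%:R <= m%:R :> R.
    move=> mN; rewrite ler_pdivrMr ?LR ?mulr_gt0 // -LR expr2 ler_wpM2l // ler_nat //.
  have sN : (s <= 2 * N)%N by rewrite -ltnS ltn_ord.
  have q1 := ler_wpM2l D_ge0 (sq s sN).
  have q2 := ler_wpM2l D_ge0 (sq r (leq_subr _ _)).
  have q3 : (F0 + D) * (s%:R + r%:R) <= eps ^+ 2 / 128 * N%:R.
    apply: (le_trans (ler_wpM2l (addr_ge0 F0_ge0 D_ge0) long)).
    by rewrite mulrA ler_wpM2r // ltW.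
  have q4 : k ^+ 2 / (4 * N%:R) = eps ^+ 2 / 64 * N%:R.
    by rewrite /k; field; rewrite gt_eqF.
  rewrite q4 mulrDr mulrDl -!mulrA.
  by move: q1 q2 q3; set a := s%:R; set b := r%:R; lra.
apply: (le_trans (ler_sum _ (fun i _ => W1 i))).
rewrite sumr_const card_sum !card_prod card_ord card_bool -[X in X <= _]mulr_natl.
rewrite ler_wpM2r ?addr_ge0 //.
have -> : 63 * N%:R ^+ 3 = (63 * N ^ 3)%:R :> R by rewrite natrM natrX.
rewrite ler_nat; clear -N0; nia.
Qed.

End Numerators.

(** * The delocalised regime *)

Section Delocalised.
Variable R : realType.
Implicit Types (lam sigma eps : R).

(** An exponential gap between a numerator and the partition function absorbs all
    polynomial factors. As [Z_on] is monotone in the reward, the numerator may be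
    taken at a larger reward [lam1]. *)
Lemma mu_exp_small lam lam1 sigma x (E : forall N, pred (zpath N)) (a A c : R) N0 :
  0 <= lam <= lam1 -> 0 < a -> 0 <= A -> 0 < c ->
  (forall N, (N0 <= N)%N -> a / Num.sqrt N%:R * expR ((2 * N)%:R * x) <= Z lam sigma N) ->
  (forall N, (N0 <= N)%N ->
    Z_on lam1 sigma (E N) <= A * N%:R ^+ 3 * expR ((2 * N)%:R * x - c * N%:R)) ->
  exists2 delta : R, 0 < delta &
    \forall N \near \oo, mu lam sigma (E N) <= expR (- (delta * N%:R)).
Proof.
move=> ll a0 A0 c0 HZ HW; have /andP[l0 _] := ll.
apply: (@poly_exp_eventually R (A / a) c) => //; first by rewrite divr_ge0 // ltW.
exists N0.+1 => N N0N.
have NR1 : 1 <= N%:R :> R by rewrite ler1n (leq_trans _ N0N).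
have NR : 0 < N%:R :> R by apply: lt_le_trans NR1.
have s0 : 0 < Num.sqrt N%:R :> R by rewrite sqrtr_gt0.
have sN : Num.sqrt N%:R <= N%:R :> R.
  rewrite -ler_sqr ?nnegrE ?(ltW s0) ?(ltW NR) // sqr_sqrtr ?(ltW NR) //.
  by rewrite expr2 ler_peMl // ltW.
have z0 : 0 < a / Num.sqrt N%:R * expR ((2 * N)%:R * x) by rewrite mulr_gt0 ?expR_gt0 // divr_gt0.
have Z0 : 0 < Z lam sigma N := lt_le_trans z0 (HZ N (ltnW N0N)).
rewrite mu_W ler_pdivrMr //.
apply: (le_trans (Z_on_le_lam sigma (E N) ll)).
apply: (le_trans (HW N (ltnW N0N))).
have t0 : 0 <= A / a * N%:R ^+ 4 * expR (- (c * N%:R)).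
  by rewrite !mulr_ge0 ?expR_ge0 ?exprn_ge0 ?invr_ge0 // ltW.
apply: le_trans (ler_wpM2l t0 (HZ N (ltnW N0N))).
rewrite expRD; set e1 := expR _; set e2 := expR _.
have -> : A / a * N%:R ^+ 4 * e2 * (a / Num.sqrt N%:R * e1) =
   A * N%:R ^+ 3 * (e1 * e2) * (N%:R / Num.sqrt N%:R) by field; rewrite !gt_eqF.
rewrite ler_peMr ?mulr_ge0 ?expR_ge0 ?exprn_ge0 ?(ltW NR) //.
by rewrite ler_pdivlMr // mul1r.
Qed.

Lemma Z_ge_height sigma : 0 < sigma -> exists2 a : R, 0 < a & exists N0, forall N, (N0 <= N)%N ->
  forall lam, 0 <= lam -> a / Num.sqrt N%:R * expR ((2 * N)%:R * G sigma) <= Z lam sigma N.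
Proof.
move=> s0; have [c c0 H] := Z_on_height_ge s0; exists c => //.
have [N0 HN] := H 0 (lexx _) (M1_gt0 s0).
exists N0 => N N0N lam l0; apply: (le_trans (HN N N0N lam l0)); exact: Z_on_total.
Qed.

Lemma Z_ge_pin_sqrt lam sigma : 2 < lam -> 0 < sigma -> exists2 a : R, 0 < a &
  forall N, (0 < N)%N -> a / Num.sqrt N%:R * expR ((2 * N)%:R * F lam) <= Z lam sigma N.
Proof.
move=> l2 s0; have [c c0 H] := Z_ge_pin l2 s0; exists c => // N N0.
apply: le_trans (H N N0); rewrite ler_wpM2r ?expR_ge0 // ler_piMr ?(ltW c0) //.
have s1 : 1 <= Num.sqrt N%:R :> R by rewrite -[X in X <= _]sqrtr1 ler_wsqrtr // ler1n.
by rewrite invf_le1 // (lt_le_trans ltr01).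
Qed.

(** Exponential loss of an excursion around mid-time that leaves a fraction of the
    system uncovered. The excess over the pinned phase is quadratic in the length,
    hence superadditive; since neither side is longer than [L / 2], either the
    excursion is not short or both sides are long, whence the two cases. *)
Lemma short_exponent (F0 D g delta s n r L : R) : 0 <= F0 -> 0 <= D -> g = F0 + D ->
  0 < L -> 0 <= s <= L / 2 -> 0 <= r <= L / 2 -> 0 <= n -> s + n + r = L ->
  0 < delta -> delta * L <= s + r ->
  (s + r) * F0 + D * (s ^+ 2 + r ^+ 2) / L + n ^+ 2 / L * g <=
  L * g - Num.min (g * delta / 4) (D / 8) * L.
Proof.
move=> F00 D0 -> L0 /andP[s0 sL] /andP[r0 rL] n0 snr d0 dl.
set c := Num.min _ _.
have c1 : c <= (F0 + D) * delta / 4 by rewrite ge_min lexx.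
have c2 : c <= D / 8 by rewrite ge_min lexx orbT.
have nE : n = L - (s + r) by lra.
rewrite -subr_ge0 -(pmulr_lge0 _ L0) nE.
have -> : (L * (F0 + D) - c * L - ((s + r) * F0 + D * (s ^+ 2 + r ^+ 2) / L +
    (L - (s + r)) ^+ 2 / L * (F0 + D))) * L =
  (F0 + 2 * D) * ((s + r) * (L - (s + r))) + 2 * D * (s * r) - c * (L * L).
  by field; rewrite gt_eqF.
have dn : 0 <= L - (s + r) by lra.
have LL : 0 <= L * L by rewrite mulr_ge0 // ltW.
have sr : 0 <= s * r by exact: mulr_ge0.
have d0' : 0 <= s + r by exact: addr_ge0.
have dd : 0 <= (s + r) * (L - (s + r)) by exact: mulr_ge0.
have t1 := mulr_ge0 F00 dd; have t2 := mulr_ge0 D0 dd; have t3 := mulr_ge0 D0 sr.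
have [d34|d34] := leP (s + r) (3 / 4 * L).
  have h : delta / 4 * (L * L) <= (s + r) * (L - (s + r)).
    have -> : delta / 4 * (L * L) = (delta * L) * (L / 4) by field.
    by apply: ler_pM => //; [rewrite mulr_ge0 // ltW | rewrite divr_ge0 // ltW | lra].
  have h1 := ler_wpM2l (addr_ge0 F00 D0) h.
  have h2 := ler_wpM2r LL c1.
  lra.
have h : 16^-1 * (L * L) <= s * r.
  have -> : 16^-1 * (L * L) = (L / 4) * (L / 4) by field.
  by apply: ler_pM; rewrite ?divr_ge0 ?(ltW L0) //; lra.
have h1 := ler_wpM2l D0 h.
have h2 := ler_wpM2r LL c2.
lra.
Qed.

(** A reference pinned phase that dominates the contacts while its rate stays below
    [g]. When [lam <= 2] there is no pinned phase, but rewards up to [2] are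
    dominated at any positive rate, with [rho] close to [1]. *)
Lemma pin_rate_below lam g : 0 <= lam -> F lam < g -> exists2 rho : R, 0 < rho < 1 &
  (Num.max lam 1 - 1) * rho ^+ 2 <= 1 /\ pin_rate rho < g.
Proof.
move=> l0 Fg; have [l2|l2] := ltP 2 lam.
  have [r01 rE] := pin_ratio l2.
  exists (Num.sqrt (lam - 1))^-1 => //; rewrite -F_pin_rate //; split => //.
  by rewrite (max_idPl _) ?rE //; lra.
have g0 : 0 < g by move: Fg; rewrite /F (ltNge 2) l2.
(* the rate of rho = 1 / (1 + x) is at most x ^ 2 / 2, hence below g *)
pose x := Num.min 1 g; have x0 : 0 < x by rewrite lt_min ltr01.
have x1 : x <= 1 by rewrite ge_min lexx.
have xg : x <= g by rewrite ge_min lexx orbT.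
have y0 : 0 < 1 + x by rewrite addr_gt0.
have r01 : 0 < (1 + x)^-1 < 1 by rewrite invr_gt0 y0 invf_lt1 // ltrDl.
exists (1 + x)^-1 => //; split.
  have m1 : Num.max lam 1 - 1 <= 1 by rewrite lerBlDr ge_max; apply/andP; split; lra.
  have r2 : 0 <= (1 + x)^-1 ^+ 2 <= 1.
    by rewrite sqr_ge0 exprn_ile1 ?invr_ge0 ?(ltW y0) // invf_le1 // lerDl ltW.
  have /andP[r20 r21] := r2.
  apply: le_trans (ler_wpM2r r20 m1) _; by rewrite mul1r.
have -> : pin_rate (1 + x)^-1 = ln (1 + x ^+ 2 / (2 * (1 + x))).
  by rewrite /pin_rate; congr ln; field; rewrite gt_eqF.
have q0 : 0 <= x ^+ 2 / (2 * (1 + x)) by rewrite divr_ge0 ?sqr_ge0 // mulr_ge0 // ltW.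
apply: (@le_lt_trans _ _ (x ^+ 2 / (2 * (1 + x)))).
  by apply: le_ln1Dx; lra.
rewrite ltr_pdivrMr ?mulr_gt0 //; nra.
Qed.

(** Only the excursion straddling mid-time matters: if it leaves a fraction of the
    system uncovered it is beaten by [short_exponent], otherwise by Chernoff's
    bound at a time where the path deviates. *)
Lemma case_delocalized lam sigma : 0 <= lam -> 0 < sigma -> F lam < G sigma ->
  forall eps, 0 < eps -> exists2 delta : R, 0 < delta &
  \forall N \near \oo,
    mu lam sigma (fun xi : zpath N => eps < deviation sigma xi) <= expR (- (delta * N%:R)).
Proof.
move=> l0 s0 FG eps e0.
have [rho r01 [lr rG]] := pin_rate_below l0 FG.
pose lam1 := Num.max lam 1; rewrite -/lam1 in lr.
have l1 : 0 < lam1 by rewrite lt_max ltr01 orbT.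
have ll : 0 <= lam <= lam1 by rewrite l0 le_max lexx.
pose F0 := pin_rate rho; pose D := G sigma - F0.
have F00 : 0 < F0 by exact: pin_rate_gt0.
have D0 : 0 < D by rewrite subr_gt0.
have GE : G sigma = F0 + D by rewrite /D addrC subrK.
have G0 := G_gt0 s0.
have GD : G sigma <= pin_rate rho + D by rewrite GE.
have [C C0 HY] := Y_le s0 r01 (ltW l1) lr (ltW D0) GD.
have [delta [c [N1 [d0 c0 Hdev]]]] := Z_on_deviation l1 s0 (ltW F00) (ltW D0) C0 HY e0.
have [a a0 [N2 HZ]] := Z_ge_height s0.
pose c1 := Num.min (G sigma * (delta / 2) / 4) (D / 8).
have c10 : 0 < c1 by rewrite lt_min !divr_gt0 // mulr_gt0 // divr_gt0.
pose c' := Num.min (2 * c1) c.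
have c'0 : 0 < c' by rewrite lt_min mulr_gt0.
apply: (@mu_exp_small lam lam1 sigma (G sigma) _ a (63 * (2 * C ^+ 2)) c' (maxn N1 N2).+1) => //.
- by rewrite mulr_ge0 // mulr_ge0 // sqr_ge0.
- by move=> N; rewrite gtn_max => /andP[_ N2N]; exact: HZ (ltnW N2N) _ l0.
move=> N; rewrite gtn_max => /andP[N1N N2N].
have N0 : (0 < N)%N by apply: leq_trans N1N.
have NR : 0 < N%:R :> R by rewrite ltr0n.
have LR : (2 * N)%:R = 2 * N%:R :> R by rewrite natrM.
have C20 : 0 <= C ^+ 2 by exact: sqr_ge0.
pose K := C ^+ 2 * expR ((2 * N)%:R * G sigma - c1 * (2 * N)%:R).
have K0 : 0 <= K by rewrite mulr_ge0 ?expR_ge0.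
pose P s e := (s < N <= e)%N.
have HK s e : (s < e <= 2 * N)%N -> P s e -> delta * N%:R < (2 * N - (e - s))%:R ->
    Z_on lam1 sigma (@excb N s e anywhere) <= K.
  move=> se /andP[sN Ne] short; have /andP[slte eN] := se.
  have nN : (e - s <= 2 * N)%N by apply: leq_trans (leq_subr _ _) eN.
  have ex : exc (sigma / N%:R) anywhere (e - s) <= expR ((e - s)%:R ^+ 2 / (2 * N)%:R * G sigma).
    by apply: (le_trans (exc_le _ _ _)); rewrite ler_expR ltilt_le_sqr.
  apply: (le_trans (Z_on_exc_le l1 HY N0 se ex)).
  rewrite -mulrA ler_wpM2l // -expRD ler_expR.
  set r := (2 * N - e)%N.
  have gE : (2 * N - (e - s))%:R = s%:R + r%:R :> R.
    by rewrite -natrD; congr (_%:R); rewrite /r; clear -slte eN; lia.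
  apply: short_exponent => //; rewrite ?(ltW F00) ?(ltW D0) ?LR ?mulr_gt0 ?divr_gt0 //.
  + by rewrite mulrC mulKf ?pnatr_eq0 // ler0n ler_nat ltnW.
  + rewrite mulrC mulKf ?pnatr_eq0 // ler0n ler_nat /r; clear -Ne eN; lia.
  + by rewrite -LR -!natrD; congr (_%:R); rewrite /r; clear -slte eN; lia.
  + by rewrite mulrA divfK ?pnatr_eq0 // -gE ltW.
have HE xi : xi \in Omega N -> eps < deviation sigma xi -> eps < deviation sigma xi /\
     exists s e, [/\ (s < e <= 2 * N)%N, P s e, hgt xi s = 0%N &
       forall u, (s < u <= e)%N -> (hgt xi u == 0%N) = (u == e)].
  move=> xiO dev; split => //.
  have N02 : (0 < N <= 2 * N)%N by rewrite N0 leq_pmull.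
  have [s [e [sN /andP[Ne eN] hs H]]] := exc_around xiO N02.
  by exists s, e; split => //; rewrite ?eN ?(leq_trans sN Ne) // /P sN.
apply: (le_trans (Hdev N (ltnW N1N) P K _ K0 HK HE)).
have N3 : 0 <= N%:R ^+ 3 :> R by rewrite exprn_ge0 // ltW.
have -> : 63 * (2 * C ^+ 2) * N%:R ^+ 3 * expR ((2 * N)%:R * G sigma - c' * N%:R) =
   63 * N%:R ^+ 3 * (C ^+ 2 * expR ((2 * N)%:R * G sigma - c' * N%:R) +
     C ^+ 2 * expR ((2 * N)%:R * G sigma - c' * N%:R)) by ring.
rewrite ler_wpM2l ?mulr_ge0 // lerD // ler_wpM2l // ler_expR lerD2l lerN2.
  rewrite LR mulrA ler_wpM2r ?(ltW NR) // mulrC; by rewrite ge_min lexx.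
by rewrite ler_wpM2r ?(ltW NR) // ge_min lexx orbT.
Qed.

End Delocalised.

(** * The localised and critical regimes *)

Section Localized.
Variable R : realType.
Implicit Types (lam sigma eps : R).

(** When [G sigma <= F lam] no excess [D] over the pinned rate is needed: the
    pinned partition function keeps the rate that it has without field. *)
Lemma localized_setup lam sigma : 0 < sigma -> 2 < lam -> G sigma <= F lam ->
  exists2 C : R, 0 < C & forall N m, (0 < N)%N -> (m <= 2 * N)%N ->
    Y (sigma / N%:R) lam m <= C * expR (m%:R * F lam + 0 * m%:R ^+ 2 / (2 * N)%:R).
Proof.
move=> s0 l2 GF; have [r01 lr] := pin_ratio l2.
have l0 : 0 <= lam by lra.
have lr1 : (lam - 1) * (Num.sqrt (lam - 1))^-1 ^+ 2 <= 1 by rewrite lr.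
have GD : G sigma <= pin_rate (Num.sqrt (lam - 1))^-1 + 0 by rewrite addr0 -F_pin_rate.
have [C C0 H] := Y_le s0 r01 l0 lr1 (lexx 0) GD.
by exists C => // N m N0 mN; rewrite F_pin_rate //; exact: H.
Qed.

(** The two pinned sides of the excursion cover the remaining steps. *)
Lemma Z_on_exc_pinned lam sigma C N s e K : 0 < lam -> (0 < N)%N -> (s < e <= 2 * N)%N ->
  (forall N m, (0 < N)%N -> (m <= 2 * N)%N ->
    Y (sigma / N%:R) lam m <= C * expR (m%:R * F lam + 0 * m%:R ^+ 2 / (2 * N)%:R)) ->
  exc (sigma / N%:R) anywhere (e - s) <= K ->
  Z_on lam sigma (@excb N s e anywhere) <=
  C ^+ 2 * expR (((2 * N)%:R - (e - s)%:R) * F lam) * K.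
Proof.
move=> l0 N0 se HY HK; apply: (le_trans (Z_on_exc_le l0 HY N0 se HK)).
have /andP[slte eN] := se.
have -> : s%:R + (2 * N - e)%:R = (2 * N)%:R - (e - s)%:R :> R.
  by rewrite (natrB _ eN) (natrB _ (ltnW slte)); ring.
by rewrite mul0r mul0r addr0.
Qed.

Lemma Z_on_height_sum lam sigma N (k : R) : 0 <= lam -> 0 <= k ->
  Z_on lam sigma (fun xi : zpath N => k < (height xi)%:R) <=
  \sum_(s < (2 * N).+1) \sum_(e < (2 * N).+1)
    (if (s < e)%N && (k < (e - s)%:R) then Z_on lam sigma (@excb N s e anywhere) else 0).
Proof.
move=> l0 k0; pose I : finType := ('I_(2 * N).+1 * 'I_(2 * N).+1)%type.
pose Ei (i : I) : pred (zpath N) := fun xi =>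
  ((i.1 < i.2)%N && (k < (i.2 - i.1)%:R)) && excb i.1 i.2 anywhere xi.
have cover xi : xi \in Omega N -> k < (height xi)%:R -> exists i : I, Ei i xi.
  move=> xiO hk; have [s [e [/andP[se eN] kse hs H]]] := exc_of_height xiO k0 hk.
  have sL : (s < (2 * N).+1)%N by rewrite ltnS (leq_trans (ltnW se)).
  have eL : (e < (2 * N).+1)%N by rewrite ltnS.
  have N0 : (0 < N)%N by clear -se eN; lia.
  exists (Ordinal sL, Ordinal eL); rewrite /Ei /= se kse /=.
  apply: excbP => //; first by rewrite se.
  by move=> u /H ->; rewrite eqxx.
apply: le_trans (@Z_on_union R lam sigma N I (fun xi : zpath N => k < (height xi)%:R) Ei l0 cover) _.
rewrite pair_bigA /=; apply: ler_sum => -[s e] _ /=.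
case: ifP => c; last by rewrite Z_on_pred0 // => xi; rewrite /Ei /= c.
by apply: Z_on_le => // xi _ /andP[].
Qed.

Lemma card_pairs_le (N : nat) (K : R) (T : nat -> nat -> R) : (0 < N)%N -> 0 <= K ->
  (forall s e, (s <= 2 * N)%N -> (e <= 2 * N)%N -> T s e <= K) ->
  \sum_(s < (2 * N).+1) \sum_(e < (2 * N).+1) T s e <= 9 * N%:R ^+ 2 * K.
Proof.
move=> N0 K0 H; apply: (@le_trans _ _ (\sum_(s < (2 * N).+1) \sum_(e < (2 * N).+1) K)).
  by apply: ler_sum => s _; apply: ler_sum => e _; apply: H; rewrite -ltnS ltn_ord.
rewrite !sumr_const card_ord -mulrnA -[X in X <= _]mulr_natl ler_wpM2r //.
have -> : 9 * N%:R ^+ 2 = (9 * N ^ 2)%:R :> R by rewrite natrM natrX.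
rewrite ler_nat (_ : 9 * N ^ 2 = 3 * N * (3 * N))%N; last by rewrite mulnACA.
by apply: leq_mul; clear -N0; lia.
Qed.

Lemma exc_le_G sigma N s e : 0 < sigma -> (0 < N)%N -> (s < e <= 2 * N)%N ->
  exc (sigma / N%:R) anywhere (e - s) <=
    expR ((e - s)%:R ^+ 2 / (2 * N)%:R * G sigma).
Proof.
move=> s0 N0 /andP[_ eN]; apply: (le_trans (exc_le _ _ _)).
by rewrite ler_expR ltilt_le_sqr // (leq_trans (leq_subr _ _)).
Qed.

(** An excursion of [n >= eps N] steps gains at most [n G] and gives up [n F]. *)
Lemma case_localized lam sigma : 0 <= lam -> 0 < sigma -> G sigma < F lam ->
  forall eps, 0 < eps -> exists2 delta : R, 0 < delta &
  \forall N \near \oo,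
    mu lam sigma (fun xi : zpath N => eps * N%:R < (height xi)%:R) <= expR (- (delta * N%:R)).
Proof.
move=> l0 s0 GF eps e0.
have l2 : 2 < lam.
  by rewrite ltNge; apply/negP => l2; have := G_gt0 s0; move: GF; rewrite /F (ltNge 2) l2 /=; lra.
have l1 : 0 < lam by lra.
have [C C0 HY] := localized_setup s0 l2 (ltW GF).
have [a a0 HZ] := Z_ge_pin_sqrt l2 s0.
have gap : 0 < F lam - G sigma by rewrite subr_gt0.
apply: (@mu_exp_small R lam lam sigma (F lam) _ a (9 * C ^+ 2) (eps * (F lam - G sigma)) 1) => //.
- by rewrite l0 lexx.
- by rewrite mulr_ge0 // sqr_ge0.
- exact: mulr_gt0.
move=> N N0; have NR : 0 < N%:R :> R by rewrite ltr0n.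
have NR1 : 1 <= N%:R :> R by rewrite ler1n.
have LR : (2 * N)%:R = 2 * N%:R :> R by rewrite natrM.
have C20 : 0 <= C ^+ 2 by exact: sqr_ge0.
pose K := C ^+ 2 * expR ((2 * N)%:R * F lam - eps * (F lam - G sigma) * N%:R).
have K0 : 0 <= K by rewrite mulr_ge0 ?expR_ge0.
have k0 : 0 <= eps * N%:R by rewrite mulr_ge0 // ltW.
apply: (le_trans (Z_on_height_sum sigma N l0 k0)).
apply: (@le_trans _ _ (9 * N%:R ^+ 2 * K)); last first.
  have -> : 9 * C ^+ 2 * N%:R ^+ 3 * expR ((2 * N)%:R * F lam - eps * (F lam - G sigma) * N%:R)
    = N%:R * (9 * N%:R ^+ 2 * K) by rewrite /K; ring.
  by rewrite ler_peMl // (mulr_ge0 _ K0) // mulr_ge0 // sqr_ge0.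
apply: (@card_pairs_le N K (fun s e => if (s < e)%N && (eps * N%:R < (e - s)%:R) then
  Z_on lam sigma (@excb N s e anywhere) else 0)) => // s e _ eN.
case: ifP => // /andP[se long].
have seN : (s < e <= 2 * N)%N by rewrite se.
apply: (le_trans (Z_on_exc_pinned l1 N0 seN HY (exc_le_G s0 N0 seN))).
rewrite -mulrA ler_wpM2l // -expRD ler_expR.
set n := (e - s)%:R in long *.
have nL : n <= (2 * N)%:R by rewrite ler_nat (leq_trans (leq_subr _ _)).
have n0 : 0 <= n by exact: ler0n.
have sq : n ^+ 2 / (2 * N)%:R <= n.
  by rewrite ler_pdivrMr ?LR ?mulr_gt0 // -LR expr2 ler_wpM2l.
have h1 := ler_wpM2r (ltW (G_gt0 s0)) sq.
have h2 := ler_wpM2r (ltW gap) (ltW long).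
lra.
Qed.

(** At criticality an excursion of [n] steps loses [F n (2 N - n) / (2 N)], which is
    exponential unless it almost fills the system; then the profile is forced. *)
Lemma case_critical_deviation lam sigma : 0 <= lam -> 0 < sigma -> G sigma = F lam ->
  forall eps, 0 < eps -> exists2 delta : R, 0 < delta &
  \forall N \near \oo,
    mu lam sigma (fun xi : zpath N => (eps * N%:R < (height xi)%:R) && (eps < deviation sigma xi))
      <= expR (- (delta * N%:R)).
Proof.
move=> l0 s0 GF eps e0.
have G0 := G_gt0 s0.
have l2 : 2 < lam.
  by rewrite ltNge; apply/negP => l2; move: GF; rewrite /F (ltNge 2) l2 /=; lra.
have l1 : 0 < lam by lra.
have GFle : G sigma <= F lam by rewrite GF.
have [C C0 HY] := localized_setup s0 l2 GFle.
have [a a0 HZ] := Z_ge_pin_sqrt l2 s0.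
have F0 := F_gt0 l2.
have [delta [c [N1 [d0 c0 Hdev]]]] := Z_on_deviation l1 s0 (ltW F0) (lexx 0) C0 HY e0.
pose c1 := F lam * eps * (delta / 2).
have c10 : 0 < c1 by rewrite mulr_gt0 ?divr_gt0 // mulr_gt0.
pose c' := Num.min c1 c; have c'0 : 0 < c' by rewrite lt_min c10.
apply: (@mu_exp_small R lam lam sigma (F lam) _ a (63 * (2 * C ^+ 2)) c' N1.+1) => //.
- by rewrite l0 lexx.
- by rewrite mulr_ge0 // mulr_ge0 // sqr_ge0.
- by move=> N N1N; apply: HZ; exact: leq_trans N1N.
move=> N N1N; have N0 : (0 < N)%N by apply: leq_trans N1N.
have NR : 0 < N%:R :> R by rewrite ltr0n.
have LR : (2 * N)%:R = 2 * N%:R :> R by rewrite natrM.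
have C20 : 0 <= C ^+ 2 by exact: sqr_ge0.
pose K := C ^+ 2 * expR ((2 * N)%:R * F lam - c1 * N%:R).
have K0 : 0 <= K by rewrite mulr_ge0 ?expR_ge0.
pose P s e := eps * N%:R < (e - s)%:R.
have HK s e : (s < e <= 2 * N)%N -> P s e -> delta * N%:R < (2 * N - (e - s))%:R ->
    Z_on lam sigma (@excb N s e anywhere) <= K.
  move=> se; rewrite /P => long short; have /andP[slte eN] := se.
  have nN : (e - s <= 2 * N)%N by apply: leq_trans (leq_subr _ _) eN.
  apply: (le_trans (Z_on_exc_pinned l1 N0 se HY (exc_le_G s0 N0 se))).
  rewrite -mulrA ler_wpM2l // -expRD ler_expR GF.
  rewrite natrB // in short; set n := (e - s)%:R in long short *.
  have -> : ((2 * N)%:R - n) * F lam + n ^+ 2 / (2 * N)%:R * F lam =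
    (2 * N)%:R * F lam - n * ((2 * N)%:R - n) / (2 * N)%:R * F lam.
    by rewrite LR; field; rewrite gt_eqF.
  rewrite lerD2l lerN2.
  have -> : c1 * N%:R = (eps * N%:R) * (delta * N%:R) / (2 * N)%:R * F lam.
    by rewrite /c1 LR; field; rewrite gt_eqF.
  rewrite ler_wpM2r ?(ltW F0) // ler_wpM2r ?invr_ge0 ?ler0n //.
  by apply: ler_pM; rewrite ?mulr_ge0 ?(ltW NR) // ltW.
have HE xi : xi \in Omega N -> (eps * N%:R < (height xi)%:R) && (eps < deviation sigma xi) ->
     eps < deviation sigma xi /\
     exists s e, [/\ (s < e <= 2 * N)%N, P s e, hgt xi s = 0%N &
       forall u, (s < u <= e)%N -> (hgt xi u == 0%N) = (u == e)].
  move=> xiO /andP[hh dev]; split => //.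
  have k0 : 0 <= eps * N%:R by rewrite mulr_ge0 // ltW.
  by have [s [e [se kse hs H]]] := exc_of_height xiO k0 hh; exists s, e.
apply: (le_trans (Hdev N (ltnW N1N) P K _ K0 HK HE)).
have N3 : 0 <= N%:R ^+ 3 :> R by rewrite exprn_ge0 // ltW.
have -> : 63 * (2 * C ^+ 2) * N%:R ^+ 3 * expR ((2 * N)%:R * F lam - c' * N%:R) =
   63 * N%:R ^+ 3 * (C ^+ 2 * expR ((2 * N)%:R * F lam - c' * N%:R) +
     C ^+ 2 * expR ((2 * N)%:R * F lam - c' * N%:R)) by ring.
rewrite GF ler_wpM2l ?mulr_ge0 // lerD // ler_wpM2l // ler_expR lerD2l lerN2.
  by rewrite ler_wpM2r ?(ltW NR) // ge_min lexx.
by rewrite ler_wpM2r ?(ltW NR) // ge_min lexx orbT.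
Qed.

(** For [n >= N] the loss [F n (2 N - n) / (2 N)] is at least [F / 2] per uncovered
    step, whence a factor geometric in the lengths of both sides, while the sharp
    excursion bound provides the factor [1 / sqrt N]. *)
Lemma Z_on_long_exc_le lam sigma C : 0 < sigma -> 2 < lam -> G sigma = F lam ->
  (forall N m, (0 < N)%N -> (m <= 2 * N)%N ->
    Y (sigma / N%:R) lam m <= C * expR (m%:R * F lam + 0 * m%:R ^+ 2 / (2 * N)%:R)) ->
  exists2 A : R, 0 < A & forall N s e, (0 < N)%N -> (s < e <= 2 * N)%N -> (N <= e - s)%N ->
  Z_on lam sigma (@excb N s e anywhere) <=
    A / Num.sqrt N%:R * expR ((2 * N)%:R * F lam) *
    (expR (- (F lam / 2)) ^+ s * expR (- (F lam / 2)) ^+ (2 * N - e)).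
Proof.
move=> s0 l2 GF HY; have l1 : 0 < lam by lra.
have F0 := F_gt0 l2.
have [B B0 HB] := exc_le_sharp s0.
exists (C ^+ 2 * (2 * B) + 1).
  by rewrite ltr_wpDl // mulr_ge0 ?sqr_ge0 // mulr_ge0 // ltW.
move=> N s e N0 se Nn; have /andP[slte eN] := se.
have NR : 0 < N%:R :> R by rewrite ltr0n.
have LR : (2 * N)%:R = 2 * N%:R :> R by rewrite natrM.
have sN0 : 0 < Num.sqrt N%:R :> R by rewrite sqrtr_gt0.
have C20 : 0 <= C ^+ 2 by exact: sqr_ge0.
set z := expR (- (F lam / 2)).
pose n := (e - s)%N; have nN : (n <= 2 * N)%N by apply: leq_trans (leq_subr _ _) eN.
have ex : exc (sigma / N%:R) anywhere n <=
    2 * B / Num.sqrt N%:R * expR (n%:R ^+ 2 / (2 * N)%:R * G sigma).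
  have [on|en] := boolP (odd n).
    rewrite exc_odd //; apply: mulr_ge0 (expR_ge0 _).
    by apply: divr_ge0 (ltW sN0); rewrite mulr_ge0 // ltW.
  have nE : n = (n./2 + n./2)%N by rewrite addnn -[LHS]odd_double_half (negbTE en).
  have k0 : (0 < n./2)%N by rewrite half_gt0; clear -Nn nE N0; rewrite /n in nE *; lia.
  have kN : (n./2 <= N)%N by clear -nN nE; lia.
  have Nk : (N <= 4 * n./2)%N by clear -Nn nE; rewrite /n in nE *; lia.
  have h0 : 0 <= sigma / N%:R by rewrite divr_ge0 // ltW.
  have hk : sigma / N%:R * (n./2)%:R <= sigma.
    by rewrite mulrAC ler_pdivrMr // ler_wpM2l ?(ltW s0) // ler_nat.
  have := HB _ _ h0 hk k0; rewrite -nE => /le_trans; apply.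
  have kR : 0 < (n./2)%:R :> R by rewrite ltr0n.
  have sk0 : 0 < Num.sqrt (n./2)%:R :> R by rewrite sqrtr_gt0.
  apply: ler_pM; rewrite ?expR_ge0 //; first by rewrite divr_ge0 ?(ltW B0) ?(ltW sk0).
    rewrite ler_pdivrMr // mulrAC ler_pdivlMr // [2 * B]mulrC -mulrA.
    rewrite ler_wpM2l ?(ltW B0) //.
    rewrite -ler_sqr ?nnegrE ?mulr_ge0 ?(ltW sN0) ?(ltW sk0) //.
    rewrite exprMn !sqr_sqrtr ?(ltW NR) ?(ltW kR) //.
    by rewrite -natrX -natrM ler_nat.
  by rewrite ler_expR ltilt_le_sqr.
apply: (le_trans (Z_on_exc_pinned l1 N0 se HY ex)); rewrite -/n.
set r := (2 * N - e)%N.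
have zz : z ^+ s * z ^+ r = expR (- (F lam / 2 * ((2 * N)%:R - n%:R))).
  rewrite -exprD /z -expRM_natl; congr expR.
  have -> : (s + r)%:R = (2 * N)%:R - n%:R :> R.
    by rewrite -natrB //; congr (_%:R); rewrite /r /n; clear -slte eN; lia.
  by ring.
rewrite zz.
have -> : C ^+ 2 * expR (((2 * N)%:R - n%:R) * F lam) *
   (2 * B / Num.sqrt N%:R * expR (n%:R ^+ 2 / (2 * N)%:R * G sigma)) =
  C ^+ 2 * (2 * B) / Num.sqrt N%:R * expR (((2 * N)%:R - n%:R) * F lam + n%:R ^+ 2 / (2 * N)%:R * G sigma).
  by rewrite expRD; ring.
rewrite -[X in _ <= X]mulrA -expRD.
have nR : N%:R <= n%:R :> R by rewrite ler_nat.
have nLR : n%:R <= (2 * N)%:R :> R by rewrite ler_nat.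
apply: ler_pM; rewrite ?expR_ge0 //.
- by rewrite divr_ge0 ?(ltW sN0) // mulr_ge0 // mulr_ge0 // ltW.
- by rewrite ler_wpM2r ?invr_ge0 ?(ltW sN0) // lerDl.
rewrite ler_expR GF -subr_ge0.
have -> : (2 * N)%:R * F lam + - (F lam / 2 * ((2 * N)%:R - n%:R)) -
   (((2 * N)%:R - n%:R) * F lam + n%:R ^+ 2 / (2 * N)%:R * F lam) =
   F lam * ((2 * N)%:R - n%:R) * (n%:R - N%:R) / (2 * N)%:R.
  by rewrite LR; field; rewrite gt_eqF.
by rewrite !mulr_ge0 ?invr_ge0 ?ler0n ?subr_ge0 ?(ltW F0).
Qed.

Lemma sum_pow_ord_le (z : R) n : 0 <= z < 1 -> \sum_(i < n) z ^+ i <= (1 - z)^-1.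
Proof. by move=> z01; rewrite -(big_mkord xpredT (fun i => z ^+ i)) geometric_le. Qed.

(** The geometric factors make the number of positions of a long excursion
    irrelevant; excursions between [eps N] and [N] lose exponentially. *)
Lemma case_critical_upper lam sigma : 0 <= lam -> 0 < sigma -> G sigma = F lam ->
  exists2 C : R, 0 < C & forall eps, 0 < eps -> exists N0, forall N, (N0 <= N)%N ->
    mu lam sigma (fun xi : zpath N => eps * N%:R < (height xi)%:R) <= C / Num.sqrt N%:R.
Proof.
move=> l0 s0 GF; have G0 := G_gt0 s0.
have l2 : 2 < lam.
  by rewrite ltNge; apply/negP => l2; move: GF; rewrite /F (ltNge 2) l2 /=; lra.
have l1 : 0 < lam by lra.
have GFle : G sigma <= F lam by rewrite GF.
have [C C0 HY] := localized_setup s0 l2 GFle.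
have [a a0 HZ] := Z_ge_pin l2 s0.
have F0 := F_gt0 l2.
have [A A0 HA] := Z_on_long_exc_le s0 l2 GF HY.
pose z := expR (- (F lam / 2)).
have z01 : 0 <= z < 1 by rewrite expR_ge0 expR_lt1 oppr_lt0 divr_gt0.
pose q := (1 - z)^-1; have q0 : 0 < q by rewrite invr_gt0 subr_gt0; case/andP: z01.
exists ((A * q ^+ 2 + 1) / a); first by rewrite divr_gt0 // addr_gt0 // mulr_gt0 // exprn_gt0.
move=> eps e0.
pose c := F lam * eps / 2; have c0 : 0 < c by rewrite divr_gt0 // mulr_gt0.
have C20 : 0 <= C ^+ 2 by exact: sqr_ge0.
pose f (N : nat) : R := Num.sqrt N%:R * (9 * N%:R ^+ 2 * (C ^+ 2 * expR (- (c * N%:R)))).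
have [delta d0 [N1 _ HN1]] : exists2 delta : R, 0 < delta &
    \forall N \near \oo, f N <= expR (- (delta * N%:R)).
  apply: (@poly_exp_eventually R (9 * C ^+ 2) c) => //; first by rewrite mulr_ge0.
  exists 1%N => N N0; rewrite /f.
  have NR1 : 1 <= N%:R :> R by rewrite ler1n.
  have sN : Num.sqrt N%:R <= N%:R ^+ 2 :> R.
    rewrite -ler_sqr ?nnegrE ?sqrtr_ge0 ?exprn_ge0 // sqr_sqrtr // -exprM.
    by rewrite -[X in X <= _]expr1 ler_weXn2l.
  have -> : 9 * C ^+ 2 * N%:R ^+ 4 * expR (- (c * N%:R)) =
     N%:R ^+ 2 * (9 * N%:R ^+ 2 * (C ^+ 2 * expR (- (c * N%:R)))) by ring.
  apply: ler_wpM2r sN.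
  by apply: mulr_ge0; [rewrite mulr_ge0 ?exprn_ge0 | rewrite mulr_ge0 ?expR_ge0].
exists N1.+1 => N N1N; have N0 : (0 < N)%N by apply: leq_trans N1N.
have NR : 0 < N%:R :> R by rewrite ltr0n.
have LR : (2 * N)%:R = 2 * N%:R :> R by rewrite natrM.
have sN0 : 0 < Num.sqrt N%:R :> R by rewrite sqrtr_gt0.
have f1 : f N <= 1.
  by apply: le_trans (HN1 N (ltnW N1N)) _; rewrite expR_le1 oppr_le0 mulr_ge0 // ltW.
set X := expR ((2 * N)%:R * F lam).
have X0 : 0 < X by exact: expR_gt0.
have Z0 : 0 < Z lam sigma N by apply: lt_le_trans (HZ N N0); rewrite mulr_gt0.
rewrite mu_W ler_pdivrMr //.
have k0 : 0 <= eps * N%:R by rewrite mulr_ge0 // ltW.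
apply: (le_trans (Z_on_height_sum sigma N l0 k0)).
pose K := C ^+ 2 * (X * expR (- (c * N%:R))).
have K0 : 0 <= K by rewrite mulr_ge0 // mulr_ge0 ?expR_ge0.
pose T s e := A / Num.sqrt N%:R * X * (z ^+ s * z ^+ (2 * N - e)).
have T0 s e : 0 <= T s e.
  have /andP[zz _] := z01.
  by apply: mulr_ge0; [rewrite mulr_ge0 ?divr_ge0 ?(ltW A0) ?(ltW X0) ?(ltW sN0) |
    rewrite mulr_ge0 ?exprn_ge0].
apply: (@le_trans _ _ (\sum_(s < (2 * N).+1) \sum_(e < (2 * N).+1) (T s e + K))).
  apply: ler_sum => s _; apply: ler_sum => e _.
  case: ifP => [/andP[se long]|_]; last by rewrite addr_ge0.
  have eN : (e <= 2 * N)%N by rewrite -ltnS ltn_ord.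
  have seN : (s < e <= 2 * N)%N by rewrite se.
  have [Nn|nN] := leqP N (e - s).
    by apply: (le_trans (HA N s e N0 seN Nn)); rewrite lerDl.
  apply: (@le_trans _ _ K); last by rewrite lerDr.
  apply: (le_trans (Z_on_exc_pinned l1 N0 seN HY (exc_le_G s0 N0 seN))).
  rewrite /K /X -mulrA ler_wpM2l // -!expRD ler_expR GF.
  have nR : (e - s)%:R <= N%:R :> R by rewrite ler_nat ltnW.
  set n := (e - s)%:R in long nR *.
  have -> : ((2 * N)%:R - n) * F lam + n ^+ 2 / (2 * N)%:R * F lam =
    (2 * N)%:R * F lam - n * ((2 * N)%:R - n) / (2 * N)%:R * F lam.
    by rewrite LR; field; rewrite gt_eqF.
  rewrite lerD2l lerN2.
  have -> : c * N%:R = (eps * N%:R) * N%:R / (2 * N)%:R * F lam.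
    by rewrite /c LR; field; rewrite gt_eqF.
  rewrite ler_wpM2r ?(ltW F0) // ler_wpM2r ?invr_ge0 ?ler0n //.
  by apply: ler_pM; rewrite ?(ltW NR) ?(ltW long) // LR; lra.
under eq_bigr do rewrite big_split /=.
rewrite big_split /=.
have S1 : \sum_(s < (2 * N).+1) \sum_(e < (2 * N).+1) T s e <= A / Num.sqrt N%:R * X * q ^+ 2.
  have -> : \sum_(s < (2 * N).+1) \sum_(e < (2 * N).+1) T s e =
      A / Num.sqrt N%:R * X * ((\sum_(s < (2 * N).+1) z ^+ s) * (\sum_(e < (2 * N).+1) z ^+ (2 * N - e))).
    rewrite mulr_suml mulr_sumr; apply: eq_bigr => s _.
    by rewrite mulr_sumr mulr_sumr; apply: eq_bigr => e _.
  have rev : \sum_(e < (2 * N).+1) z ^+ (2 * N - e) = \sum_(e < (2 * N).+1) z ^+ e.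
    rewrite (reindex_inj rev_ord_inj) /=; apply: eq_bigr => e _.
    by rewrite subSS subKn // -ltnS.
  rewrite rev ler_wpM2l ?mulr_ge0 ?divr_ge0 ?(ltW A0) ?(ltW X0) ?(ltW sN0) //.
  have /andP[zz _] := z01.
  rewrite expr2; apply: ler_pM; rewrite ?sum_pow_ord_le //; apply: sumr_ge0 => i _; exact: exprn_ge0.
have S2 : \sum_(s < (2 * N).+1) \sum_(e < (2 * N).+1) K <= X / Num.sqrt N%:R.
  apply: (le_trans (@card_pairs_le N K (fun _ _ => K) N0 K0 (fun _ _ _ _ => lexx _))).
  rewrite ler_pdivlMr //.
  have -> : 9 * N%:R ^+ 2 * K * Num.sqrt N%:R = X * f N by rewrite /K /f; ring.
  by rewrite ler_piMr // ltW.
apply: (le_trans (lerD S1 S2)).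
have c3 : 0 <= (A * q ^+ 2 + 1) / a / Num.sqrt N%:R.
  by rewrite !divr_ge0 ?(ltW a0) ?(ltW sN0) // addr_ge0 // mulr_ge0 ?(ltW A0) ?sqr_ge0.
apply: le_trans (ler_wpM2l c3 (HZ N N0)).
rewrite -/X le_eqVlt; apply/orP; left; apply/eqP.
by field; rewrite !gt_eqF.
Qed.

(** Full-length excursions weigh [exp (2 N G) / sqrt N], and the whole partition
    function at most [exp (2 N F) = exp (2 N G)], up to constants. *)
Lemma case_critical_lower lam sigma : 0 <= lam -> 0 < sigma -> G sigma = F lam ->
  exists2 a : R, 0 < a & forall eps, 0 < eps -> eps < M sigma 1 ->
  exists N0, forall N, (N0 <= N)%N ->
    a / Num.sqrt N%:R <= mu lam sigma (fun xi : zpath N => eps * N%:R < (height xi)%:R).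
Proof.
move=> l0 s0 GF; have G0 := G_gt0 s0.
have l2 : 2 < lam.
  by rewrite ltNge; apply/negP => l2; move: GF; rewrite /F (ltNge 2) l2 /=; lra.
have l1 : 0 < lam by lra.
have GFle : G sigma <= F lam by rewrite GF.
have [C C0 HY] := localized_setup s0 l2 GFle.
have [c c0 Hc] := Z_on_height_ge s0.
have [b b0 HZ] := Z_ge_pin l2 s0.
exists (c * lam / C); first by rewrite divr_gt0 // mulr_gt0.
move=> eps e0 eM; have [N0 HN0] := Hc eps (ltW e0) eM.
exists N0.+1 => N N0N; have N0' : (0 < N)%N by apply: leq_trans N0N.
have sN0 : 0 < Num.sqrt N%:R :> R by rewrite sqrtr_gt0 ltr0n.
have Z0 : 0 < Z lam sigma N by apply: lt_le_trans (HZ N N0'); rewrite mulr_gt0 ?expR_gt0.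
rewrite mu_W ler_pdivlMr //.
apply: le_trans (HN0 N (ltnW N0N) lam l0).
have ZC : lam * Z lam sigma N <= C * expR ((2 * N)%:R * G sigma).
  have := HY N (2 * N)%N N0' (leqnn _); rewrite -weight_total // !mul0r addr0 -GF.
  by [].
have -> : c * lam / C / Num.sqrt N%:R * Z lam sigma N =
  c / C / Num.sqrt N%:R * (lam * Z lam sigma N) by ring.
have c3 : 0 <= c / C / Num.sqrt N%:R by rewrite !divr_ge0 // ltW.
apply: (le_trans (ler_wpM2l c3 ZC)).
by rewrite le_eqVlt; apply/orP; left; apply/eqP; field; rewrite !gt_eqF.
Qed.

End Localized.

Theorem theorem2p4 (R : realType) (lambda sigma : R)
    (lambda_ge0 : 0 <= lambda) (sigma_gt0 : 0 < sigma) :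
  [/\ F lambda < G sigma ->
        forall eps : R, 0 < eps ->
        exists2 delta : R, 0 < delta &
        \forall N \near \oo,
          mu lambda sigma (fun xi : zpath N => eps < deviation sigma xi)
            <= expR (- (delta * N%:R)),
      G sigma < F lambda ->
        forall eps : R, 0 < eps ->
        exists2 delta : R, 0 < delta &
        \forall N \near \oo,
          mu lambda sigma (fun xi : zpath N => eps * N%:R < (height xi)%:R)
            <= expR (- (delta * N%:R))
    & G sigma = F lambda ->
        (exists2 C : R, 0 < C &
          forall eps : R, 0 < eps ->
          \forall N \near \oo,
            let p := mu lambda sigma
                       (fun xi : zpath N => eps * N%:R < (height xi)%:R) in
            (eps < M sigma 1 -> (C * Num.sqrt N%:R)^-1 <= p) /\
            p <= C / Num.sqrt N%:R) /\
        (forall eps : R, 0 < eps ->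
          exists2 delta : R, 0 < delta &
          \forall N \near \oo,
            mu lambda sigma
              (fun xi : zpath N => (eps * N%:R < (height xi)%:R)
                                       && (eps < deviation sigma xi))
              <= expR (- (delta * N%:R)))].
Proof.
split; [exact: case_delocalized | exact: case_localized | move=> GF].
split; last exact: case_critical_deviation.
have [C C0 Hup] := case_critical_upper lambda_ge0 sigma_gt0 GF.
have [a a0 Hlow] := case_critical_lower lambda_ge0 sigma_gt0 GF.
have a1 : 0 < a^-1 by rewrite invr_gt0.
exists (C + a^-1); first by rewrite addr_gt0.
move=> eps e0; have [N1 H1] := Hup eps e0.
have [N2 H2] : exists N2, forall N, (N2 <= N)%N -> eps < M sigma 1 ->
    a / Num.sqrt N%:R <= mu lambda sigma (fun xi : zpath N => eps * N%:R < (height xi)%:R).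
  have [eM|eM] := ltP eps (M sigma 1); last by exists 0%N.
  by have [N2 H2] := Hlow eps e0 eM; exists N2 => N N2N _; exact: H2.
exists (maxn N1 N2).+1 => // N /=; rewrite gtn_max => /andP[N1N N2N].
have s0 : 0 < Num.sqrt N%:R :> R by rewrite sqrtr_gt0 ltr0n (leq_trans _ N1N).
split.
  move=> eM; apply: le_trans (H2 N (ltnW N2N) eM).
  rewrite invfM ler_wpM2r ?invr_ge0 ?(ltW s0) //.
  by rewrite -[X in _ <= X]invrK lef_pV2 ?posrE ?addr_gt0 // lerDr ltW.
apply: le_trans (H1 N (ltnW N1N)) _.
by rewrite ler_wpM2r ?invr_ge0 ?(ltW s0) // lerDl ltW.
Qed.
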